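(* Consider the AdaSketch-Newton algorithm (defined in the context) applied to $\min_{x\in\mathbb{R}^n} f(x)$ subject to $c(x)=0$, with any input sequence $\{\theta_k\}\subseteq(0,1]$ such that $\theta_k\to0$ as $k\to\infty$. Let $z^\star=(x^\star,\lambda^\star)$ be a local solution, i.e. $x^\star$ is a local solution of the problem with Lagrange multiplier $\lambda^\star$ satisfying $\nabla f(x^\star)+G(x^\star)^T\lambda^\star=0$ and $c(x^\star)=0$. Assume: (i) the iterates $\{(x_k,\lambda_k)\}_{k\ge 0}$ are contained in a convex compact set $\mathcal{X}\times\Lambda$ such that over $\mathcal{X}$ the objective $f$ and the constraint $c$ are twice continuously differentiable with Lipschitz continuous Hessians; (ii) there exist absolute constants $\xi_G,\xi_B,\Upsilon_B>0$ such that for all $k$: $G_k$ has full row rank with $G_kG_k^T\succeq \xi_G I$, $u^TB_ku\ge \xi_B\|u\|^2$ for every $u$ with $G_ku=0$, and $\|B_k\|\le\Upsilon_B$; (iii) there exists a constant $\pi\in(0,1]$ such that the sketching matrices $S_{k,j}\sim S$ are iid and satisfy $P(S^Tu\ne 0)\ge\pi$ for every $u\in\mathbb{R}^{n+m}\setminus\{0\}$; (iv) $f$ and each coordinate of $c$ are thrice continuously differentiable over $\mathcal{X}$; (v) $\|H_k-B_k\|=O(\tau_k)$ for a sequence $\tau_k\to0$ as $k\to\infty$; (vi) $z_k\to z^\star$. Then for all sufficiently large $k$, $\alpha_k=1$ and $$\|z_{k+1}-z^\star\|\le O(\theta_k+\tau_k)\,\|z_k-z^\star\|+O\left(\|z_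k-z^\star\|^2\right).$$
   Context: Problem and notation. $f:\mathbb{R}^n\to\mathbb{R}$ and $c:\mathbb{R}^n\to\mathbb{R}^m$ are twice continuously differentiable. $\|\cdot\|$ is the $\ell_2$ norm for vectors and the operator norm for matrices; $a\vee b=\max\{a,b\}$, $a\wedge b=\min\{a,b\}$; $(\cdot)^\dagger$ is the Moore–Penrose pseudoinverse. $\mathcal{L}(x,\lambda)=f(x)+\lambda^Tc(x)$ is the Lagrangian, $H(x,\lambda)=\nabla_x^2\mathcal{L}(x,\lambda)\in\mathbb{R}^{n\times n}$, and $G(x)=\nabla^Tc(x)\in\mathbb{R}^{m\times n}$ is the Jacobian of $c$. Write $z=(x,\lambda)$; a subscript $k$ denotes evaluation at $z_k=(x_k,\lambda_k)$, so $\nabla\mathcal{L}_k=(\nabla_x\mathcal{L}_k,\,c_k)$. For $\eta=(\eta_1,\eta_2)$ the exact augmented Lagrangian is $$\mathcal{L}_\eta(x,\lambda)=\mathcal{L}(x,\lambda)+\tfrac{\eta_1}{2}\|c(x)\|^2+\tfrac{\eta_2}{2}\|\nabla_x\mathcal{L}(x,\lambda)\|^2,$$ and $\nabla\mathcal{L}^k_{\eta_k}$ is its gradient in $(x,\lambda)$ at $z_k$ with $\eta=\eta_k=(\eta_{1,k},\eta_{2,k})$. Newton system. $B_k\in\mathbb{R}^{n\times n}$ is a symmetric modification of $H_k$, $\Gamma_k=\begin{pmatrix} B_k & G_k^T \\ G_k & 0 \end{pmatrix}$, and the exact direction $\Delta z_k$ solves $\Gamma_k\Delta z_k=-\nabla\mathcal{L}_k$.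 Sketching solver. $S\in\mathbb{R}^{(n+m)\times d}$ is a random matrix with distribution $\mathcal{P}$ ($d$ may be random). At outer iteration $k$, start from $\tilde\Delta z_{k,0}=0$; at inner iteration $j$ draw a fresh independent copy $S_{k,j}$ of $S$ and set $$\tilde\Delta z_{k,j+1}=\tilde\Delta z_{k,j}-\Gamma_kS_{k,j}(S_{k,j}^T\Gamma_k^2S_{k,j})^\dagger S_{k,j}^Tr_{k,j},\qquad r_{k,j}=\Gamma_k\tilde\Delta z_{k,j}+\nabla\mathcal{L}_k.$$ Auxiliary quantities. With $\sigma_{1,k}$ the least singular value of $G_k$, $$\Psi_k=\frac{20(\|B_k\|^2\vee1)}{(\xi_B\wedge1)(\sigma_{1,k}^2\wedge1)},\quad \Upsilon_k=\|G_k\|\vee\|H_k\|\vee1,\quad \delta_k^{\mathrm{trial}}=\frac{(0.5-\beta)\eta_{2,k}}{(1+\eta_{1,k}+\eta_{2,k})\Upsilon_k^2\Psi_k^2}.$$ Accuracy condition: $\|r_{k,j}\|\le\theta_k\delta_k\|\nabla\mathcal{L}_k\|/(\|\Gamma_k\|\Psi_k)$. Descent direction condition: $(\nabla\mathcal{L}^k_{\eta_k})^T\tilde\Delta z_{k,j}\le-\eta_{2,k}\|\nabla\mathcal{L}_k\|^2/2$. AdaSketch-Newton algorithm. Inputs: initial $z_0$; a sequence $\{\theta_k\}\subseteq(0,1]$; scalars $\eta_{1,0},\eta_{2,0},\xi_B>0$, $\delta_0\in(0,1)$, $\beta\in(0,0.5)$, $\nu>1$. For $k=0,1,2,\dots$: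 (1) compute $f_k,\nabla f_k,c_k,G_k,H_k$, generate $B_k$, compute $\Psi_k,\Upsilon_k,\delta_k^{\mathrm{trial}}$, and set $\delta_k\leftarrow\delta_k\wedge\delta_k^{\mathrm{trial}}$; set the inexact direction to $0$. (2) Until both the accuracy condition and the descent direction condition hold: run the sketching update (continuing from the latest inexact direction) until the accuracy condition holds; then, if the descent direction condition fails, update $\eta_{1,k}\leftarrow\eta_{1,k}\nu^2$, $\eta_{2,k}\leftarrow\eta_{2,k}/\nu$, recompute $\delta_k^{\mathrm{trial}}$, and set $\delta_k\leftarrow(\delta_k/\nu^4)\wedge\delta_k^{\mathrm{trial}}$. (3) Let $\tilde\Delta z_k$ be the resulting direction. Choose $\alpha_k$ by backtracking line search, i.e. $\alpha_k$ is the largest element of $\{1,\rho,\rho^2,\dots\}$ (for a fixed $\rho\in(0,1)$) satisfying the Armijo condition $\mathcal{L}_{\eta_k}(z_k+\alpha_k\tilde\Delta z_k)\le\mathcal{L}_{\eta_k}(z_k)+\alpha_k\beta(\nabla\mathcal{L}^k_{\eta_k})^T\tilde\Delta z_k$. Set $z_{k+1}=z_k+\alpha_k\tilde\Delta z_k$. (4) Set $\eta_{1,k+1}\leftarrow\eta_{1,k}$, $\eta_{2,k+1}\leftarrow\eta_{2,k}$, $\delta_{k+1}\leftarrow\delta_k$. The constant $\xi_B$ in the assumption on $B_k$ is the input parameter $\xi_B$. The constants in $O(\cdot)$ do not depend on $k$. *)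

(* Defs.v *)
From HB Require Import structures.
From mathcomp Require Import all_boot all_order all_algebra.
From mathcomp Require Import all_classical all_reals all_analysis.
Set Implicit Arguments.
Unset Strict Implicit.
Unset Printing Implicit Defensive.
Import Order.TTheory GRing.Theory Num.Theory.
Import numFieldNormedType.Exports.
Local Open Scope classical_set_scope.
Local Open Scope ring_scope.

(* The library norm on matrices is the entrywise maximum; the l2 norm and the
   induced operator norm are therefore defined here. *)
Definition dotp (R : realType) (p : nat) (u v : 'cV[R]_p) : R :=
  (u^T *m v) 0 0.

Definition l2norm (R : realType) (p : nat) (u : 'cV[R]_p) : R :=
  Num.sqrt (dotp u u).

Definition opnorm (R : realType) (p q : nat) (A : 'M[R]_(p, q)) : R :=
  sup [set l2norm (A *m u) | u in [set u : 'cV[R]_q | l2norm u <= 1]].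

(* The singular values of a p x q matrix with p <= q. *)
Definition singular_value (R : realType) (p q : nat) (A : 'M[R]_(p, q))
    (s : R) : Prop :=
  0 <= s /\ eigenvalue (A *m A^T) (s ^+ 2).

Definition least_singular_value (R : realType) (p q : nat)
    (A : 'M[R]_(p, q)) : R :=
  inf [set s | singular_value A s].

(* The four Penrose equations have exactly one solution. *)
Definition is_moore_penrose (R : realType) (p q : nat) (A : 'M[R]_(p, q))
    (Y : 'M[R]_(q, p)) : Prop :=
  [/\ A *m Y *m A = A, Y *m A *m Y = Y,
      (A *m Y)^T = A *m Y & (Y *m A)^T = Y *m A].

Definition pinv (R : realType) (p q : nat) (A : 'M[R]_(p, q)) : 'M[R]_(q, p) :=
  xget 0 [set Y | is_moore_penrose A Y].

Definition pderiv (R : realType) (p : nat) (i : 'I_p) (g : 'cV[R]_p -> R)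
    (x : 'cV[R]_p) : R :=
  'D_(delta_mx i 0) g x.

Definition grad (R : realType) (p : nat) (g : 'cV[R]_p -> R) (x : 'cV[R]_p) :
    'cV[R]_p :=
  \col_i pderiv i g x.

Definition hess (R : realType) (p : nat) (g : 'cV[R]_p -> R) (x : 'cV[R]_p) :
    'M[R]_p :=
  \matrix_(i, j) pderiv i (pderiv j g) x.

Definition component (R : realType) (n m : nat) (c : 'cV[R]_n -> 'cV[R]_m)
    (i : 'I_m) (x : 'cV[R]_n) : R :=
  c x i 0.

Definition jac (R : realType) (n m : nat) (c : 'cV[R]_n -> 'cV[R]_m)
    (x : 'cV[R]_n) : 'M[R]_(m, n) :=
  \matrix_(i, j) pderiv j (component c i) x.

(* g is r times continuously differentiable over A: the derivatives exist (as
   derivatives of functions on the whole space) at every point of A, and the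
   r-th order ones are continuous relative to A. *)
Fixpoint Ck (R : realType) (p r : nat) (A : set 'cV[R]_p)
    (g : 'cV[R]_p -> R) : Prop :=
  match r with
  | 0 => {within A, continuous g}
  | r'.+1 => (forall x, A x -> differentiable g x) /\
             (forall i : 'I_p, Ck r' A (pderiv i g))
  end.

Definition lipschitz_hess (R : realType) (p : nat) (A : set 'cV[R]_p)
    (g : 'cV[R]_p -> R) : Prop :=
  exists L : R, forall x y, A x -> A y ->
    opnorm (hess g x - hess g y) <= L * l2norm (x - y).

Definition local_solution (R : realType) (n m : nat) (f : 'cV[R]_n -> R)
    (c : 'cV[R]_n -> 'cV[R]_m) (x : 'cV[R]_n) : Prop :=
  c x = 0 /\ \forall y \near x, c y = 0 -> f x <= f y.

Section Lagrangian.
Variables (R : realType) (n m : nat).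
Variables (f : 'cV[R]_n -> R) (c : 'cV[R]_n -> 'cV[R]_m).

(* z = (x, lambda) is stacked as col_mx x lambda. *)
Definition primal (z : 'cV[R]_(n + m)) : 'cV[R]_n := usubmx z.
Definition dual_var (z : 'cV[R]_(n + m)) : 'cV[R]_m := dsubmx z.

Definition lagr (lam : 'cV[R]_m) (x : 'cV[R]_n) : R := f x + dotp lam (c x).

Definition gradx_lagr (z : 'cV[R]_(n + m)) : 'cV[R]_n :=
  grad (lagr (dual_var z)) (primal z).

Definition grad_lagr (z : 'cV[R]_(n + m)) : 'cV[R]_(n + m) :=
  col_mx (gradx_lagr z) (c (primal z)).

Definition hess_lagr (z : 'cV[R]_(n + m)) : 'M[R]_n :=
  hess (lagr (dual_var z)) (primal z).

Definition aug_lagr (eta1 eta2 : R) (z : 'cV[R]_(n + m)) : R :=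
  lagr (dual_var z) (primal z) + eta1 / 2 * l2norm (c (primal z)) ^+ 2
  + eta2 / 2 * l2norm (gradx_lagr z) ^+ 2.

End Lagrangian.

Definition kkt_mx (R : realType) (n m : nat) (B : 'M[R]_n) (G : 'M[R]_(m, n)) :
    'M[R]_(n + m) :=
  block_mx B G^T G 0.

Definition sketch (R : realType) (N : nat) : Type := {d : nat & 'M[R]_(N, d)}.

(* Disjoint union topology of the spaces 'M_(N, d). *)
HB.instance Definition _ (R : realType) (N : nat) :=
  Topological.copy (sketch R N)
    {d : nat & ('M[R]_(N, d) : topologicalType)}.
HB.instance Definition _ (R : realType) (N : nat) :=
  isPointed.Build (sketch R N) (existT (fun d => 'M[R]_(N, d)) 0%N 0).

Definition borel_sketch (R : realType) (N : nat) :=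
  g_sigma_algebraType (@open (sketch R N)).

(* dz - Gamma S (S^T Gamma^2 S)^+ S^T r, with r = Gamma dz + g. *)
Definition sketch_update (R : realType) (N : nat) (Gam : 'M[R]_N)
    (g : 'cV[R]_N) (s : sketch R N) (dz : 'cV[R]_N) : 'cV[R]_N :=
  let S := projT2 s in
  dz - Gam *m S *m pinv (S^T *m (Gam *m Gam) *m S) *m S^T *m (Gam *m dz + g).

Record inputs (R : realType) (n m : nat) := Inputs {
  z_init : 'cV[R]_(n + m);
  theta : nat -> R;
  eta1_init : R;
  eta2_init : R;
  delta_init : R;
  xi_B : R;
  beta : R;
  nu : R;
  rho : R }.

Definition admissible (R : realType) (n m : nat) (inp : inputs R n m) : Prop :=
  [/\ forall k, 0 < theta inp k <= 1,
      [/\ 0 < eta1_init inp, 0 < eta2_init inp & 0 < xi_B inp],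
      0 < delta_init inp < 1,
      0 < beta inp < 2^-1 &
      1 < nu inp /\ 0 < rho inp < 1].

Record state (R : realType) (n m : nat) := State {
  iterate : 'cV[R]_(n + m);
  eta1 : R;
  eta2 : R;
  delta : R }.

HB.instance Definition _ (R : realType) (n m : nat) :=
  gen_eqMixin (state R n m).
HB.instance Definition _ (R : realType) (n m : nat) :=
  gen_choiceMixin (state R n m).

(* [drawn] counts the sketches drawn
   in the current outer iteration, so the next one is S_{k, drawn}. *)
Record inner_state (R : realType) (n m : nat) := InnerState {
  dir : 'cV[R]_(n + m);
  drawn : nat;
  in_eta1 : R;
  in_eta2 : R;
  in_delta : R }.

Section Algorithm.
Variables (R : realType) (n m : nat).
Variables (f : 'cV[R]_n -> R) (c : 'cV[R]_n -> 'cV[R]_m) (inp : inputs R n m).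

Section OuterIteration.
Variables (k : nat) (z : 'cV[R]_(n + m)) (B : 'M[R]_n).

Let G := jac c (primal z).
Let Gam := kkt_mx B G.
Let g := grad_lagr f c z.

Definition Psi : R :=
  20 * Num.max (opnorm B ^+ 2) 1
  / (Num.min (xi_B inp) 1 * Num.min (least_singular_value G ^+ 2) 1).

Definition Upsilon : R :=
  Num.max (Num.max (opnorm G) (opnorm (hess_lagr f c z))) 1.

Definition delta_trial (e1 e2 : R) : R :=
  (2^-1 - beta inp) * e2 / ((1 + e1 + e2) * Upsilon ^+ 2 * Psi ^+ 2).

Definition accurate (w : inner_state R n m) : bool :=
  l2norm (Gam *m dir w + g)
  <= theta inp k * in_delta w * l2norm g / (opnorm Gam * Psi).

Definition descends (w : inner_state R n m) : bool :=
  dotp (grad (aug_lagr f c (in_eta1 w) (in_eta2 w)) z) (dir w)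
  <= - in_eta2 w * l2norm g ^+ 2 / 2.

Definition update_params (w : inner_state R n m) : inner_state R n m :=
  let e1 := in_eta1 w * nu inp ^+ 2 in
  let e2 := in_eta2 w / nu inp in
  InnerState (dir w) (drawn w) e1 e2
    (Num.min (in_delta w / nu inp ^+ 4) (delta_trial e1 e2)).

Definition draw_sketch (S : nat -> sketch R (n + m))
    (w : inner_state R n m) : inner_state R n m :=
  InnerState (sketch_update Gam g (S (drawn w)) (dir w)) (drawn w).+1
    (in_eta1 w) (in_eta2 w) (in_delta w).

(* The loop over the two conditions and the sketching loop nested in it, one
   elementary move at a time; nothing changes once both conditions hold. *)
Definition inner_step (S : nat -> sketch R (n + m))
    (w : inner_state R n m) : inner_state R n m :=
  if ~~ accurate w then draw_sketch S w
  else if ~~ descends w then update_params w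
  else w.

Definition armijo (w : inner_state R n m) (a : R) : bool :=
  aug_lagr f c (in_eta1 w) (in_eta2 w) (z + a *: dir w)
  <= aug_lagr f c (in_eta1 w) (in_eta2 w) z
     + a * beta inp
       * dotp (grad (aug_lagr f c (in_eta1 w) (in_eta2 w)) z) (dir w).

End OuterIteration.

Definition inner_init (k : nat) (B : 'M[R]_n) (s : state R n m) :
    inner_state R n m :=
  InnerState 0 0 (eta1 s) (eta2 s)
    (Num.min (delta s) (delta_trial (iterate s) B (eta1 s) (eta2 s))).

(* The pair (next state, alpha_k) produced by outer iteration k.  This set has
   at most one element; it is empty exactly when the sketching loops or the
   backtracking do not terminate. *)
Definition outcome (k : nat) (B : 'M[R]_n) (S : nat -> sketch R (n + m))
    (s : state R n m) : set (state R n m * R) :=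
  [set p | exists t i : nat,
     let z := iterate s in
     let w := iter t (inner_step k z B S) (inner_init k B s) in
     [/\ accurate k z B w, descends z w,
         armijo z w (rho inp ^+ i),
         forall l, (l < i)%N -> ~~ armijo z w (rho inp ^+ l) &
         p = (State (z + rho inp ^+ i *: dir w)
                (in_eta1 w) (in_eta2 w) (in_delta w),
              rho inp ^+ i)]].

(* (state at the start of outer iteration k, alpha_{k-1}) for a realization of
   the matrices B_k and of the sketches S_{k,j}.  If outer iteration k does not
   terminate, the state is kept and alpha_k takes the value 0, which is not a
   possible step size. *)
Fixpoint run (B : nat -> 'M[R]_n) (S : nat -> nat -> sketch R (n + m))
    (k : nat) : state R n m * R :=
  match k with
  | 0 => (State (z_init inp) (eta1_init inp) (eta2_init inp) (delta_init inp),
          0)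
  | k'.+1 => let s := (run B S k').1 in
             xget (s, 0) (outcome k' (B k') (S k') s)
  end.

Definition z_of (B : nat -> 'M[R]_n) (S : nat -> nat -> sketch R (n + m))
    (k : nat) : 'cV[R]_(n + m) :=
  iterate (run B S k).1.

Definition alpha_of (B : nat -> 'M[R]_n) (S : nat -> nat -> sketch R (n + m))
    (k : nat) : R :=
  (run B S k.+1).2.

End Algorithm.

Section Randomness.
Variables (R : realType) (n m : nat) (d : measure_display).
Variables (Om : measurableType d) (P : probability Om R).
Variables (z : nat -> Om -> 'cV[R]_(n + m)) (B : nat -> Om -> 'M[R]_n).
Variable (S : nat -> nat -> Om -> sketch R (n + m)).

(* The sigma-algebra generated by z_0, ..., z_k, B_0, ..., B_k and the sketches
   of the outer iterations before k. *)
Definition past (k : nat) : set (set Om) :=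
  <<s [set E | exists i O, [/\ (i <= k)%N, open O & E = z i @^-1` O]]
      `|` [set E | exists i O, [/\ (i <= k)%N, open O & E = B i @^-1` O]]
      `|` [set E | exists i j O, [/\ (i < k)%N, open O & E = S i j @^-1` O]] >>.

(* The S_{k,j} are fresh iid draws from the law Pr: during outer iteration k
   they are independent, distributed as Pr, and independent of the past.  Since
   the past of k contains the sketches of all earlier outer iterations, this
   yields the joint independence of the whole family (S_{k,j})_{k,j}. *)
Definition fresh_iid (Pr : probability (borel_sketch R (n + m)) R) : Prop :=
  forall k : nat, past k `<=` measurable /\
    forall (A : set Om) (D : nat -> set (borel_sketch R (n + m))) (N : nat),
      past k A -> (forall j, measurable (D j)) ->
      P (A `&` \bigcap_(j < N) (S k j @^-1` D j)) =
      (P A * \prod_(j < N) Pr (D j))%E.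

End Randomness.

(* Main.v *)
Require Import Defs.
From HB Require Import structures.
From mathcomp Require Import all_boot all_order all_algebra.
From mathcomp Require Import all_classical all_reals all_analysis.
From mathcomp Require Import ring lra.
Set Implicit Arguments.
Unset Strict Implicit.
Unset Printing Implicit Defensive.
Import Order.TTheory GRing.Theory Num.Theory.
Import numFieldNormedType.Exports.
Local Open Scope classical_set_scope.
Local Open Scope ring_scope.

(** Write [g] for the KKT map [(grad_x L, c)], [M] for its derivative and [Gam]
    for the matrix of the Newton system, that is [M] with [B] in place of the
    Hessian block. A probabilistic part shows that almost surely every outer
    iteration ends; the rest is deterministic and about one realization.

    Sketching. If [Gam dstar = - g], one update replaces the error
    [e = dz - dstar] by [e - P e], with [P] the orthogonal projector onto the
    range of [Gam S] ([sketch_update_error], [range_proj_pythagoras]), so the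
    error never grows. Compactness of the unit sphere gives finitely many open
    sets of sketches, each of positive probability, such that any consecutive
    sketches taken from them in turn see a fixed fraction of every vector
    ([sensing_pattern_exists]). This pattern depends on the law of the sketches
    alone and serves all random [Gam] and [g] at once. By independence it almost
    surely recurs infinitely often in every outer iteration
    ([ae_pattern_infinitely_often]), and each recurrence lowers the squared error
    by a fixed amount as long as the residual is large ([sketch_iter_converges]).

    Descent and termination. The assumptions bound [Gam] from below uniformly
    ([kkt_bounded_below]), so an accurate direction is close to the Newton
    direction. In the directional derivative of the augmented Lagrangian the
    tangential part is controlled by the reduced positivity of [B] once [eta2] is
    small, the normal part by [eta1] once [eta1 eta2] is large, and the
    inexactness by [delta] ([descent_direction]). An update multiplies
    [eta1 eta2] by [nu] and divides [delta] by at least [nu ^ 4], so after some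
    number of updates, the same for all iterates, accuracy implies descent
    ([descent_after_updates]). Hence the parameters take finitely many values
    along a run ([run_params]) and the inner loop ends ([inner_loop_terminates]).

    Unit steps. Near the solution the accuracy condition and the convergence of
    [B] to the Hessian give [M d = - g + o(|g|)]. Strict differentiability of [g]
    then gives [g (z + d) = o(|g|)], so both penalty terms nearly vanish at
    [z + d], and the Lagrangian itself changes by [g . d / 2 + o(|g|^2)]. Since
    [g . d] differs from the directional derivative of the augmented Lagrangian
    by twice its penalty terms, the augmented Lagrangian changes by half of that
    derivative up to [o(|g|^2)], and [beta < 1/2] makes the unit step acceptable
    ([armijo_full_step]).

    Rate. Apply the lower bound on [Gam] to
    [Gam (z + d - zs) = (M (z - zs) - g) + (Gam - M) (z - zs) + (Gam d + g)]. The
    three terms are quadratic in [z - zs] by the Lipschitz Hessians, of order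
    [tau] by the choice of [B], and of order [theta] by the accuracy condition
    ([newton_rate]). *)

(** * Euclidean and operator norms *)

Section Euclid.
Variable R : realType.
Implicit Types (p q r : nat).

Lemma trE p q (A : 'M[R]_(p, q)) i j : A^T i j = A j i.
Proof. by rewrite mxE. Qed.
Lemma subE p q (A B : 'M[R]_(p, q)) i j : (A - B) i j = A i j - B i j.
Proof. by rewrite !mxE. Qed.

Lemma dotpE p (u v : 'cV[R]_p) : dotp u v = \sum_i u i 0 * v i 0.
Proof. by rewrite /dotp mxE; apply: eq_bigr => i _; rewrite mxE. Qed.

Lemma dotpC p (u v : 'cV[R]_p) : dotp u v = dotp v u.
Proof. by rewrite !dotpE; apply: eq_bigr => i _; rewrite mulrC. Qed.

Lemma dotpDl p (u v w : 'cV[R]_p) : dotp (u + v) w = dotp u w + dotp v w.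
Proof. by rewrite /dotp linearD /= mulmxDl mxE. Qed.
Lemma dotpDr p (u v w : 'cV[R]_p) : dotp u (v + w) = dotp u v + dotp u w.
Proof. by rewrite !(dotpC u) dotpDl. Qed.
Lemma dotpNl p (u v : 'cV[R]_p) : dotp (- u) v = - dotp u v.
Proof. by rewrite /dotp linearN /= mulNmx mxE. Qed.
Lemma dotpNr p (u v : 'cV[R]_p) : dotp u (- v) = - dotp u v.
Proof. by rewrite dotpC dotpNl dotpC. Qed.
Lemma dotpBl p (u v w : 'cV[R]_p) : dotp (u - v) w = dotp u w - dotp v w.
Proof. by rewrite dotpDl dotpNl. Qed.
Lemma dotpBr p (u v w : 'cV[R]_p) : dotp u (v - w) = dotp u v - dotp u w.
Proof. by rewrite dotpDr dotpNr. Qed.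
Lemma dotpZl p a (u v : 'cV[R]_p) : dotp (a *: u) v = a * dotp u v.
Proof. by rewrite /dotp linearZ /= -scalemxAl mxE. Qed.
Lemma dotpZr p a (u v : 'cV[R]_p) : dotp u (a *: v) = a * dotp u v.
Proof. by rewrite dotpC dotpZl dotpC. Qed.
Lemma dotp0l p (u : 'cV[R]_p) : dotp 0 u = 0.
Proof. by rewrite -(scale0r 0) dotpZl mul0r. Qed.
Lemma dotp0r p (u : 'cV[R]_p) : dotp u 0 = 0.
Proof. by rewrite dotpC dotp0l. Qed.

Lemma dotp_mulmxl p q (A : 'M[R]_(p, q)) u v : dotp (A *m u) v = dotp u (A^T *m v).
Proof. by rewrite /dotp trmx_mul mulmxA. Qed.
Lemma dotp_mulmxr p q (A : 'M[R]_(p, q)) u v : dotp u (A *m v) = dotp (A^T *m u) v.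
Proof. by rewrite dotp_mulmxl trmxK. Qed.

Lemma dotp_col_mx p q (a b : 'cV[R]_p) (c d : 'cV[R]_q) :
  dotp (col_mx a c) (col_mx b d) = dotp a b + dotp c d.
Proof. by rewrite /dotp tr_col_mx mul_row_col mxE. Qed.

Lemma dotp_ge0 p (u : 'cV[R]_p) : 0 <= dotp u u.
Proof. by rewrite dotpE sumr_ge0 // => i _; rewrite -expr2 sqr_ge0. Qed.

Lemma dotp_eq0 p (u : 'cV[R]_p) : (dotp u u == 0) = (u == 0).
Proof.
apply/idP/eqP => [|->]; last by rewrite dotp0l.
rewrite dotpE psumr_eq0 => [/allP h|i _]; last by rewrite -expr2 sqr_ge0.
apply/colP => i; have := h i; rewrite mem_index_enum => /(_ isT).
by rewrite /= mulf_eq0 orbb mxE => /eqP.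
Qed.

Lemma l2norm_ge0 p (u : 'cV[R]_p) : 0 <= l2norm u.
Proof. exact: sqrtr_ge0. Qed.
Hint Resolve l2norm_ge0 : core.

Lemma l2norm_sqr p (u : 'cV[R]_p) : l2norm u ^+ 2 = dotp u u.
Proof. by rewrite sqr_sqrtr ?dotp_ge0. Qed.

Lemma l2norm_eq0 p (u : 'cV[R]_p) : (l2norm u == 0) = (u == 0).
Proof. by rewrite -(sqrf_eq0 (l2norm u)) l2norm_sqr dotp_eq0. Qed.

Lemma l2norm_gt0 p (u : 'cV[R]_p) : (0 < l2norm u) = (u != 0).
Proof. by rewrite lt_def l2norm_eq0 l2norm_ge0 andbT. Qed.

Lemma l2norm0 p : l2norm (0 : 'cV[R]_p) = 0.
Proof. by apply/eqP; rewrite l2norm_eq0. Qed.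

Lemma l2normZ p a (u : 'cV[R]_p) : l2norm (a *: u) = `|a| * l2norm u.
Proof.
by rewrite /l2norm dotpZl dotpZr mulrA -expr2 sqrtrM ?sqr_ge0 // sqrtr_sqr.
Qed.

Lemma l2normN p (u : 'cV[R]_p) : l2norm (- u) = l2norm u.
Proof. by rewrite -scaleN1r l2normZ normrN1 mul1r. Qed.

Lemma l2normBC p (u v : 'cV[R]_p) : l2norm (u - v) = l2norm (v - u).
Proof. by rewrite -l2normN opprB. Qed.

(** The Cauchy-Schwarz inequality, from the square of [|v| u - |u| v]. *)
Lemma dotp_le p (u v : 'cV[R]_p) : dotp u v <= l2norm u * l2norm v.
Proof.
have [->|u0] := eqVneq u 0; first by rewrite dotp0l l2norm0 mul0r.
have [->|v0] := eqVneq v 0; first by rewrite dotp0r l2norm0 mulr0.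
have := dotp_ge0 (l2norm v *: u - l2norm u *: v).
rewrite dotpBl !dotpBr !dotpZl !dotpZr -!l2norm_sqr (dotpC v u).
have nu : 0 < l2norm u by rewrite l2norm_gt0.
have nv : 0 < l2norm v by rewrite l2norm_gt0.
move: (l2norm u) (l2norm v) nu nv (dotp u v) => a b a0 b0 s h.
have ab : 0 < a * b by exact: mulr_gt0.
rewrite -(ler_pM2l ab); lra.
Qed.

Lemma ler_abs_dotp p (u v : 'cV[R]_p) : `|dotp u v| <= l2norm u * l2norm v.
Proof.
rewrite ler_norml dotp_le andbT lerNl -dotpNl.
by rewrite (le_trans (dotp_le _ _)) // l2normN.
Qed.

Lemma l2normD p (u v : 'cV[R]_p) : l2norm (u + v) <= l2norm u + l2norm v.
Proof.
rewrite -(@ler_pXn2r _ 2) ?nnegrE ?addr_ge0 //.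
rewrite l2norm_sqr dotpDl !dotpDr -!l2norm_sqr (dotpC v u) sqrrD.
have := dotp_le u v; lra.
Qed.

Lemma l2normB p (u v : 'cV[R]_p) : l2norm (u - v) <= l2norm u + l2norm v.
Proof. by rewrite (le_trans (l2normD _ _)) // l2normN. Qed.

Lemma l2norm_sum p (I : Type) (s : seq I) (Q : pred I) (F : I -> 'cV[R]_p) :
  l2norm (\sum_(i <- s | Q i) F i) <= \sum_(i <- s | Q i) l2norm (F i).
Proof.
elim/big_rec2: _ => [|i y x _ h]; first by rewrite l2norm0.
by rewrite (le_trans (l2normD _ _)) // lerD2l.
Qed.

Lemma sqr_l2norm_col_mx p q (u : 'cV[R]_p) (v : 'cV[R]_q) :
  l2norm (col_mx u v) ^+ 2 = l2norm u ^+ 2 + l2norm v ^+ 2.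
Proof. by rewrite !l2norm_sqr dotp_col_mx. Qed.

Lemma l2norm_col_mxl p q (u : 'cV[R]_p) (v : 'cV[R]_q) :
  l2norm u <= l2norm (col_mx u v).
Proof.
by rewrite -(@ler_pXn2r _ 2) ?nnegrE // sqr_l2norm_col_mx lerDl sqr_ge0.
Qed.

Lemma l2norm_col_mxr p q (u : 'cV[R]_p) (v : 'cV[R]_q) :
  l2norm v <= l2norm (col_mx u v).
Proof.
by rewrite -(@ler_pXn2r _ 2) ?nnegrE // sqr_l2norm_col_mx lerDr sqr_ge0.
Qed.

Lemma l2norm_col_mx_le p q (u : 'cV[R]_p) (v : 'cV[R]_q) :
  l2norm (col_mx u v) <= l2norm u + l2norm v.
Proof.
rewrite -(@ler_pXn2r _ 2) ?nnegrE ?addr_ge0 // sqr_l2norm_col_mx sqrrD.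
by rewrite lerD2r lerDl mulrn_wge0 // mulr_ge0.
Qed.

Lemma l2norm_coord p (u : 'cV[R]_p) i : `|u i 0| <= l2norm u.
Proof.
rewrite -(@ler_pXn2r _ 2) ?nnegrE // real_normK ?num_real // l2norm_sqr dotpE.
rewrite (bigD1 i) //= -expr2 lerDl sumr_ge0 // => j _.
by rewrite -expr2 sqr_ge0.
Qed.

Lemma l2norm_delta p (i : 'I_p) : l2norm (delta_mx i 0 : 'cV[R]_p) = 1.
Proof.
rewrite /l2norm dotpE (bigD1 i) //= !mxE !eqxx mul1r big1 ?addr0 ?sqrtr1 //.
by move=> j /negbTE ji; rewrite !mxE ji mul0r.
Qed.

Lemma cV_sum_delta p (u : 'cV[R]_p) : u = \sum_i u i 0 *: delta_mx i 0.
Proof.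
rewrite {1}[u]matrix_sum_delta; apply: eq_bigr => i _.
by rewrite big_ord1.
Qed.

Lemma l2norm_le_sum p (u : 'cV[R]_p) : l2norm u <= \sum_i `|u i 0|.
Proof.
rewrite {1}[u]cV_sum_delta (le_trans (l2norm_sum _ _ _))// ler_sum// => i _.
by rewrite l2normZ l2norm_delta mulr1.
Qed.

Lemma l2norm_le_coord p (u : 'cV[R]_p) a : (forall i, `|u i 0| <= a) ->
  l2norm u <= p%:R * a.
Proof.
move=> h; rewrite (le_trans (l2norm_le_sum u))//.
rewrite (@le_trans _ _ (\sum_(i < p) a))//; first by apply: ler_sum.
by rewrite sumr_const card_ord mulr_natl.
Qed.

Lemma l2norm_mulmx_le p q (A : 'M[R]_(p, q)) a u :
  (forall i j, `|A i j| <= a) -> l2norm (A *m u) <= p%:R * (q%:R * a) * l2norm u.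
Proof.
move=> h; rewrite -mulrA; apply: l2norm_le_coord => i; rewrite mxE.
rewrite (le_trans (ler_norm_sum _ _ _))//.
rewrite (@le_trans _ _ (\sum_(j < q) a * l2norm u))//.
  by apply: ler_sum => j _; rewrite normrM ler_pM ?l2norm_coord.
by rewrite sumr_const card_ord -mulrA mulr_natl.
Qed.

Lemma opnorm_bounded p q (A : 'M[R]_(p, q)) :
  has_sup [set l2norm (A *m u) | u in [set u : 'cV[R]_q | l2norm u <= 1]].
Proof.
split; first by exists (l2norm (A *m 0)); exists 0 => //=; rewrite l2norm0.
pose a := \sum_i \sum_j `|A i j|.
exists (p%:R * (q%:R * a)) => _ [u /= u1 <-].
have ha i j : `|A i j| <= a.
  rewrite /a (bigD1 i) //= (bigD1 j) //= -addrA lerDl addr_ge0 ?sumr_ge0 //.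
  by move=> k _; rewrite sumr_ge0.
rewrite (le_trans (l2norm_mulmx_le _ ha))// ler_piMr// !mulr_ge0 //.
by rewrite /a sumr_ge0// => k _; rewrite sumr_ge0.
Qed.

Lemma opnorm_ge0 p q (A : 'M[R]_(p, q)) : 0 <= opnorm A.
Proof.
rewrite (_ : 0 = l2norm (A *m 0)); last by rewrite mulmx0 l2norm0.
apply: ub_le_sup; first by case: (opnorm_bounded A).
by exists 0 => //=; rewrite l2norm0.
Qed.

Lemma opnormP p q (A : 'M[R]_(p, q)) u : l2norm (A *m u) <= opnorm A * l2norm u.
Proof.
have [->|u0] := eqVneq u 0; first by rewrite mulmx0 !l2norm0 mulr0.
have nu : 0 < l2norm u by rewrite l2norm_gt0.
rewrite -ler_pdivrMr// mulrC -[X in X * _]gtr0_norm ?invr_gt0//.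
rewrite -l2normZ scalemxAr; apply: ub_le_sup; first by case: (opnorm_bounded A).
by exists ((l2norm u)^-1 *: u) => //=; rewrite l2normZ gtr0_norm ?invr_gt0 ?mulVf ?gt_eqF.
Qed.

Lemma opnorm_entry p q (A : 'M[R]_(p, q)) i j : `|A i j| <= opnorm A.
Proof.
have := opnormP A (delta_mx j 0); rewrite l2norm_delta mulr1 -colE.
apply: le_trans; apply: le_trans (l2norm_coord _ i).
by rewrite mxE.
Qed.

(** [|A^T u|^2 = u . A (A^T u)], to which the bound on [A] applies. *)
Lemma l2norm_trmx_le p q (A : 'M[R]_(p, q)) a : 0 <= a ->
  (forall u, l2norm (A *m u) <= a * l2norm u) ->
  forall u, l2norm (A^T *m u) <= a * l2norm u.
Proof.
move=> a0 h u; have [->|v0] := eqVneq (A^T *m u) 0; first by rewrite l2norm0 mulr_ge0.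
rewrite -(@ler_pM2l _ (l2norm (A^T *m u))) ?l2norm_gt0 // -expr2 l2norm_sqr.
rewrite dotp_mulmxl trmxK (le_trans (dotp_le _ _))//.
by rewrite mulrC mulrCA mulrA ler_wpM2r// mulrC.
Qed.

End Euclid.
#[export] Hint Extern 0 (is_true (@Order.le _ _ _ (l2norm _))) =>
  solve [apply: l2norm_ge0] : core.

(** * Pseudoinverses, projectors and the KKT matrix *)

Section LinAlg.
Variable R : realType.
Implicit Types (p q r : nat).

Lemma mulmx_tr_eq0 p q (Z : 'M[R]_(p, q)) : Z *m Z^T = 0 -> Z = 0.
Proof.
move=> h; apply/matrixP => i j; rewrite mxE.
have := congr1 (fun M : 'M[R]_p => M i i) h; rewrite !mxE => /eqP.
rewrite psumr_eq0 => [/allP/(_ j)|k _]; last by rewrite mxE -expr2 sqr_ge0.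
by rewrite mem_index_enum => /(_ isT); rewrite mxE mulf_eq0 orbb => /eqP.
Qed.

Lemma gram_unitmx p q (Z : 'M[R]_(p, q)) : row_free Z -> Z *m Z^T \in unitmx.
Proof.
move=> fZ; rewrite -row_free_unit; apply/inj_row_free => v h.
apply: (row_free_inj fZ); rewrite mul0mx; apply: mulmx_tr_eq0.
by rewrite trmx_mul -!mulmxA (mulmxA Z) (mulmxA v) h mul0mx.
Qed.

(** The full-rank factorization [A = F E] gives the pseudoinverse
    [E^T (E E^T)^-1 (F^T F)^-1 F^T]. *)
Lemma moore_penrose_exists p q (A : 'M[R]_(p, q)) :
  exists Y, is_moore_penrose A Y.
Proof.
have [r [F [E [-> fF fE]]]] : exists r (F : 'M[R]_(p, r)) (E : 'M[R]_(r, q)),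
    [/\ A = F *m E, row_free F^T & row_free E].
  exists (\rank A), (col_base A), (row_base A); split.
  - by rewrite mulmx_base.
  - by rewrite /row_free mxrank_tr; exact: col_base_full.
  - exact: row_base_free.
have uE : E *m E^T \in unitmx by exact: gram_unitmx.
have uF : F^T *m F \in unitmx by have := gram_unitmx fF; rewrite trmxK.
pose Y := E^T *m invmx (E *m E^T) *m invmx (F^T *m F) *m F^T.
have AY : F *m E *m Y = F *m invmx (F^T *m F) *m F^T.
  by rewrite /Y !mulmxA -(mulmxA F E) mulmxK.
have YA : Y *m (F *m E) = E^T *m invmx (E *m E^T) *m E.
  by rewrite /Y !mulmxA -(mulmxA _ F^T F) mulmxKV.
exists Y; split.
- by rewrite AY !mulmxA -(mulmxA _ F^T F) mulmxKV.
- by rewrite YA /Y !mulmxA -(mulmxA _ E E^T) mulmxKV.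
- by rewrite AY !trmx_mul trmxK trmx_inv trmx_mul trmxK mulmxA.
- by rewrite YA !trmx_mul trmxK trmx_inv trmx_mul trmxK mulmxA.
Qed.

(** Of the Penrose equations this is the one that makes [A (A^T A)^+ A^T] a
    projector. *)
Lemma mulmx_pinv p q (A : 'M[R]_(p, q)) : A *m Defs.pinv A *m A = A.
Proof.
rewrite /Defs.pinv; case: xgetP => [Y _ []//|h].
by have [Y hY] := moore_penrose_exists A; case: (h Y).
Qed.

(** The orthogonal projector onto the range of [A]. *)
Definition range_proj p q (A : 'M[R]_(p, q)) : 'M[R]_p :=
  A *m Defs.pinv (A^T *m A) *m A^T.

(** [Z = A^T P - A^T] satisfies [Z A = 0] and has the form [Y A^T], so that
    [Z Z^T = 0]. *)
Lemma trmx_range_proj p q (A : 'M[R]_(p, q)) : A^T *m range_proj A = A^T.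
Proof.
pose C := A^T *m A; apply/eqP; rewrite -subr_eq0; apply/eqP.
have zA : (A^T *m range_proj A - A^T) *m A = 0.
  rewrite mulmxBl /range_proj !mulmxA -(mulmxA _ A^T A) -/C mulmx_pinv.
  by rewrite subrr.
apply: mulmx_tr_eq0; rewrite [X in _ *m X^T](_ : _ = (C *m Defs.pinv C - 1%:M) *m A^T).
  by rewrite trmx_mul trmxK mulmxA zA mul0mx.
by rewrite mulmxBl mul1mx /range_proj !mulmxA.
Qed.

Lemma range_proj_pythagoras p q (A : 'M[R]_(p, q)) e :
  l2norm (e - range_proj A *m e) ^+ 2 = l2norm e ^+ 2 - l2norm (range_proj A *m e) ^+ 2.
Proof.
have PP : (range_proj A)^T *m range_proj A = (range_proj A)^T.
  rewrite {1 3}/range_proj !trmx_mul trmxK -!mulmxA trmx_range_proj.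
  by rewrite !mulmxA.
have h : dotp (range_proj A *m e) (range_proj A *m e) = dotp e (range_proj A *m e).
  by rewrite dotp_mulmxl mulmxA PP -dotp_mulmxl dotpC.
rewrite !l2norm_sqr dotpBl !dotpBr (dotpC (range_proj A *m e) e) h; lra.
Qed.

(** Every [x] is the sum of its component in the kernel of [G] and of a
    component in the range of [G^T], which [G x] controls. *)
Lemma kernel_range_split n m (G : 'M[R]_(m, n)) (xi g : R) :
  0 < xi -> 0 <= g -> (forall u, l2norm (G *m u) <= g * l2norm u) ->
  (forall y, xi * l2norm y ^+ 2 <= dotp y (G *m G^T *m y)) ->
  forall x : 'cV[R]_n, exists xN xR : 'cV[R]_n, [/\ x = xN + xR, G *m xN = 0 &
    l2norm xR <= g / xi * l2norm (G *m x)].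
Proof.
move=> xi0 g0 hg hG x.
have uG : G *m G^T \in unitmx.
  rewrite -unitmx_tr -row_free_unit; apply/inj_row_free => v h.
  apply: trmx_inj; apply/eqP; rewrite trmx0 -l2norm_eq0 -sqrf_eq0.
  rewrite eq_le sqr_ge0 andbT -(pmulr_rle0 _ xi0) (le_trans (hG _))//.
  have -> : G *m G^T *m v^T = 0.
    by rewrite -[X in X *m _]trmxK -trmx_mul h trmx0.
  by rewrite dotp0r.
pose y := invmx (G *m G^T) *m (G *m x).
have hy : G *m G^T *m y = G *m x by rewrite /y mulmxA mulmxV// mul1mx.
have ny : l2norm y <= l2norm (G *m x) / xi.
  have [->|y0] := eqVneq y 0; first by rewrite l2norm0 divr_ge0 ?l2norm_ge0 ?(ltW xi0).
  rewrite ler_pdivlMr// -(@ler_pM2l _ (l2norm y)) ?l2norm_gt0//.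
  rewrite [leLHS](_ : _ = xi * l2norm y ^+ 2); last by ring.
  by rewrite (le_trans (hG y))// hy dotp_le.
exists (x - G^T *m y), (G^T *m y); split.
- by rewrite subrK.
- by rewrite mulmxBr mulmxA hy subrr.
- by rewrite (le_trans (l2norm_trmx_le g0 hg y))// -mulrA ler_wpM2l// mulrC.
Qed.

(** [k1] bounds the primal part of the inverse of the KKT matrix and the last
    summand its dual part; the summand [1] makes the constant at least [1]. *)
Definition kkt_const (xi xB b g : R) : R :=
  let k1 := g / xi + (1 + b * (g / xi)) / xB in
  1 + k1 + g * (1 + b * k1) / xi.

Lemma kkt_const_gt1 xi xB b g : 0 < xi -> 0 < xB -> 0 <= b -> 0 <= g ->
  1 <= kkt_const xi xB b g.
Proof.
move=> xi0 xB0 b0 g0; rewrite /kkt_const -addrA lerDl.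
have [xi1 xB1] := (ltW xi0, ltW xB0).
by rewrite !(addr_ge0, mulr_ge0, invr_ge0).
Qed.

(** The KKT matrix is bounded below: the full rank of [G] controls the
    component of [x] normal to the constraints and the multiplier, and the
    reduced positivity of [B] controls the tangential component. *)
Lemma kkt_bounded_below n m (B : 'M[R]_n) (G : 'M[R]_(m, n)) (xi xB b g : R) :
  0 < xi -> 0 < xB -> 0 <= b -> 0 <= g ->
  (forall u, l2norm (G *m u) <= g * l2norm u) ->
  (forall u, l2norm (B *m u) <= b * l2norm u) ->
  (forall y, xi * l2norm y ^+ 2 <= dotp y (G *m G^T *m y)) ->
  (forall u, G *m u = 0 -> xB * l2norm u ^+ 2 <= dotp u (B *m u)) ->
  forall u, l2norm u <= kkt_const xi xB b g * l2norm (kkt_mx B G *m u).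
Proof.
move=> xi0 xB0 b0 g0 hg hb hG hB u.
rewrite -[u]vsubmxK; set x := usubmx u; set lam := dsubmx u.
rewrite /kkt_mx mul_block_col mul0mx addr0.
set a := B *m x + G^T *m lam; set w := col_mx a _; set t := l2norm w.
have at_ : l2norm a <= t by exact: l2norm_col_mxl.
have bt : l2norm (G *m x) <= t by exact: l2norm_col_mxr.
have t0 : 0 <= t by exact: l2norm_ge0.
have [xi1 xB1] := (ltW xi0, ltW xB0).
have [xN [xR [xE GN nR]]] := kernel_range_split xi0 g0 hg hG x.
set s := g / xi in nR *.
have s0 : 0 <= s by rewrite divr_ge0.
have nRt : l2norm xR <= s * t by rewrite (le_trans nR)// ler_wpM2l.
have nN : l2norm xN <= (1 + b * s) / xB * t.
  have [->|N0] := eqVneq xN 0.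
    by rewrite l2norm0 !(mulr_ge0, addr_ge0, invr_ge0).
  rewrite mulrAC ler_pdivlMr// -(@ler_pM2l _ (l2norm xN)) ?l2norm_gt0//.
  rewrite [leLHS](_ : _ = xB * l2norm xN ^+ 2); last by ring.
  rewrite (le_trans (hB _ GN))//.
  have -> : B *m xN = a - G^T *m lam - B *m xR.
    by rewrite /a addrK -mulmxBr xE addrK.
  rewrite !dotpBr -dotp_mulmxl GN dotp0l subr0 -dotpBr.
  apply: le_trans (dotp_le _ _) _; apply: ler_wpM2l => //.
  apply: le_trans (l2normB _ _) _.
  rewrite mulrDl mul1r; apply: lerD => //; apply: le_trans (hb _) _.
  by rewrite -mulrA; apply: ler_wpM2l.
have nx : l2norm x <= (s + (1 + b * s) / xB) * t.
  by rewrite xE (le_trans (l2normD _ _))// addrC mulrDl lerD.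
set k1 := _ + _ in nx.
have k10 : 0 <= k1 by rewrite !(addr_ge0, mulr_ge0, invr_ge0).
have nl : l2norm lam <= g * (1 + b * k1) / xi * t.
  have [->|l0] := eqVneq lam 0.
    by rewrite l2norm0 !(mulr_ge0, addr_ge0, invr_ge0).
  rewrite mulrAC ler_pdivlMr// mulrC -(@ler_pM2l _ (l2norm lam)) ?l2norm_gt0//.
  rewrite [leLHS](_ : _ = xi * l2norm lam ^+ 2); last by ring.
  rewrite (le_trans (hG _))//.
  have -> : G *m G^T *m lam = G *m (a - B *m x).
    by rewrite /a addrC addKr mulmxA.
  apply: le_trans (dotp_le _ _) _; apply: ler_wpM2l => //.
  apply: le_trans (hg _) _; rewrite -mulrA; apply: ler_wpM2l => //.
  apply: le_trans (l2normB _ _) _.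
  rewrite mulrDl mul1r; apply: lerD => //; apply: le_trans (hb _) _.
  by rewrite -mulrA; apply: ler_wpM2l.
rewrite (le_trans (l2norm_col_mx_le _ _))// /kkt_const -/s -/k1 -addrA mulrDl mul1r.
by rewrite mulrDl (le_trans (lerD nx nl))// lerDr.
Qed.

End LinAlg.

(** * Compactness of the sphere and the least singular value *)

Section Topology.
Variable R : realType.
Implicit Types (p q r : nat).

Lemma coord_le_normr p q (A : 'M[R]_(p, q)) i j : `|A i j| <= `|A|.
Proof.
rewrite [leRHS]/Num.norm /= mx_normrE; apply/bigmax_geP; right => /=.
by exists (i, j).
Qed.

Lemma normr_le_coord p q (A : 'M[R]_(p, q)) a : 0 <= a ->
  (forall i j, `|A i j| <= a) -> `|A| <= a.
Proof.
by move=> a0 h; rewrite [leLHS]/Num.norm /= mx_normrE; apply/bigmax_leP; split.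
Qed.

Lemma l2norm_le_normr p (u : 'cV[R]_p) : l2norm u <= p%:R * `|u|.
Proof. by apply: l2norm_le_coord => i; exact: coord_le_normr. Qed.

Lemma normr_le_l2norm p (u : 'cV[R]_p) : `|u| <= l2norm u.
Proof.
by apply: normr_le_coord => // i j; rewrite (ord1 j); exact: l2norm_coord.
Qed.

Lemma mulmx_entry_continuous p q r (A : 'M[R]_(r, p)) i j :
  continuous (fun u : 'M[R]_(p, q) => (A *m u) i j).
Proof.
rewrite (_ : (fun u : 'M[R]_(p, q) => _) = fun u : 'M[R]_(p, q) => \sum_k A i k * u k j); last first.
  by apply/funext => u; rewrite mxE.
apply: continuous_big => [|k _ u]; first exact: add_continuous.
by apply: continuousM; [exact: cst_continuous|exact: coord_continuous].
Qed.

Lemma dotp_mulmx_continuous p (A : 'M[R]_p) :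
  continuous (fun u : 'cV[R]_p => dotp u (A *m u)).
Proof.
rewrite (_ : (fun u : 'cV[R]_p => _) = fun u : 'cV[R]_p => \sum_i u i 0 * (A *m u) i 0); last first.
  by apply/funext => u; rewrite dotpE.
apply: continuous_big => [|k _ u]; first exact: add_continuous.
by apply: continuousM; [exact: coord_continuous|exact: mulmx_entry_continuous].
Qed.

Lemma l2norm_comp_continuous (T : topologicalType) p (h : T -> 'cV[R]_p) :
  (forall i, continuous (fun t => h t i 0)) -> continuous (fun t => l2norm (h t)).
Proof.
move=> ch t; apply: (@continuous_comp _ _ _ (fun t => dotp (h t) (h t)) Num.sqrt);
  last exact: sqrt_continuous.
move: t; rewrite (_ : (fun t => _) = fun t => \sum_i h t i 0 * h t i 0); last first.
  by apply/funext => t; rewrite dotpE.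
apply: continuous_big => [|k _ u]; first exact: add_continuous.
by apply: continuousM; exact: ch.
Qed.

Lemma l2norm_continuous p : continuous (@l2norm R p).
Proof. by apply: l2norm_comp_continuous => i; exact: coord_continuous. Qed.

Lemma sphere_compact p : compact [set u : 'cV[R]_p | l2norm u = 1].
Proof.
have -> : [set u : 'cV[R]_p | l2norm u = 1] =
    trmx @` [set v : 'rV[R]_p | l2norm v^T = 1].
  apply/seteqP; split => [u /= h|_ [v /= h <-]//].
  by exists u^T; rewrite /= trmxK.
have ct : continuous (trmx : 'rV[R]_p -> 'cV[R]_p).
  move=> v; have Fv : Filter (nbhs v) := nbhs_filter v.
  apply/(@cvgrPdist_lt _ 'cV[R]_p _ _ Fv) => e e0; near=> w.
  have -> : v^T - w^T = (v - w)^T by rewrite linearB.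
  apply: (@le_lt_trans _ _ `|v - w|).
    by apply: normr_le_coord => // i j; rewrite mxE coord_le_normr.
  by near: w; move: e e0; apply/cvgrPdist_lt; exact: cvg_id.
apply: continuous_compact; first exact: continuous_subspaceT.
apply: bounded_closed_compact.
  exists 1; split => // x x1 v /= h; rewrite (le_trans _ (ltW x1))//.
  rewrite -h; apply: le_trans (normr_le_l2norm _).
  by apply: normr_le_coord => // i j; rewrite (_ : v i j = v^T j i) ?coord_le_normr // mxE.
have /continuous_closedP cl : continuous (fun v : 'rV[R]_p => l2norm v^T).
  by move=> v; apply: continuous_comp; [exact: ct|exact: l2norm_continuous].
exact: (cl _ (@closed_eq R 1)).
Unshelve. all: by end_near. Qed.

(** A minimizer [u] of the Rayleigh quotient is an eigenvector: with [a] the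
    minimum, the form of [A - a I] is nonnegative and vanishes at [u], so its
    first variation at [u] vanishes. *)
Lemma symmetric_eigenvalue p (A : 'M[R]_p) : (0 < p)%N -> A^T = A ->
  exists a, eigenvalue A a.
Proof.
move=> p0 sA.
have S0 : [set u : 'cV[R]_p | l2norm u = 1] !=set0.
  by exists (delta_mx (Ordinal p0) 0); rewrite /= l2norm_delta.
have [|u u1 umin] := compact_EVT_min S0 (@sphere_compact p) (f := fun u => dotp u (A *m u)).
  exact/continuous_subspaceT/dotp_mulmx_continuous.
move: u1; rewrite inE /= => u1; pose a := dotp u (A *m u).
pose C := A - a%:M.
have sC : C^T = C by rewrite /C linearB /= sA tr_scalar_mx.
have C0 v : 0 <= dotp v (C *m v).
  have [->|v0] := eqVneq v 0; first by rewrite dotp0l.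
  have nv : 0 < l2norm v by rewrite l2norm_gt0.
  have : a <= dotp ((l2norm v)^-1 *: v) (A *m ((l2norm v)^-1 *: v)).
    by apply: umin; rewrite inE /= l2normZ gtr0_norm ?invr_gt0 // mulVf // gt_eqF.
  rewrite -scalemxAr dotpZl dotpZr mulrA -expr2 exprVn mulrC ler_pdivlMr ?exprn_gt0 //.
  by rewrite mulmxBl mul_scalar_mx dotpBr dotpZr l2norm_sqr subr_ge0.
have Cu : dotp u (C *m u) = 0.
  by rewrite mulmxBl mul_scalar_mx dotpBr dotpZr -l2norm_sqr u1 expr1n mulr1 subrr.
pose v := C *m u.
have q t : 0 <= t * (2 * dotp v v) + t ^+ 2 * dotp v (C *m v).
  have := C0 (u + t *: v).
  rewrite mulmxDr -scalemxAr !dotpDl !dotpDr !dotpZl !dotpZr Cu add0r.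
  rewrite (_ : dotp u (C *m v) = dotp v v); last by rewrite dotp_mulmxr sC.
  by move=> h; rewrite (le_trans h)// le_eqVlt; apply/orP; left; apply/eqP; rewrite -/v; ring.
have v0 : v = 0.
  apply/eqP; rewrite -dotp_eq0 eq_le dotp_ge0 andbT leNgt; apply/negP => vv.
  set b := dotp v (C *m v) in q.
  have b0 : 0 <= b := C0 v.
  have b1 : 0 < 1 + b by rewrite ltr_wpDr.
  have := q (- (dotp v v / (1 + b))).
  set e := dotp v v in vv *; apply/negP; rewrite -ltNge sqrrN.
  have -> : - (e / (1 + b)) * (2 * e) + (e / (1 + b)) ^+ 2 * b =
    - ((e / (1 + b)) ^+ 2 * (2 + b)).
    by field; rewrite gt_eqF.
  by rewrite oppr_lt0 mulr_gt0 ?exprn_gt0 ?divr_gt0 ?ltr_wpDr.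
exists a; apply/eigenvalueP; exists u^T.
  rewrite -[LHS]trmxK trmx_mul trmxK sA -linearZ /=; congr (_^T).
  by apply/eqP; rewrite -subr_eq0 -mul_scalar_mx -mulmxBl -/C -/v v0.
by rewrite -trmx0 (inj_eq trmx_inj) -l2norm_gt0 u1.
Qed.

(** The infimum that defines the least singular value is over a nonempty set
    because [G G^T] has an eigenvalue; an empty one would make it [0]. *)
Lemma least_singular_value_ge n m (G : 'M[R]_(m, n)) (xi : R) :
  (0 < m)%N -> 0 < xi ->
  (forall y, xi * l2norm y ^+ 2 <= dotp y (G *m G^T *m y)) ->
  Num.sqrt xi <= least_singular_value G.
Proof.
move=> m0 xi0 hG.
have ge_xi a : eigenvalue (G *m G^T) a -> xi <= a.
  case/eigenvalueP => v hv v0.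
  have vT0 : 0 < l2norm v^T by rewrite l2norm_gt0 -trmx0 (inj_eq trmx_inj).
  have := hG v^T; rewrite (_ : G *m G^T *m v^T = a *: v^T).
    by rewrite dotpZr -l2norm_sqr ler_pM2r // exprn_gt0.
  by rewrite -linearZ /= -hv !trmx_mul trmxK.
apply: lb_le_inf.
  have [a ea] : exists a, eigenvalue (G *m G^T) a.
    by apply: symmetric_eigenvalue => //; rewrite trmx_mul trmxK.
  exists (Num.sqrt a); split; first exact: sqrtr_ge0.
  by rewrite sqr_sqrtr // (le_trans (ltW xi0))// ge_xi.
move=> s [s0 /ge_xi h].
by rewrite -(ger0_norm s0) -sqrtr_sqr ler_sqrt // (le_trans (ltW xi0)).
Qed.

End Topology.

(** * Sketch-and-project along sensing patterns *)

Section Sketching.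
Variables (R : realType) (N : nat).
Implicit Types (s : sketch R N) (u : 'cV[R]_N).

(** The update sees [dz] through the residual [Gam (dz - dstar)] alone; in terms
    of the error it removes a projection. *)
Lemma sketch_update_error (Gam : 'M[R]_N) (g dz dstar : 'cV[R]_N) s :
  Gam^T = Gam -> Gam *m dstar = - g ->
  sketch_update Gam g s dz - dstar =
  (dz - dstar) - range_proj (Gam *m projT2 s) *m (dz - dstar).
Proof.
move=> sG hd; rewrite /sketch_update /range_proj -addrA (addrC (- _)) addrA.
congr (_ - _); rewrite trmx_mul sG.
have -> : Gam *m dz + g = Gam *m (dz - dstar) by rewrite mulmxBr hd opprK.
by rewrite !mulmxA.
Qed.

Fixpoint sketch_iter (Gam : 'M[R]_N) (g : 'cV[R]_N) (S : nat -> sketch R N)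
    (j : nat) : 'cV[R]_N :=
  if j is j'.+1 then sketch_update Gam g (S j') (sketch_iter Gam g S j') else 0.

(** Sketches that do not miss [u]. One index [k] quantifies the visible part of
    [u] and bounds the sketch, which makes the property stable under small
    changes of [u]; as [k] varies these sets exhaust [S^T u != 0]. *)
Definition senses u (k : nat) : set (sketch R N) :=
  [set s : sketch R N | [/\ (projT1 s <= k)%N,
     `|projT2 s : 'M[R]_(N, projT1 s)| < k%:R &
               k.+1%:R^-1 < l2norm ((projT2 s)^T *m u)]].

(** A finite pattern of sets of sketches which, once realized by consecutive
    sketches, leaves no residual unseen. *)
Definition sensing_pattern (L : nat) (D : nat -> set (sketch R N)) (eps M : R) :=
  forall S : nat -> sketch R N, (forall i, (i < L)%N -> D i (S i)) ->
  (forall u, u != 0 -> exists2 i, (i < L)%N &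
     eps * l2norm u <= l2norm ((projT2 (S i))^T *m u)) /\
  (forall i u, (i < L)%N -> l2norm ((projT2 (S i))^T *m u) <= M * l2norm u).

(** If a pattern reduced the squared error by only [Delta], then no step of the
    block moved the error by more than [sqrt Delta], so that every sketch of the
    block sees almost nothing of the residual at the start of the block. *)
Lemma sensing_block_drop (Gam : 'M[R]_N) (S : nat -> sketch R N) (e : nat -> 'cV[R]_N)
    L D eps M b :
  Gam^T = Gam -> 0 <= M -> 0 <= b -> (forall u, l2norm (Gam *m u) <= b * l2norm u) ->
  sensing_pattern L D eps M ->
  (forall i, (i < L)%N -> D i (S i)) ->
  (forall i, e i.+1 = e i - range_proj (Gam *m projT2 (S i)) *m e i) ->
  eps * l2norm (Gam *m e 0%N) <=
    M * b * L%:R * Num.sqrt (l2norm (e 0%N) ^+ 2 - l2norm (e L) ^+ 2).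
Proof.
move=> sG M0 b0 hb sens DS he; have [spot bnd] := sens S DS.
have [->|r0] := eqVneq (Gam *m e 0%N) 0.
  by rewrite l2norm0 mulr0 !mulr_ge0 ?sqrtr_ge0.
have [i iL hi] := spot _ r0.
set De := _ - _; pose q j := l2norm (range_proj (Gam *m projT2 (S j)) *m e j).
have drop j : l2norm (e j.+1) ^+ 2 = l2norm (e j) ^+ 2 - q j ^+ 2.
  by rewrite he range_proj_pythagoras.
have mono j l : l2norm (e (j + l)%N) ^+ 2 <= l2norm (e j) ^+ 2.
  elim: l => [|l ih]; first by rewrite addn0.
  by rewrite addnS drop; apply: le_trans ih; rewrite gerBl sqr_ge0.
have qD j : (j < L)%N -> q j <= Num.sqrt De.
  move=> jL; rewrite -[leLHS]ger0_norm ?l2norm_ge0 // -sqrtr_sqr; apply: ler_wsqrtr.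
  have := mono 0%N j; have := mono j.+1 (L - j.+1)%N; rewrite subnKC // add0n drop.
  rewrite /De; lra.
have dist j : (j <= L)%N -> l2norm (e 0%N - e j) <= j%:R * Num.sqrt De.
  elim: j => [|j ih] jL; first by rewrite subrr l2norm0 mul0r.
  rewrite he opprB addrCA addrC (le_trans (l2normD _ _))// -natr1 mulrDl mul1r.
  by apply: lerD; [apply: ih; exact: ltnW|exact: qD].
have hA j u : (j < L)%N -> l2norm ((Gam *m projT2 (S j))^T *m u) <= M * b * l2norm u.
  move=> jL; rewrite trmx_mul sG -mulmxA (le_trans (bnd _ _ jL))// -mulrA.
  by apply: ler_wpM2l.

apply: (le_trans hi).
have -> : (projT2 (S i))^T *m (Gam *m e 0%N) =
    (Gam *m projT2 (S i))^T *m (e 0%N - e i) +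
    (Gam *m projT2 (S i))^T *m (range_proj (Gam *m projT2 (S i)) *m e i).
  rewrite (mulmxA _ (range_proj _)) trmx_range_proj -mulmxDr subrK trmx_mul sG.
  by rewrite mulmxA.
apply: le_trans (l2normD _ _) _.
have Mb : 0 <= M * b by exact: mulr_ge0.
apply: (@le_trans _ _ (M * b * (i%:R * Num.sqrt De) + M * b * Num.sqrt De)).
  by apply: lerD; (apply: le_trans (hA _ _ iL) _; apply: ler_wpM2l => //);
    [apply: dist; exact: ltnW|exact: qD].
rewrite -mulrDr -[X in _ + X]mul1r -mulrDl natr1 -!mulrA.
by do 2![apply: ler_wpM2l => //]; rewrite ler_wpM2r ?sqrtr_ge0 ?ler_nat.
Qed.

(** Each occurrence of the pattern lowers the squared error by a fixed amount as
    long as the residual stays above [eta], which can happen only finitely often. *)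
Lemma sketch_iter_converges (Gam : 'M[R]_N) (g dstar : 'cV[R]_N) (S : nat -> sketch R N)
    L D eps M :
  Gam^T = Gam -> Gam *m dstar = - g ->
  (0 < L)%N -> 0 < eps -> 0 < M -> sensing_pattern L D eps M ->
  (forall t0, exists2 t, (t0 <= t)%N & forall i, (i < L)%N -> D i (S (t * L + i)%N)) ->
  forall eta j0, 0 < eta ->
  exists2 j, (j0 <= j)%N & l2norm (Gam *m sketch_iter Gam g S j + g) <= eta.
Proof.
move=> sG hd L0 eps0 M0 sens often eta j0 eta0.
pose e j := sketch_iter Gam g S j - dstar.
have he j : e j.+1 = e j - range_proj (Gam *m projT2 (S j)) *m e j.
  by rewrite /e /= sketch_update_error.
have resE j : Gam *m sketch_iter Gam g S j + g = Gam *m e j.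
  by rewrite /e mulmxBr hd opprK.
apply: contrapT => H.
have big j : (j0 <= j)%N -> eta < l2norm (Gam *m e j).
  move=> jj; rewrite ltNge; apply/negP => h; apply: H; exists j => //.
  by rewrite resE.
have mono j l : l2norm (e (j + l)%N) ^+ 2 <= l2norm (e j) ^+ 2.
  elim: l => [|l ih]; first by rewrite addn0.
  by rewrite addnS he range_proj_pythagoras; apply: le_trans ih; rewrite gerBl sqr_ge0.
pose b := opnorm Gam + 1.
have b0 : 0 < b by rewrite ltr_wpDl// opnorm_ge0.
have hb u : l2norm (Gam *m u) <= b * l2norm u.
  by apply: le_trans (opnormP _ _) _; rewrite ler_wpM2r// lerDl.
have c0 : 0 < M * b * L%:R by rewrite !mulr_gt0// ltr0n.
pose kap := (eps * eta / (M * b * L%:R)) ^+ 2.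
have kap0 : 0 < kap by rewrite exprn_gt0// divr_gt0// mulr_gt0.
have step j : (j0 <= j)%N -> exists2 j', (j0 <= j')%N &
    l2norm (e j') ^+ 2 <= l2norm (e j) ^+ 2 - kap.
  move=> jj; have [t tj ht] := often j; set a := (t * L)%N in ht.
  have ja : (j <= a)%N by rewrite (leq_trans tj)// leq_pmulr.
  exists (a + L)%N; first by rewrite (leq_trans jj)// (leq_trans ja)// leq_addr.
  have := @sensing_block_drop Gam (fun i => S (a + i)%N) (fun i => e (a + i)%N)
    L D eps M b sG (ltW M0) (ltW b0) hb sens ht.
  move=> /(_ _)/wrap[i|]; first by rewrite addnS he.
  rewrite addn0 => h.
  have De : l2norm (e a) ^+ 2 <= l2norm (e j) ^+ 2.
    by have := mono j (a - j)%N; rewrite subnKC.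
  suff : kap <= l2norm (e a) ^+ 2 - l2norm (e (a + L)%N) ^+ 2 by lra.
  set De' := _ - _ in h *.
  have De0 : 0 <= De' by rewrite subr_ge0 mono.
  rewrite -[leRHS]sqr_sqrtr// /kap ler_pXn2r ?nnegrE ?sqrtr_ge0//; last first.
    by rewrite ltW// divr_gt0// mulr_gt0.
  rewrite ler_pdivrMr// [leRHS]mulrC; apply: le_trans h; apply: ler_wpM2l; first exact: ltW.
  by apply/ltW/big; exact: leq_trans jj ja.
have desc p : exists2 j, (j0 <= j)%N & l2norm (e j) ^+ 2 <= l2norm (e j0) ^+ 2 - p%:R * kap.
  elim: p => [|p [j jj hj]]; first by exists j0 => //; rewrite mul0r subr0.
  have [j' jj' hj'] := step j jj; exists j' => //.
  by rewrite -natr1 mulrDl; lra.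
have [p hp] : exists p : nat, l2norm (e j0) ^+ 2 / kap < p%:R.
  by exists (Num.bound (l2norm (e j0) ^+ 2 / kap)); rewrite archi_boundP// divr_ge0 ?sqr_ge0 ?ltW.
have [j jj hj] := desc p; move: hp; rewrite ltr_pdivrMr//.
have := sqr_ge0 (l2norm (e j)); lra.
Qed.

End Sketching.

(** * Almost sure recurrence of sensing patterns *)

Section IndependentBlocks.
Context (R : realType) (d : measure_display) (Om : measurableType d).
Variables (P : probability Om R) (X : nat -> set Om) (a : nat -> R) (L : nat) (p : R).
Hypothesis mX : forall j, measurable (X j).
Hypothesis indep : forall s : seq nat, uniq s ->
  P [set w | forall j, j \in s -> X j w] = (\prod_(j <- s) a j)%:E.
Hypothesis block_prob : forall t, \prod_(j <- iota (t * L) L) a j = p.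
Hypothesis p_gt0 : 0 < p.

Let rect (s : seq nat) := [set w | forall j, j \in s -> X j w].
Let block (t : nat) := iota (t * L) L.
Let fails (t0 T : nat) :=
  [set w | forall t, (t0 <= t < t0 + T)%N -> ~ rect (block t) w].

Let measurable_rect s : measurable (rect s).
Proof.
have -> : rect s = \bigcap_(j in [set j | j \in s]) X j by [].
exact: bigcap_measurableType.
Qed.

Let failsS t0 T : fails t0 T.+1 = fails t0 T `\` rect (block (t0 + T)).
Proof.
apply/seteqP; split => [w h|w [h1 h2] t].
  split => [t /andP[h1 h2]|]; last by apply: h; rewrite leq_addr addnS leqnn.
  by apply: h; rewrite h1 addnS ltnS ltnW.
rewrite addnS ltnS => /andP[tt]; rewrite leq_eqVlt => /orP[/eqP ->//|tT].
by apply: h1; rewrite tt.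
Qed.

Let measurable_fails t0 T : measurable (fails t0 T).
Proof.
elim: T => [|T ih].
  rewrite (_ : fails t0 0 = setT)//; apply/seteqP; split => // w _ t.
  by rewrite addn0 ltnNge => /andP[->].
by rewrite failsS; exact: measurableD.
Qed.

(** The failures of successive blocks, jointly with a product event on later indices,
    multiply: the failure of a block is the complement of a product event. *)
Let prob_fails t0 T s : uniq s -> (forall j, j \in s -> ((t0 + T) * L <= j)%N) ->
  P (fails t0 T `&` rect s) = ((1 - p) ^+ T * \prod_(j <- s) a j)%:E.
Proof.
elim: T s => [|T ih] s us hs.
  rewrite (_ : fails t0 0 = setT); first by rewrite setTI expr0 mul1r; exact: indep.
  apply/seteqP; split => // w _ t.
  by rewrite addn0 ltnNge => /andP[->].
have hs' j : j \in s -> ((t0 + T) * L <= j)%N.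
  by move=> /hs; apply: leq_trans; rewrite addnS leq_mul2r leqnSn orbT.
have rcat : rect (block (t0 + T)) `&` rect s = rect (block (t0 + T) ++ s).
  apply/seteqP; split => [w [h1 h2] j|w h].
    by rewrite mem_cat => /orP[/h1|/h2].
  by split => j js; apply: h; rewrite mem_cat js ?orbT.
rewrite failsS setDE setIAC -setDE measureD ?ltey_eq ?fin_num_measure//; last first.
- exact: measurableI.
- exact: measurableI.
rewrite -setIA (setIC (rect s)) rcat.
have us' : uniq (block (t0 + T) ++ s).
  rewrite cat_uniq iota_uniq us andbT /=; apply/hasPn => j /hs.
  rewrite mem_iota addnS mulSn addnC => h; apply/negP => /andP[_ h2].
  by move: (leq_ltn_trans h h2); rewrite ltnn.
have E1 := ih s us hs'; have := ih _ us'; rewrite big_cat /= block_prob => E2.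
transitivity (((1 - p) ^+ T * \prod_(j <- s) a j)%:E -
    ((1 - p) ^+ T * (p * \prod_(j <- s) a j))%:E)%E.
  congr (_ - _)%E; first exact: E1.
  apply: E2 => j; rewrite mem_cat => /orP[|/hs'//].
  by rewrite mem_iota => /andP[].
by rewrite -EFinB exprS; congr _%:E; ring.
Qed.

(** From [t0] on, [T] successive blocks all fail with probability [(1 - p)^T]. *)
Lemma ae_block_infinitely_often :
  {ae P, forall w, forall t0, exists2 t, (t0 <= t)%N &
     forall i, (i < L)%N -> X (t * L + i)%N w}.
Proof.
have p1 : p <= 1.
  have -> : p = fine (P (rect (block 0))) by rewrite indep ?iota_uniq// block_prob.
  by rewrite -lee_fin fineK ?fin_num_measure// probability_le1.
have null t0 : P.-negligible (\bigcap_T fails t0 T).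
  apply/negligibleP; first exact: bigcapT_measurable.
  suff : P (\bigcap_T fails t0 T) = 0%E by [].
  set r := P _; have rfin : r \is a fin_num by rewrite fin_num_measure//; exact: bigcapT_measurable.
  have rle T : fine r <= (1 - p) ^+ T.
    rewrite -lee_fin fineK//.
    have -> : (((1 - p) ^+ T)%:E = P (fails t0 T))%E.
      have nil_ge j : j \in [::] -> ((t0 + T) * L <= j)%N by [].
      have := @prob_fails t0 T [::] isT nil_ge; rewrite big_nil mulr1 => <-.
      congr (P _); apply/seteqP; split => [w [h _]|w h]; first exact: h.
      by split => // j; rewrite in_nil.
    apply: le_measure; rewrite ?inE//; first exact: bigcapT_measurable.
    by move=> w; apply.
  have r0 : 0 <= fine r by apply: fine_ge0; exact: measure_ge0.
  apply/eqP; rewrite -(fineK rfin) eqe eq_le r0 andbT leNgt; apply/negP => r1.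
  have z1 : `|1 - p| < 1 by rewrite ger0_norm ?subr_ge0// gtrBl.
  have /cvgr_lt/(_ _ r1) [T _ /(_ T (leqnn T))/=] := cvg_expr z1.
  by rewrite ltNge rle.
have := negligible_bigcup null; apply: negligibleS => w /= h.
have [t0 ht0] : exists t0, ~ exists2 t, (t0 <= t)%N &
    forall i, (i < L)%N -> X (t * L + i)%N w by apply/existsNP.
exists t0 => // T _ t /andP[tt _] hr; apply: ht0; exists t => // i iL.
by apply: hr; rewrite mem_iota leq_addr ltn_add2l.
Qed.

End IndependentBlocks.

Section Patterns.
Context (R : realType) (N : nat).
Variable Pr : probability (borel_sketch R N) R.
Hypothesis N_gt0 : (0 < N)%N.

Lemma open_senses (u : 'cV[R]_N) k : open (senses u k : set (sketch R N)).
Proof.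
apply/sigT_openP => q; have [qk|qk] := leqP q k; last first.
  rewrite (_ : _ @^-1` _ = set0); first exact: open0.
  by apply/seteqP; split => // A [/=]; rewrite leqNgt qk.
rewrite (_ : _ @^-1` _ = (fun A : 'M[R]_(N, q) => `|A|) @^-1` [set x | x < k%:R] `&`
   (fun A : 'M[R]_(N, q) => l2norm (A^T *m u)) @^-1` [set x | k.+1%:R^-1 < x]); last first.
  by apply/seteqP; split => [A [/= _ ? ?]//|A [/= ? ?]]; split.
apply: openI; apply: open_comp; rewrite ?(open_lt, open_gt)// => A _.
  exact: norm_continuous.
apply: l2norm_comp_continuous => j.
rewrite (_ : (fun A : 'M[R]_(N, q) => _) = fun A : 'M[R]_(N, q) => \sum_i A i j * u i 0); last first.
  by apply/funext => B; rewrite mxE; under eq_bigr do rewrite mxE.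
apply: continuous_big => [|i _ B]; first exact: add_continuous.
by apply: continuousM; [exact: coord_continuous|exact: cst_continuous].
Qed.

Lemma measurable_open_sketch (D : set (sketch R N)) :
  open D -> measurable (D : set (borel_sketch R N)).
Proof. exact: sub_sigma_algebra. Qed.

Hypothesis Pr_sees : forall u : 'cV[R]_N, u != 0 ->
  (0 < Pr [set s : sketch R N | ((projT2 s)^T *m u != 0)%R])%E.

Lemma senses_gt0 (u : 'cV[R]_N) : u != 0 -> exists k, (0 < Pr (senses u k))%E.
Proof.
move=> u0; apply: contrapT => /forallNP h.
have z k : Pr.-negligible (senses u k : set (borel_sketch R N)).
  apply/negligibleP; first by apply: measurable_open_sketch; exact: open_senses.
  by apply/eqP; rewrite eq_le measure_ge0 andbT leNgt; apply/negP/h.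
have := Pr_sees u0; rewrite (_ : [set s | _] = \bigcup_k (senses u k : set (borel_sketch R N))).
  have -> : Pr (\bigcup_k (senses u k : set (borel_sketch R N))) = 0%E; last by rewrite ltxx.
  apply: measure_negligible; last exact: negligible_bigcup.
  by apply: bigcup_measurable => k _; apply: measurable_open_sketch; exact: open_senses.
apply/seteqP; split => [[q A] /= h0|[q A] [k _ [_ _ /= h0]]]; last first.
  by rewrite -l2norm_gt0; apply: lt_trans h0; rewrite invr_gt0 ltr0n.
have l0 : 0 < l2norm (A^T *m u) by rewrite l2norm_gt0.
pose k := maxn q (maxn (Num.bound `|A|) (Num.bound (l2norm (A^T *m u))^-1)).
exists k => //; split => /=; first exact: leq_maxl.
  apply: lt_le_trans (archi_boundP (normr_ge0 _)) _.
  by rewrite ler_nat !leq_max leqnn orbT.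
rewrite invf_plt ?posrE ?ltr0n//.
apply: lt_trans (archi_boundP _) _; first by rewrite invr_ge0.
by rewrite ltr_nat ltnS !leq_max leqnn !orbT.
Qed.

Lemma senses_le (u : 'cV[R]_N) k (s : sketch R N) (y : 'cV[R]_N) : senses u k s ->
  l2norm ((projT2 s)^T *m y) <= k%:R * (N%:R * k%:R) * l2norm y.
Proof.
case: s => q A [/= qk Ak _]; have h i j : `|A^T i j| <= k%:R.
  by rewrite mxE (le_trans (coord_le_normr _ _ _))// ltW.
apply: le_trans (l2norm_mulmx_le _ h) _; apply: ler_wpM2r => //.
by apply: ler_wpM2r; rewrite ?ler_nat// mulr_ge0.
Qed.

(** [senses u k] keeps working for the vectors near [u], so finitely many of
    these sets serve the whole (compact) unit sphere. *)
Lemma sensing_pattern_exists : exists L (D : nat -> set (sketch R N)) (eps M : R),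
  [/\ (0 < L)%N, 0 < eps, 0 < M, sensing_pattern L D eps M &
      forall i, open (D i) /\ ((i < L)%N -> (0 < Pr (D i))%E)].
Proof.
pose k (u : 'cV[R]_N) := xget 0%N [set k | (0 < Pr (senses u k))%E].
have hk u : u != 0 -> (0 < Pr (senses u (k u)))%E.
  by move=> /senses_gt0[l hl]; rewrite /k; case: xgetP => [//|/(_ l)].
pose c l : R := l%:R * (N%:R * l%:R).
have c_ge0 l : 0 <= c l by rewrite !mulr_ge0.
pose rho u := (k u).+1%:R^-1 / 2 / (1 + c (k u) * N%:R).
have den_gt0 u : 0 < 1 + c (k u) * N%:R :> R by rewrite ltr_wpDr// mulr_ge0.
have rho_gt0 u : 0 < rho u by rewrite !divr_gt0// invr_gt0 ltr0n.
have near_sense u v s : ball u (rho u) v -> senses u (k u) s ->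
    (k u).+1%:R^-1 / 2 <= l2norm ((projT2 s)^T *m v).
  move=> uv hs; have [_ _ big] := hs.
  have small : l2norm ((projT2 s)^T *m (u - v)) <= (k u).+1%:R^-1 / 2.
    apply: le_trans (senses_le _ hs) _.
    have uv' : l2norm (u - v) <= N%:R * rho u.
      apply: le_trans (l2norm_le_normr _) _; apply: ler_wpM2l => //.
      by apply: ltW; move: uv; rewrite mx_norm_ball.
    apply: (@le_trans _ _ (c (k u) * (N%:R * rho u))); first exact: ler_wpM2l.
    rewrite /rho; set x := _^-1 / 2.
    have x0 : 0 <= x by rewrite divr_ge0// invr_ge0.
    rewrite [leLHS](_ : _ = x * ((c (k u) * N%:R) / (1 + c (k u) * N%:R))); last by ring.
    by rewrite ler_piMr// ler_pdivrMr// mul1r lerDr.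
  have := l2normD ((projT2 s)^T *m v) ((projT2 s)^T *m (u - v)).
  rewrite -mulmxDr (addrC v) subrK => h.
  move: big small h; set x := l2norm _; set y := l2norm _; set z := l2norm _.
 set a := (X in X < x); rewrite -/a => *; lra.
have sph := @sphere_compact R N; rewrite compact_cover in sph.
have [|v v1|F Fs cov] := sph _ [set u : 'cV[R]_N | l2norm u = 1] (fun u => ball u (rho u)).
- by move=> u _; exact: ball_open.
- by exists v => //; exact: ballxx.
pose us : seq 'cV[R]_N := [seq u <- finmap.enum_fset F | u != 0].
pose D i := senses (nth 0 us i) (k (nth 0 us i)).
pose kmax := (\max_(u <- us) k u)%N.
have kle i : (i < size us)%N -> (k (nth 0%R us i) <= kmax)%N.
  by move=> ius; exact: (@leq_bigmax_seq _ us xpredT k _ (mem_nth 0 ius) isT).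
have spot (v : 'cV[R]_N) : l2norm v = 1 -> exists2 i, (i < size us)%N &
    ball (nth 0 us i) (rho (nth 0 us i)) v.
  move=> /cov[u /= uF uv].
  have uus : u \in us.
    rewrite mem_filter uF andbT -l2norm_gt0.
    by have := Fs u uF; rewrite inE /= => ->.
  by exists (index u us); rewrite ?index_mem// nth_index.
have e0 : l2norm (delta_mx (Ordinal N_gt0) 0 : 'cV[R]_N) = 1 by exact: l2norm_delta.
have [i0 i0L _] := spot _ e0.
exists (size us), D, (kmax.+1%:R^-1 / 2), (1 + c kmax); split.
- exact: leq_ltn_trans i0L.
- by rewrite divr_gt0// invr_gt0 ltr0n.
- by rewrite ltr_wpDr.
- move=> S DS; split => [u u0|i u iL].
    have nu : 0 < l2norm u by rewrite l2norm_gt0.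
    have [|i iL hi] := spot ((l2norm u)^-1 *: u).
      by rewrite l2normZ gtr0_norm ?invr_gt0// mulVf// gt_eqF.
    exists i => //; have := near_sense _ _ _ hi (DS i iL).
    rewrite -scalemxAr l2normZ gtr0_norm ?invr_gt0// [leRHS]mulrC ler_pdivlMr//.
    apply: le_trans; apply: ler_wpM2r => //; apply: ler_wpM2r; first by rewrite invr_ge0.
    by rewrite lef_pV2 ?posrE ?ltr0n// ler_nat ltnS kle.
  apply: le_trans (senses_le _ (DS i iL)) _; apply: ler_wpM2r => //.
  apply: (@le_trans _ _ (c kmax)); last by rewrite lerDr.
  have h : (k (nth 0 us i))%:R <= kmax%:R :> R by rewrite ler_nat kle.
  by rewrite /c !ler_pM// ?mulr_ge0//; apply: ler_wpM2l.
- move=> i; split; first exact: open_senses.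
  move=> iL; apply: hk; have : nth 0 us i \in us by exact: mem_nth.
  by rewrite mem_filter => /andP[].
Qed.

End Patterns.

Section FreshSketches.
Context (R : realType) (n m : nat) (d : measure_display) (Om : measurableType d).
Variables (P : probability Om R) (z : nat -> Om -> 'cV[R]_(n + m)).
Variables (B : nat -> Om -> 'M[R]_n) (S : nat -> nat -> Om -> sketch R (n + m)).
Variable Pr : probability (borel_sketch R (n + m)) R.
Hypothesis fresh : fresh_iid P z B S Pr.

Lemma measurable_sketch_preimage k j (D : set (sketch R (n + m))) :
  open D -> measurable (S k j @^-1` D).
Proof.
move=> oD; have [h _] := fresh k.+1; apply: h.
by apply: sub_sigma_algebra; right; exists k, j, D; rewrite ltnSn.
Qed.

(** Sketch sets prescribed at finitely many indices only: the others are filled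
    with the whole space, of probability [1]. *)
Lemma sketch_indep k (D : nat -> set (sketch R (n + m))) (s : seq nat) :
  (forall j, open (D j)) -> uniq s ->
  P [set w | forall j, j \in s -> D j (S k j w)] =
  (\prod_(j <- s) fine (Pr (D j)))%:E.
Proof.
move=> oD us; have [_ h] := fresh k.
have mD j : measurable (D j : set (borel_sketch R (n + m))).
  exact: measurable_open_sketch.
pose E j : set (borel_sketch R (n + m)) := if j \in s then D j else setT.
pose q := (\max_(j <- s) j).+1%N.
have sq j : j \in s -> (j < q)%N.
  by move=> js; rewrite ltnS; exact: (@leq_bigmax_seq _ s xpredT id _ js).
have pT : past z B S k setT by rewrite -setC0 -setTD; apply: sigma_algebraCD; exact: sigma_algebra0.
have mE j : measurable (E j) by rewrite /E; case: ifP.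
have := h setT E q pT mE; rewrite setTI probability_setT mul1e.
rewrite (_ : \bigcap_(j in _) _ = [set w | forall j, j \in s -> D j (S k j w)]); last first.
  apply/seteqP; split => [w hw j js|w hw j _] /=.
    by have := hw j (sq j js); rewrite /E /= js.
  by rewrite /E; case: ifPn => // js; exact: hw.
move=> ->.
have -> : (\prod_(j < q) Pr (E j) =
    \prod_(j < q) (if (j : nat) \in s then fine (Pr (D j)) else 1)%:E)%E.
  apply: eq_bigr => j _; rewrite /E; case: ifP => _; last exact: probability_setT.
  by rewrite fineK// fin_num_measure.
rewrite prodEFin -(big_mkord xpredT (fun j => if j \in s then fine (Pr (D j)) else 1)).
rewrite -big_mkcond /= -big_filter; congr _%:E; apply: perm_big.
apply: uniq_perm => //; first by rewrite filter_uniq ?iota_uniq.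
move=> j; rewrite mem_filter mem_index_iota /=.
by case: (boolP (j \in s)) => // /sq ->.
Qed.

Lemma ae_pattern_infinitely_often L (D : nat -> set (sketch R (n + m))) :
  (forall i, open (D i) /\ ((i < L)%N -> (0 < Pr (D i))%E)) ->
  {ae P, forall w, forall k t0, exists2 t, (t0 <= t)%N &
     forall i, (i < L)%N -> D i (S k (t * L + i)%N w)}.
Proof.
move=> hD; apply: ae_foralln => k.
pose D' j := D (j %% L)%N.
have oD' j : open (D' j) by have [] := hD (j %% L)%N.
have modL t i : (i < L)%N -> D' (t * L + i)%N = D i.
  by move=> iL; rewrite /D' modnMDl modn_small.
have h := @ae_block_infinitely_often R d Om P (fun j => S k j @^-1` D' j)
  (fun j => fine (Pr (D' j))) L (\prod_(j <- iota 0 L) fine (Pr (D j))).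
apply: filterS (h _ _ _ _) => [w hw t0||||].
- have [t tt ht] := hw t0; exists t => // i iL.
  by have := ht i iL; rewrite /= modL.
- by move=> j; exact: measurable_sketch_preimage.
- by move=> s us; exact: sketch_indep.
- move=> t; rewrite -[X in iota X]addn0 iotaDl big_map.
  by rewrite big_seq [RHS]big_seq; apply: eq_bigr => i; rewrite mem_iota => /modL ->.
- rewrite big_seq; apply: prodr_gt0 => i; rewrite mem_iota => iL.
  have [oD /(_ iL) pos] := hD i; apply: fine_gt0; rewrite pos /=.
  by rewrite ltey_eq fin_num_measure//; exact: measurable_open_sketch.
Qed.

End FreshSketches.

(** * Calculus along lines *)

Section Lines.
Variable R : realType.

Lemma gradE p (g : 'cV[R]_p -> R) x i : grad g x i 0 = pderiv i g x.
Proof. by rewrite mxE. Qed.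
Lemma hessE p (g : 'cV[R]_p -> R) x i j : hess g x i j = pderiv i (pderiv j g) x.
Proof. by rewrite mxE. Qed.

Lemma Ck2_differentiable p (g : 'cV[R]_p -> R) : Ck 2 setT g -> forall x, differentiable g x.
Proof. by move=> [h _] x; exact: h. Qed.

Lemma Ck2_differentiable_pderiv p (g : 'cV[R]_p -> R) :
  Ck 2 setT g -> forall j x, differentiable (pderiv j g) x.
Proof. by move=> [_ h] j x; have [h' _] := h j; exact: h'. Qed.

Lemma Ck2_continuous_hess p (g : 'cV[R]_p -> R) :
  Ck 2 setT g -> forall i j, continuous (fun x => hess g x i j).
Proof.
move=> [_ h] i j; rewrite (_ : (fun x => _) = pderiv i (pderiv j g)); last first.
  by apply/funext => x; rewrite mxE.
have [_ /(_ i) hc] := h j; rewrite /= in hc.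
exact: (@continuous_subspace_setT 'cV[R]_p R _).2 hc.
Qed.

Lemma is_derive_sumf m (F : 'I_m -> R -> R) (dF : 'I_m -> R) (t : R) :
  (forall i, is_derive t 1 (F i) (dF i)) ->
  is_derive t 1 (fun s => \sum_i F i s) (\sum_i dF i).
Proof.
move=> h; rewrite (_ : (fun s => _) = \sum_i F i); last by rewrite fct_sumE.
exact: is_derive_sum.
Qed.

Lemma is_derive_addf (F G : R -> R) (dF dG t : R) :
  is_derive t 1 F dF -> is_derive t 1 G dG ->
  is_derive t 1 (fun s => F s + G s) (dF + dG).
Proof. by move=> hF hG; exact: is_deriveD. Qed.

Lemma is_derive_mulf (F G : R -> R) (dF dG t : R) :
  is_derive t 1 F dF -> is_derive t 1 G dG ->
  is_derive t 1 (fun s => F s * G s) (F t * dG + G t * dF).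
Proof. by move=> hF hG; exact: is_deriveM. Qed.

Lemma is_derive_affine (a b t : R) : is_derive t 1 (fun s => a + s * b) b.
Proof.
have h := is_derive_addf (is_derive_cst a t 1)
  (is_derive_mulf (is_derive_id t (1 : R)) (is_derive_cst b t 1)).
by apply: is_derive_eq h _; rewrite mulr0 add0r mulr1 add0r.
Qed.

Lemma derive_dotp_grad p (h : 'cV[R]_p -> R) (y v : 'cV[R]_p) :
  differentiable h y -> 'd h y v = dotp (grad h y) v.
Proof.
move=> dh; rewrite {1}[v]cV_sum_delta linear_sum dotpE; apply: eq_bigr => i _.
by rewrite linearZ /= mxE /pderiv deriveE// mulrC.
Qed.

(** Functions of [(x, lambda)] built from [f] and [c] are differentiated along
    lines, where they become sums and products of functions of one real
    variable. *)
Lemma is_derive_line p (h : 'cV[R]_p -> R) (y v : 'cV[R]_p) (t : R) :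
  differentiable h (y + t *: v) ->
  is_derive t 1 (fun s => h (y + s *: v)) (dotp (grad h (y + t *: v)) v).
Proof.
move=> dh.
have dl : is_diff t (fun s : R => y + s *: v) ( *:%R^~ v).
  by apply: is_diff_eq; rewrite add0r.
pose l s : 'cV[R]_p := y + s *: v.
have dl1 : differentiable l t by exact: (@ex_diff _ _ _ _ _ _ _ dl).
have dc : differentiable (h \o l) t by exact: differentiable_comp.
apply: DeriveDef; first exact: diff_derivable.
rewrite deriveE// (diff_comp dl1 dh) /= (@diff_val _ _ _ _ _ _ _ dl) scale1r.
exact: derive_dotp_grad.
Qed.

Lemma mvt01 (F dF : R -> R) : (forall t : R, is_derive t (1 : R) F (dF t)) ->
  exists2 t, 0 < t < 1 & F 1 - F 0 = dF t.
Proof.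
move=> h; have cF : {within `[0, 1], continuous F}.
  apply: derivable_within_continuous => t _; have ht := h t.
  exact: (@ex_derive _ _ _ _ _ _ _ ht).
have [t] := MVT ltr01 (fun t _ => h t) cF.
by rewrite in_itv /= => t01; rewrite subr0 mulr1; exists t.
Qed.

Lemma mvt_line p (h : 'cV[R]_p -> R) (y v : 'cV[R]_p) :
  (forall x, differentiable h x) ->
  exists2 t, 0 < t < 1 & h (y + v) - h y = dotp (grad h (y + t *: v)) v.
Proof.
move=> dh; have [t t01 ht] := mvt01 (fun t => is_derive_line (dh (y + t *: v))).
by exists t => //; rewrite -ht scale1r scale0r addr0.
Qed.

(** Brings the partial derivatives in [grad] and [hess] back to derivatives along
    lines. *)
Lemma derive_line p (h : 'cV[R]_p -> R) (x v : 'cV[R]_p) (a : R) :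
  is_derive (0 : R) (1 : R) (fun t : R => h (x + t *: v)) a -> 'D_v h x = a.
Proof.
move=> [dh <-]; rewrite /derive. do 2 f_equal; apply/funext => t /=.
by rewrite addr0 scale0r addr0 -[t%:A]/(t * 1) mulr1 (addrC x).
Qed.

End Lines.

(** * The KKT map and the augmented Lagrangian *)

Section PrimalDual.
Variables (R : realType) (n m : nat).
Implicit Types (z d : 'cV[R]_(n + m)).

Lemma primalD z d : primal (z + d) = primal z + primal d.
Proof. exact: linearD. Qed.
Lemma primalZ a d : primal (a *: d) = a *: primal d.
Proof. exact: linearZ. Qed.
Lemma dual_varD z d : dual_var (z + d) = dual_var z + dual_var d.
Proof. exact: linearD. Qed.
Lemma dual_varZ a d : dual_var (a *: d) = a *: dual_var d.
Proof. exact: linearZ. Qed.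

Lemma l2norm_primal d : l2norm (primal d) <= l2norm d.
Proof. by rewrite -{2}[d]vsubmxK l2norm_col_mxl. Qed.

Lemma l2norm_dual_var d : l2norm (dual_var d) <= l2norm d.
Proof. by rewrite -{2}[d]vsubmxK l2norm_col_mxr. Qed.

Lemma primal_continuous : continuous (@primal R n m).
Proof.
move=> z; have Fz : Filter (nbhs z) := nbhs_filter z.
apply/(@cvgrPdist_lt _ 'cV[R]_n _ _ Fz) => e e0; near=> w.
rewrite -[primal z - primal w]linearB; apply: (@le_lt_trans _ _ `|z - w|).
  by apply: normr_le_coord => // i j; rewrite mxE coord_le_normr.
by near: w; move: e e0; apply/cvgrPdist_lt; exact: cvg_id.
Unshelve. all: by end_near. Qed.

Lemma dual_var_continuous : continuous (@dual_var R n m).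
Proof.
move=> z; have Fz : Filter (nbhs z) := nbhs_filter z.
apply/(@cvgrPdist_lt _ 'cV[R]_m _ _ Fz) => e e0; near=> w.
rewrite -[dual_var z - dual_var w]linearB; apply: (@le_lt_trans _ _ `|z - w|).
  by apply: normr_le_coord => // i j; rewrite mxE coord_le_normr.
by near: w; move: e e0; apply/cvgrPdist_lt; exact: cvg_id.
Unshelve. all: by end_near. Qed.

End PrimalDual.

Section LagrangianCalculus.
Variables (R : realType) (n m : nat).
Variables (f : 'cV[R]_n -> R) (c : 'cV[R]_n -> 'cV[R]_m).
Hypothesis f2 : Ck 2 setT f.
Hypothesis c2 : forall i, Ck 2 setT (component c i).
Implicit Types (z d : 'cV[R]_(n + m)).

Lemma jacE (x : 'cV[R]_n) i j : jac c x i j = pderiv j (component c i) x.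
Proof. by rewrite mxE. Qed.

Let df := Ck2_differentiable f2.
Let dc i := Ck2_differentiable (c2 i).
Let dpf := Ck2_differentiable_pderiv f2.
Let dpc i := Ck2_differentiable_pderiv (c2 i).

Lemma pderiv_lincomb (h0 : 'cV[R]_n -> R) (h : 'I_m -> 'cV[R]_n -> R)
    (a : 'I_m -> R) j (x : 'cV[R]_n) :
  differentiable h0 x -> (forall i, differentiable (h i) x) ->
  pderiv j (fun y => h0 y + \sum_i a i * h i y) x =
  pderiv j h0 x + \sum_i a i * pderiv j (h i) x.
Proof.
move=> d0 dh; set v : 'cV[R]_n := delta_mx j 0.
have line (k : 'cV[R]_n -> R) : differentiable k x ->
    is_derive (0 : R) (1 : R) (fun t : R => k (x + t *: v)) (pderiv j k x).
  move=> dk; have := @is_derive_line R n k x v 0; rewrite scale0r addr0 => /(_ dk).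
  by rewrite -derive_dotp_grad// -deriveE.
apply: derive_line; apply: is_derive_addf; first exact: line.
apply: is_derive_sumf => i.
have := is_derive_mulf (is_derive_cst (a i) (0 : R) 1) (line _ (dh i)).
by move=> h1; apply: is_derive_eq h1 _; rewrite mulr0 addr0.
Qed.

Lemma lagrE (lam : 'cV[R]_m) (x : 'cV[R]_n) :
  lagr f c lam x = f x + \sum_i lam i 0 * component c i x.
Proof. by rewrite /lagr dotpE. Qed.

Lemma gradx_lagrE z j : gradx_lagr f c z j 0 =
  pderiv j f (primal z) + \sum_i dual_var z i 0 * jac c (primal z) i j.
Proof.
rewrite mxE (_ : lagr f c _ = fun y => f y + \sum_i dual_var z i 0 * component c i y); last first.
  by apply/funext => y; rewrite lagrE.
rewrite pderiv_lincomb; [|exact: df|by move=> i; exact: dc].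
by congr (_ + _); apply: eq_bigr => i _; rewrite jacE.
Qed.

Lemma hess_lagrE z i j : hess_lagr f c z i j =
  hess f (primal z) i j + \sum_k dual_var z k 0 * hess (component c k) (primal z) i j.
Proof.
have E : pderiv j (lagr f c (dual_var z)) = fun y => pderiv j f y +
    \sum_k dual_var z k 0 * pderiv j (component c k) y.
  apply/funext => y; rewrite (_ : lagr f c _ = fun y =>
      f y + \sum_i dual_var z i 0 * component c i y); last first.
    by apply/funext => y'; rewrite lagrE.
  by rewrite pderiv_lincomb; [|exact: df|by move=> k; exact: dc].
transitivity (pderiv i (pderiv j (lagr f c (dual_var z))) (primal z)); first exact: hessE.
rewrite E pderiv_lincomb; [|exact: dpf|by move=> k; exact: dpc].
congr (_ + _); first exact/esym/hessE.
by apply: eq_bigr => k _; congr (_ * _); exact/esym/hessE.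
Qed.

(** The derivative of the KKT map [grad_lagr]. The Hessian is transposed because
    the row index of [hess] is the one of the last differentiation. *)
Definition kkt_jac z : 'M[R]_(n + m) :=
  block_mx (hess_lagr f c z)^T (jac c (primal z))^T (jac c (primal z)) 0.

Lemma is_derive_grad_lagr z d (t : R) p :
  is_derive t (1 : R) (fun s => grad_lagr f c (z + s *: d) p 0)
    ((kkt_jac (z + t *: d) *m d) p 0).
Proof.
set x := primal z; set u := primal d; set l := dual_var z; set v := dual_var d.
have xt s : primal (z + s *: d) = x + s *: u by rewrite primalD primalZ.
have lt_ s i : dual_var (z + s *: d) i 0 = l i 0 + s * v i 0.
  by rewrite dual_varD dual_varZ !mxE.
have dE : d = col_mx u v by rewrite vsubmxK.
rewrite /kkt_jac [X in _ *m X]dE mul_block_col mul0mx addr0.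
have [j ->|i ->] := split_ordP p.
  rewrite (_ : (fun s => _) = fun s => pderiv j f (x + s *: u) +
      \sum_i (l i 0 + s * v i 0) * pderiv j (component c i) (x + s *: u)); last first.
    apply/funext => s; rewrite /grad_lagr col_mxEu gradx_lagrE xt.
    by congr (_ + _); apply: eq_bigr => i _; rewrite lt_ jacE.
  have h := is_derive_addf (is_derive_line (dpf j (x + t *: u)))
    (is_derive_sumf (fun i => is_derive_mulf (is_derive_affine (l i 0) (v i 0) t)
      (is_derive_line (dpc i j (x + t *: u))))).
  apply: is_derive_eq h _; rewrite col_mxEu mxE [X in _ = X + _]mxE [X in _ = _ + X]mxE.
  rewrite big_split /= addrA; congr (_ + _); last first.
    by apply: eq_bigr => i _; rewrite trE jacE xt.
  transitivity (\sum_a (grad (pderiv j f) (x + t *: u) a 0 * u a 0 + \sum_i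
      (l i 0 + t * v i 0) * (grad (pderiv j (component c i)) (x + t *: u) a 0 * u a 0))).
    rewrite big_split /= exchange_big /=; congr (_ + _); first exact: dotpE.
    by apply: eq_bigr => i _; rewrite dotpE mulr_sumr.
  apply: eq_bigr => a _.
  rewrite [in RHS](trE (hess_lagr f c (z + t *: d)) j a) [in RHS](hess_lagrE (z + t *: d) a j).
  rewrite [in RHS]xt mulrDl mulr_suml; congr (_ + _).
    by congr (_ * _); exact: etrans (gradE _ _ _) (esym (hessE _ _ _ _)).
  apply: eq_bigr => i _; rewrite lt_ mulrA; congr (_ * _ * _).
  exact: etrans (gradE _ _ _) (esym (hessE _ _ _ _)).
rewrite (_ : (fun s => _) = fun s => component c i (x + s *: u)); last first.
  by apply/funext => s; rewrite /grad_lagr col_mxEd xt.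
apply: is_derive_eq (is_derive_line (dc i (x + t *: u))) _.
by rewrite col_mxEd mxE dotpE; apply: eq_bigr => a _; rewrite gradE jacE xt.
Qed.

Definition lagr_at z : R := lagr f c (dual_var z) (primal z).

Lemma is_derive_lagr_at z d (t : R) :
  is_derive t (1 : R) (fun s => lagr_at (z + s *: d))
    (dotp (grad_lagr f c (z + t *: d)) d).
Proof.
set x := primal z; set u := primal d; set l := dual_var z; set v := dual_var d.
have xt s : primal (z + s *: d) = x + s *: u by rewrite primalD primalZ.
have lt_ s i : dual_var (z + s *: d) i 0 = l i 0 + s * v i 0.
  by rewrite dual_varD dual_varZ !mxE.
have dE : d = col_mx u v by rewrite vsubmxK.
rewrite (_ : (fun s => _) = fun s => f (x + s *: u) +
    \sum_i (l i 0 + s * v i 0) * component c i (x + s *: u)); last first.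
  apply/funext => s; rewrite /lagr_at lagrE xt.
  by congr (_ + _); apply: eq_bigr => i _; rewrite lt_.
have h := is_derive_addf (is_derive_line (df (x + t *: u)))
  (is_derive_sumf (fun i => is_derive_mulf (is_derive_affine (l i 0) (v i 0) t)
    (is_derive_line (dc i (x + t *: u))))).
apply: is_derive_eq h _; rewrite {2}dE dotp_col_mx big_split /= addrA.
congr (_ + _); last by rewrite dotpE xt.
rewrite [RHS]dotpE; under [RHS]eq_bigr => j _ do rewrite gradx_lagrE mulrDl mulr_suml.
rewrite big_split /= dotpE; congr (_ + _).
  by apply: eq_bigr => j _; rewrite gradE xt.
rewrite exchange_big /=; apply: eq_bigr => i _; rewrite dotpE mulr_sumr.
by apply: eq_bigr => j _; rewrite lt_ xt gradE jacE mulrA.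
Qed.

(** The diagonal weights of the two penalty terms of the augmented Lagrangian,
    which is the Lagrangian plus half of the weighted square of the KKT map. *)
Definition weights (e1 e2 : R) (g : 'cV[R]_(n + m)) : 'cV[R]_(n + m) :=
  col_mx (e2 *: primal g) (e1 *: dual_var g).

Lemma weightsE e1 e2 (g : 'cV[R]_(n + m)) i :
  weights e1 e2 g i 0 = weights e1 e2 (const_mx 1) i 0 * g i 0.
Proof.
by have [j ->|j ->] := split_ordP i;
  rewrite /weights /primal /dual_var !(col_mxEu, col_mxEd) !mxE mulr1.
Qed.

Lemma aug_lagrE e1 e2 z : aug_lagr f c e1 e2 z =
  lagr_at z + 2^-1 * dotp (weights e1 e2 (grad_lagr f c z)) (grad_lagr f c z).
Proof.
rewrite /aug_lagr /lagr_at -[in RHS](vsubmxK (grad_lagr f c z)) dotp_col_mx !dotpZl.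
rewrite /grad_lagr /primal /dual_var !col_mxKu !col_mxKd !l2norm_sqr.
by rewrite -addrA; congr (_ + _); ring.
Qed.

(** The function is the Lagrangian, of gradient [g], plus [g . W g / 2] with [W]
    the weights; so its gradient is [g + M^T W g]. *)
Lemma dotp_grad_aug_lagr e1 e2 z d :
  dotp (grad (aug_lagr f c e1 e2) z) d =
  dotp (grad_lagr f c z) d +
  dotp (weights e1 e2 (grad_lagr f c z)) (kkt_jac z *m d).
Proof.
set g := grad_lagr f c z.
suff h p : pderiv p (aug_lagr f c e1 e2) z =
    dotp g (delta_mx p 0) + dotp (weights e1 e2 g) (kkt_jac z *m delta_mx p 0).
  rewrite {2 3}[d]cV_sum_delta.
  have lin (a : 'cV[R]_(n + m)) : dotp a (\sum_i d i 0 *: delta_mx i 0) =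
      \sum_i d i 0 * dotp a (delta_mx i 0).
    rewrite {1}/dotp mulmx_sumr summxE; apply: eq_bigr => i _.
    by rewrite -scalemxAr mxE.
  rewrite dotp_mulmxr !lin -big_split /= dotpE; apply: eq_bigr => p _.
  by rewrite mxE h dotp_mulmxr -mulrDr mulrC.
apply: derive_line; set v := delta_mx p 0.
rewrite (_ : (fun t : R => _) = fun t => lagr_at (z + t *: v) +
    2^-1 * \sum_i (weights e1 e2 (const_mx 1)) i 0 *
      (grad_lagr f c (z + t *: v) i 0 * grad_lagr f c (z + t *: v) i 0)); last first.
  apply/funext => t; rewrite aug_lagrE; congr (_ + _ * _); rewrite dotpE.
  apply: eq_bigr => i _; rewrite mulrA; congr (_ * _).
  exact: weightsE.
have D := is_derive_addf (is_derive_lagr_at z v 0)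
  (is_derive_mulf (is_derive_cst (2^-1 : R) (0 : R) 1) (is_derive_sumf (fun i =>
    is_derive_mulf (is_derive_cst ((weights e1 e2 (const_mx 1)) i 0) (0 : R) 1)
    (is_derive_mulf (is_derive_grad_lagr z v 0 i) (is_derive_grad_lagr z v 0 i))))).
apply: is_derive_eq D _; rewrite scale0r addr0; congr (_ + _).
rewrite mulr0 addr0 mulr_sumr dotpE; apply: eq_bigr => i _.
rewrite mulr0 addr0 -/g.
have -> : weights e1 e2 g i 0 = weights e1 e2 (const_mx 1) i 0 * g i 0.
  exact: weightsE.
by rewrite /cst; field.
Qed.

End LagrangianCalculus.

(** * First- and second-order expansions *)

Section Bounds.
Variable R : realType.

Lemma finite_common_bound (I : finType) (Q : I -> R -> Prop) :
  (forall i b b', Q i b -> b <= b' -> Q i b') ->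
  (forall i, exists2 b : R, 0 <= b & Q i b) -> exists2 b : R, 0 <= b & forall i, Q i b.
Proof.
move=> mono /(_ _)/cid2 h; exists (\sum_i s2val (h i)).
  by apply: sumr_ge0 => i _; exact: (s2valP (h i)).
move=> i; apply: (mono _ _ _ (s2valP' (h i))).
rewrite (bigD1 i)//= lerDl; apply: sumr_ge0 => j _; exact: (s2valP (h j)).
Qed.

Lemma compact_continuous_bounded p (A : set 'cV[R]_p) (h : 'cV[R]_p -> R) :
  compact A -> continuous h -> exists2 b : R, 0 <= b & forall x, A x -> `|h x| <= b.
Proof.
move=> cA ch.
have : compact (h @` A) by apply: continuous_compact => //; exact: continuous_subspaceT.
move/compact_bounded => [M [_ hM]]; exists (`|M| + 1); first by rewrite addr_ge0.
move=> x Ax; apply: (hM (`|M| + 1)); last by exists x.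
by rewrite (le_lt_trans (ler_norm _))// ltrDl.
Qed.

Lemma convex_setP p (A : set 'cV[R]_p) (x y : 'cV[R]_p) (t : R) :
  convex_set (A : set (convex_lmodType 'cV[R]_p)) -> A x -> A y -> 0 <= t <= 1 ->
  A (x + t *: (y - x)).
Proof.
move=> cA Ax Ay /andP[t0 t1].
have := cA y x (Itv01 t0 t1); rewrite !inE => /(_ Ay Ax).
have -> : x + t *: (y - x) = t *: y + (1 - t) *: x.
  by apply/colP => i; rewrite !mxE; ring.
exact.
Qed.

End Bounds.

Section KKTMap.
Variables (R : realType) (n m : nat).
Variables (f : 'cV[R]_n -> R) (c : 'cV[R]_n -> 'cV[R]_m).
Hypothesis f2 : Ck 2 setT f.
Hypothesis c2 : forall i, Ck 2 setT (component c i).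
Implicit Types (z y w d : 'cV[R]_(n + m)).
Notation g := (grad_lagr f c).
Notation M := (kkt_jac f c).

(** The mean value theorem for each component; the intermediate point depends on
    the component, so the derivatives are compared entry by entry. *)
Lemma grad_lagr_increment z d kap :
  (forall t, 0 <= t <= 1 -> forall p q, `|M (z + t *: d) p q - M z p q| <= kap) ->
  l2norm (g (z + d) - g z - M z *m d) <= (n + m)%:R ^+ 2 * kap * l2norm d.
Proof.
move=> h; rewrite expr2 -!mulrA; apply: l2norm_le_coord => p.
have [t /andP[t0 t1]] := mvt01 (is_derive_grad_lagr f2 c2 z d ^~ p).
rewrite scale1r scale0r addr0 => E.
have -> : (g (z + d) - g z - M z *m d) p 0 = ((M (z + t *: d) - M z) *m d) p 0.
  by rewrite mulmxBl [LHS]mxE [RHS]mxE -E [X in X + _]mxE [(- g z) p 0]mxE.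
rewrite mxE (le_trans (ler_norm_sum _ _ _))//.
rewrite (@le_trans _ _ (\sum_(q < n + m) kap * l2norm d))//.
  apply: ler_sum => q _; rewrite normrM ler_pM ?l2norm_coord//.
  by rewrite mxE [(- M z) p q]mxE h// !ltW.
by rewrite sumr_const card_ord mulr_natl.
Qed.

Lemma kkt_jac_ul z i j : M z (lshift m i) (lshift m j) = hess f (primal z) j i +
  \sum_k dual_var z k 0 * hess (component c k) (primal z) j i.
Proof.
rewrite -(hess_lagrE f2 c2 z j i) -(trE (hess_lagr f c z) i j).
exact: block_mxEul.
Qed.

Lemma kkt_jac_ur z i j :
  M z (lshift m i) (rshift n j) = pderiv i (component c j) (primal z).
Proof. by rewrite /kkt_jac block_mxEur trE jacE. Qed.

Lemma kkt_jac_dl z i j :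
  M z (rshift n i) (lshift m j) = pderiv j (component c i) (primal z).
Proof. by rewrite /kkt_jac block_mxEdl jacE. Qed.

Lemma kkt_jac_dr z i j : M z (rshift n i) (rshift n j) = 0.
Proof. by rewrite /kkt_jac block_mxEdr mxE. Qed.

Lemma kkt_jac_continuous p q : continuous (fun z => M z p q).
Proof.
have cG i j : continuous (fun z : 'cV[R]_(n + m) => pderiv j (component c i) (primal z)).
  move=> z; apply: (@continuous_comp _ _ _ (@primal R n m) (pderiv j (component c i))).
    exact: primal_continuous.
  exact: (differentiable_continuous (Ck2_differentiable_pderiv (c2 i) j (primal z))).
have cH (h : 'cV[R]_n -> R) i j : Ck 2 setT h ->
    continuous (fun z : 'cV[R]_(n + m) => hess h (primal z) i j).
  move=> h2 z; apply: (@continuous_comp _ _ _ (@primal R n m) (fun x => hess h x i j)).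
    exact: primal_continuous.
  exact: Ck2_continuous_hess.
have cL k : continuous (fun z : 'cV[R]_(n + m) => dual_var z k 0).
  rewrite (_ : (fun z => _) = fun z : 'cV[R]_(n + m) => z (rshift n k) 0); first exact: coord_continuous.
  by apply/funext => z; rewrite mxE.
have [i ->|i ->] := split_ordP p; have [j ->|j ->] := split_ordP q.
- rewrite (_ : (fun z => _) = fun z => hess f (primal z) j i +
      \sum_k dual_var z k 0 * hess (component c k) (primal z) j i); last first.
    by apply/funext => z; rewrite kkt_jac_ul.
  move=> z; apply: continuousD; first exact: (cH f j i f2).
  move: z; apply: continuous_big => [|k _ z]; first exact: add_continuous.
  by apply: continuousM; [exact: cL|exact: (cH _ j i (c2 k))].
- rewrite (_ : (fun z => _) = fun z => pderiv i (component c j) (primal z)); first exact: cG.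
  by apply/funext => z; rewrite kkt_jac_ur.
- rewrite (_ : (fun z => _) = fun z => pderiv j (component c i) (primal z)); first exact: cG.
  by apply/funext => z; rewrite kkt_jac_dl.
- rewrite (_ : (fun z => _) = fun z => 0); first exact: cst_continuous.
  by apply/funext => z; rewrite kkt_jac_dr.
Qed.

Lemma kkt_jac_near zs kap : 0 < kap -> exists2 rho, 0 < rho &
  forall w, l2norm (w - zs) < rho -> forall p q, `|M zs p q - M w p q| < kap.
Proof.
move=> kap0.
have Fz : Filter (nbhs zs) := nbhs_filter zs.
have : \forall w \near zs, forall p, forall q, `|M zs p q - M w p q| < kap.
  apply: (@filter_forall _ _ (fun p w => forall q, `|M zs p q - M w p q| < kap) _ Fz) => p.
  apply: (@filter_forall _ _ (fun q w => `|M zs p q - M w p q| < kap) _ Fz) => q.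
  exact: (@cvgrPdist_lt _ R _ _ Fz _ _).1 (@kkt_jac_continuous p q zs) _ kap0.
move=> /nbhs_normP[rho /= rho0 h]; exists rho => // w hw p q; apply: h => /=.
by rewrite -normrN opprB (le_lt_trans (normr_le_l2norm _)).
Qed.

(** The linearization is taken at [y], which stands for a moving iterate, and not
    at the limit [zs]: continuity of [M] at [zs] makes it uniformly accurate. *)
Lemma grad_lagr_strictly_differentiable zs eps : 0 < eps -> exists2 rho, 0 < rho &
  forall y d, l2norm (y - zs) < rho -> l2norm (y + d - zs) < rho ->
  forall t, 0 <= t <= 1 ->
  l2norm (g (y + t *: d) - g y - t *: (M y *m d)) <= eps * l2norm d.
Proof.
move=> eps0; pose N : R := 1 + (n + m)%:R ^+ 2.
have N0 : 0 < N by rewrite ltr_wpDr// sqr_ge0.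
have k0 : 0 < eps / N / 2 by rewrite !divr_gt0.
have [rho rho0 near] := kkt_jac_near zs k0; exists rho => // y d hy hyd t /andP[t0 t1].
have tri (a b e : R) : `|b - a| < eps / N / 2 -> `|b - e| < eps / N / 2 -> `|a - e| <= eps / N.
  by move=> h1 h2; apply: le_trans (ler_distD b _ _) _; rewrite (distrC a); lra.
have seg s : 0 <= s <= 1 -> l2norm (y + s *: d - zs) < rho.
  move=> /andP[s0 s1].
  have -> : y + s *: d - zs = (1 - s) *: (y - zs) + s *: (y + d - zs).
    by apply/colP => i; rewrite !mxE; ring.
  apply: le_lt_trans (l2normD _ _) _; rewrite !l2normZ !ger0_norm ?subr_ge0//.
  have [->|s1'] := eqVneq s 1; first by rewrite subrr mul0r add0r mul1r.
  have : 0 < (1 - s) * (rho - l2norm (y - zs)).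
    by rewrite mulr_gt0// subr_gt0// lt_neqAle s1'.
  have : 0 <= s * (rho - l2norm (y + d - zs)) by rewrite mulr_ge0// subr_ge0 ltW.
  lra.
have := @grad_lagr_increment y (t *: d) (eps / N).
rewrite -scalemxAr => /(_ _)/le_trans; apply.
  move=> s /andP[s0 s1] p q; rewrite scalerA.
  have st : 0 <= s * t <= 1 by rewrite mulr_ge0//= mulr_ile1.
  exact: tri (near _ (seg _ st) p q) (near _ hy p q).
rewrite l2normZ ger0_norm//.
have -> : (n + m)%:R ^+ 2 * (eps / N) * (t * l2norm d) =
  eps * l2norm d * (t * ((n + m)%:R ^+ 2 / N)) by ring.
rewrite ler_piMr// ?mulr_ge0 ?(ltW eps0)// mulr_ile1//.
  by rewrite divr_ge0 ?sqr_ge0// ltW.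
by rewrite ler_pdivrMr// mul1r lerDr.
Qed.

(** Second-order expansion of the Lagrangian, from the first-order expansion of
    its gradient. *)
Lemma lagr_at_expansion y d eps :
  (forall t, 0 <= t <= 1 ->
    l2norm (g (y + t *: d) - g y - t *: (M y *m d)) <= eps * l2norm d) ->
  lagr_at f c (y + d) <= lagr_at f c y + dotp (g y) d + 2^-1 * dotp d (M y *m d)
    + eps * l2norm d ^+ 2.
Proof.
move=> h; pose b := dotp d (M y *m d).
pose F t := lagr_at f c (y + t *: d) + (0 + t * - dotp (g y) d) +
  t * (0 + t * - (2^-1 * b)).
have dF (t : R) : is_derive t (1 : R) F
    (dotp (g (y + t *: d) - g y - t *: (M y *m d)) d).
  have D1 := is_derive_addf (is_derive_lagr_at f2 c2 y d t)
    (is_derive_affine 0 (- dotp (g y) d) t).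
  have D2 := is_derive_mulf (is_derive_id t (1 : R)) (is_derive_affine 0 (- (2^-1 * b)) t).
  have D := is_derive_addf D1 D2.
  apply: is_derive_eq D _; rewrite !dotpBl dotpZl (dotpC (M y *m d)) -/b /=; by field.
have [t /andP[t0 t1] E] := mvt01 dF.
have : F 1 - F 0 <= eps * l2norm d ^+ 2.
  rewrite E (le_trans (dotp_le _ _))// expr2 mulrA ler_wpM2r// h// !ltW//.
rewrite /F scale1r scale0r addr0 -/b; lra.
Qed.

End KKTMap.

(** * Uniform bounds on a compact convex set *)

Section CompactBounds.
Variable R : realType.

(** One constant for four bounds, so that those of [f] and of the components of
    [c] merge into one. *)
Definition C2_bound n (A : set 'cV[R]_n) (h : 'cV[R]_n -> R) (b : R) : Prop :=
  forall x y, A x -> A y -> forall i j,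
  [/\ `|hess h x i j| <= b, `|hess h x i j - hess h y i j| <= b * l2norm (x - y),
      `|pderiv j h x| <= b & `|pderiv j h x - pderiv j h y| <= b * l2norm (x - y)].

Lemma C2_bound_mono n (A : set 'cV[R]_n) h b b' : C2_bound A h b -> b <= b' -> C2_bound A h b'.
Proof.
move=> H bb x y Ax Ay i j; have [h1 h2 h3 h4] := H x y Ax Ay i j.
by split; apply: le_trans; [exact: h1| |exact: h2| |exact: h3| |exact: h4|] => //;
  apply: ler_wpM2r.
Qed.

Lemma C2_bound_exists n (A : set 'cV[R]_n) h : Ck 2 setT h -> compact A ->
  convex_set (A : set (convex_lmodType 'cV[R]_n)) -> lipschitz_hess A h ->
  exists2 b : R, 0 <= b & C2_bound A h b.
Proof.
move=> h2 cA vA [L hL].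
have [b1 b10 hb1] : exists2 b : R, 0 <= b & forall ij : 'I_n * 'I_n, forall x, A x ->
    `|hess h x ij.1 ij.2| <= b.
  apply: finite_common_bound => [ij b b' H bb x Ax|ij]; first exact: le_trans (H x Ax) bb.
  exact: (compact_continuous_bounded cA (@Ck2_continuous_hess R n h h2 ij.1 ij.2)).
have [b2 b20 hb2] : exists2 b : R, 0 <= b & forall j, forall x, A x -> `|pderiv j h x| <= b.
  apply: finite_common_bound => [j b b' H bb x Ax|j]; first exact: le_trans (H x Ax) bb.
  apply: (@compact_continuous_bounded R n A (pderiv j h) cA) => x.
  exact: (differentiable_continuous (Ck2_differentiable_pderiv h2 j x)).
have b30 : 0 <= n%:R * b1 by rewrite mulr_ge0.
exists (b1 + `|L| + b2 + n%:R * b1); first by rewrite !addr_ge0.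
move=> x y Ax Ay i j; have nxy : 0 <= l2norm (x - y) by [].
have aL : 0 <= `|L| by [].
split.
- by have := hb1 (i, j) x Ax => /=; lra.
- have := opnorm_entry (hess h x - hess h y) i j; rewrite subE => h1.
  apply: le_trans h1 _; apply: le_trans (hL x y Ax Ay) _; apply: ler_wpM2r => //.
  have := ler_norm L; lra.
- by have := hb2 j x Ax; lra.
- have [t /andP[t0 t1] E] := mvt_line y (x - y) (Ck2_differentiable_pderiv h2 j).
  rewrite (_ : y + (x - y) = x) in E; last by rewrite addrC subrK.
  rewrite E.
  have At : A (y + t *: (x - y)) by apply: convex_setP => //; rewrite !ltW.
  apply: le_trans (ler_abs_dotp _ _) _; apply: ler_wpM2r => //.
  apply: (@le_trans _ _ (n%:R * b1)); last lra.
  apply: l2norm_le_coord => k; rewrite gradE -hessE; exact: (hb1 (k, j)).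
Qed.

Variables (n m : nat) (f : 'cV[R]_n -> R) (c : 'cV[R]_n -> 'cV[R]_m).
Hypothesis f2 : Ck 2 setT f.
Hypothesis c2 : forall i, Ck 2 setT (component c i).
Variables (X : set 'cV[R]_n) (Lam : set 'cV[R]_m).
Hypotheses (cX : compact X) (vX : convex_set (X : set (convex_lmodType 'cV[R]_n))).
Hypotheses (cL : compact Lam) (vL : convex_set (Lam : set (convex_lmodType 'cV[R]_m))).
Hypotheses (lf : lipschitz_hess X f) (lc : forall i, lipschitz_hess X (component c i)).
Notation g := (grad_lagr f c).
Notation M := (kkt_jac f c).

(** The Hessian block is linear in the multiplier, so its Lipschitz constant
    involves the bounds on [Lam] and on the second derivatives. *)
Lemma kkt_jac_bounds : exists2 C : R, 0 <= C & forall z w : 'cV[R]_(n + m),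
  X (primal z) /\ Lam (dual_var z) -> X (primal w) /\ Lam (dual_var w) ->
  forall p q, `|M z p q| <= C /\ `|M z p q - M w p q| <= C * l2norm (z - w).
Proof.
have [bf bf0 hf] := C2_bound_exists f2 cX vX lf.
have [bc bc0 hc] : exists2 b : R, 0 <= b & forall i, C2_bound X (component c i) b.
  apply: finite_common_bound => [i b b' h bb|i]; first exact: (C2_bound_mono h bb).
  exact: (C2_bound_exists (c2 i) cX vX (lc i)).
have [bl bl0 hl] : exists2 b : R, 0 <= b & forall k, forall l, Lam l -> `|l k 0| <= b.
  apply: finite_common_bound => [j b b' H bb x Ax|j]; first exact: le_trans (H x Ax) bb.
  apply: (@compact_continuous_bounded R m Lam (fun l => l j 0) cL).
  exact: coord_continuous.
have mm : 0 <= m%:R * (bl * bc) :> R by rewrite !mulr_ge0.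
have mb : 0 <= m%:R * bc :> R by rewrite !mulr_ge0.
exists (bf + bc + m%:R * (bl * bc) + m%:R * bc); first by rewrite !addr_ge0.
set C := _ + _ + _ + _.
have bcC : bc <= C by rewrite /C; lra.
have C0 : 0 <= C by rewrite (le_trans bc0).
move=> z w [Xz Lz] [Xw Lw] p q; set r := l2norm (z - w).
have r0 : 0 <= r by exact: l2norm_ge0.
have px : l2norm (primal z - primal w) <= r.
  by rewrite -[primal z - primal w]linearB l2norm_primal.
have pl k : `|dual_var z k 0 - dual_var w k 0| <= r.
  have := l2norm_coord (dual_var (z - w)) k.
  rewrite [dual_var (z - w)]linearB subE => h.
  apply: le_trans h _; rewrite -[_ - _]linearB; exact: l2norm_dual_var.
have lift b s : b <= C -> s <= b * l2norm (primal z - primal w) -> s <= C * r.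
  move=> bC; move/le_trans; apply; apply: (@le_trans _ _ (C * l2norm (primal z - primal w))).
    exact: ler_wpM2r.
  exact: ler_wpM2l.
have [i ->|i ->] := split_ordP p; have [j ->|j ->] := split_ordP q.
- rewrite !(kkt_jac_ul f2 c2).
  have [h1 h2 _ _] := hf _ _ Xz Xw j i; split.
    apply: le_trans (ler_normD _ _) _; apply: (@le_trans _ _ (bf + m%:R * (bl * bc))).
      apply: lerD => //; apply: le_trans (ler_norm_sum _ _ _) _.
      apply: (@le_trans _ _ (\sum_(k < m) bl * bc)).
        apply: ler_sum => k _; rewrite normrM ler_pM ?hl//.
        by have [] := hc k _ _ Xz Xw j i.
      by rewrite sumr_const card_ord mulr_natl.
    rewrite /C; lra.
  rewrite opprD addrACA -sumrB; apply: le_trans (ler_normD _ _) _.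
  apply: (@le_trans _ _ (bf * r + m%:R * (r * bc + bl * (bc * r)))).
    apply: lerD; first by apply: le_trans h2 _; exact: ler_wpM2l.
    apply: le_trans (ler_norm_sum _ _ _) _.
    apply: (@le_trans _ _ (\sum_(k < m) (r * bc + bl * (bc * r)))); last first.
      by rewrite sumr_const card_ord mulr_natl.
    apply: ler_sum => k _; have [k1 k2 _ _] := hc k _ _ Xw Xz j i.
    have prodB (a a' b b' : R) : a * b - a' * b' = (a - a') * b' + a * (b - b') by ring.
    rewrite prodB.
    apply: le_trans (ler_normD _ _) _; rewrite !normrM; apply: lerD.
      by rewrite ler_pM ?pl.
    rewrite ler_pM ?hl// distrC; apply: le_trans k2 _.
    by rewrite l2normBC; exact: ler_wpM2l.
  have : 0 <= bc * r by rewrite mulr_ge0.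
  rewrite /C !mulrDr !mulrDl [m%:R * (bl * bc) * r](_ : _ = m%:R * (bl * (bc * r))); last by ring.
  rewrite (mulrC r bc) mulrA; lra.
- rewrite !kkt_jac_ur.
  have [_ _ h1 h2] := hc j _ _ Xz Xw i i.
  by split; [exact: le_trans bcC|exact: lift h2].
- rewrite !kkt_jac_dl.
  have [_ _ h1 h2] := hc i _ _ Xz Xw j j.
  by split; [exact: le_trans bcC|exact: lift h2].
- by rewrite !kkt_jac_dr subrr normr0; split=> //; rewrite mulr_ge0.
Qed.

(** Convexity keeps the segment from [z] to [w] in the region where [M] is
    Lipschitz. *)
Lemma grad_lagr_quadratic : exists2 C : R, 0 <= C & forall z w : 'cV[R]_(n + m),
  X (primal z) /\ Lam (dual_var z) -> X (primal w) /\ Lam (dual_var w) ->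
  l2norm (g w - g z - M z *m (w - z)) <= C * l2norm (w - z) ^+ 2.
Proof.
have [C C0 hC] := kkt_jac_bounds.
exists ((n + m)%:R ^+ 2 * C); first by rewrite mulr_ge0// sqr_ge0.
move=> z w [Xz Lz] [Xw Lw].
have := @grad_lagr_increment R n m f c f2 c2 z (w - z) (C * l2norm (w - z)).
rewrite (_ : z + (w - z) = w); last by rewrite addrC subrK.
move=> /(_ _)/le_trans; apply; last by rewrite expr2 !mulrA.
move=> t t01 p q.
have hz : X (primal (z + t *: (w - z))) /\ Lam (dual_var (z + t *: (w - z))).
  rewrite primalD primalZ dual_varD dual_varZ.
  have -> : primal (w - z) = primal w - primal z by exact: linearB.
  have -> : dual_var (w - z) = dual_var w - dual_var z by exact: linearB.
  by split; exact: convex_setP.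
have [_ h] := hC _ _ hz (conj Xz Lz) p q; apply: le_trans h _.
apply: ler_wpM2l => //; rewrite addrAC subrr add0r l2normZ.
by move/andP: t01 => [t0 t1]; rewrite ger0_norm// ler_piMl.
Qed.

End CompactBounds.

(** * Descent directions of the augmented Lagrangian *)

Section Inequalities.
Variable R : realType.

Lemma young (a b t : R) : 0 < t -> a * b <= t * a ^+ 2 + b ^+ 2 / (4 * t).
Proof.
move=> t0; have h := sqr_ge0 (2 * t * a - b).
have -> : t * a ^+ 2 + b ^+ 2 / (4 * t) = a * b + (2 * t * a - b) ^+ 2 / (4 * t).
  by field; rewrite gt_eqF.
by rewrite lerDl divr_ge0// mulr_ge0// ltW.
Qed.

Lemma exprn_unbounded (nu b : R) : 1 < nu -> exists T0, forall T, (T0 <= T)%N -> b <= nu ^+ T.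
Proof.
move=> nu1; pose x := nu - 1; have x0 : 0 < x by rewrite subr_gt0.
have bern T : 1 + T%:R * x <= nu ^+ T.
  elim: T => [|T ih]; first by rewrite mul0r addr0 expr0.
  rewrite exprS; have Tx : 0 <= T%:R * x by rewrite mulr_ge0// ltW.
  have -> : nu = 1 + x by rewrite addrC subrK.
  apply: (@le_trans _ _ ((1 + x) * (1 + T%:R * x))).
    by rewrite -natr1; have := mulr_ge0 (ltW x0) Tx; lra.
  apply: ler_wpM2l; first by rewrite addr_ge0// ltW.
  by rewrite (_ : 1 + x = nu)// addrC subrK.
exists (Num.bound `|b / x|) => T hT; apply: le_trans (bern T).
have h1 : b / x <= T%:R.
  apply: le_trans (ler_norm _) _; apply: ltW.
  apply: lt_le_trans (archi_boundP (normr_ge0 _)) _.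
  by rewrite ler_nat.
rewrite ler_pdivrMr// in h1; lra.
Qed.

End Inequalities.

Section Conditioning.
Variables (R : realType) (n m : nat).
Variables (f : 'cV[R]_n -> R) (c : 'cV[R]_n -> 'cV[R]_m).
Implicit Types (z d u : 'cV[R]_(n + m)) (B : 'M[R]_n).
Notation g := (grad_lagr f c).
Notation M := (kkt_jac f c).
Notation Gam z B := (kkt_mx B (jac c (primal z))).

(** The quantitative content of the assumptions at an iterate, with one
    constant [K] for all bounds. *)
Record well_conditioned (K xB : R) z B : Prop := WellConditioned {
  wc_sym : (Gam z B)^T = Gam z B;
  wc_below : forall u, l2norm u <= K * l2norm (Gam z B *m u);
  wc_B : forall x : 'cV[R]_n, l2norm (B *m x) <= K * l2norm x;
  wc_HB : forall x : 'cV[R]_n,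
    l2norm (((hess_lagr f c z)^T - B) *m x) <= 2 * K * l2norm x;
  wc_split : forall x : 'cV[R]_n, exists xN xR : 'cV[R]_n,
    [/\ x = xN + xR, jac c (primal z) *m xN = 0 &
        l2norm xR <= K * l2norm (jac c (primal z) *m x)];
  wc_tangent : forall x : 'cV[R]_n, jac c (primal z) *m x = 0 ->
    xB * l2norm x ^+ 2 <= dotp x (B *m x) }.

Lemma kkt_jac_sub_mul z B d :
  M z *m d - Gam z B *m d = col_mx (((hess_lagr f c z)^T - B) *m primal d) 0.
Proof.
rewrite -{1 2}[d]vsubmxK /kkt_jac /kkt_mx !mul_block_col !mul0mx !addr0.
rewrite opp_col_mx add_col_mx subrr opprD addrACA subrr addr0 -/(primal d).
by rewrite mulmxBl.
Qed.

Lemma wc_solvable K xB z B (b : 'cV[R]_(n + m)) :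
  well_conditioned K xB z B -> exists d, Gam z B *m d = b.
Proof.
move=> wc; have uG : Gam z B \in unitmx.
  rewrite -unitmx_tr -row_free_unit; apply/inj_row_free => v h.
  apply: trmx_inj; apply/eqP; rewrite trmx0 -l2norm_eq0 eq_le l2norm_ge0 andbT.
  have E : Gam z B *m v^T = 0 by rewrite -[X in X *m _]trmxK -trmx_mul h trmx0.
  by have := wc_below wc v^T; rewrite E l2norm0 mulr0.
by exists (invmx (Gam z B) *m b); rewrite mulmxA mulmxV// mul1mx.
Qed.

Lemma wc_opnorm K xB z B : (0 < n + m)%N -> 0 < K -> well_conditioned K xB z B ->
  K^-1 <= opnorm (Gam z B).
Proof.
move=> nm0 K0 wc; pose e : 'cV[R]_(n + m) := delta_mx (Ordinal nm0) 0.
have e1 : l2norm e = 1 by exact: l2norm_delta.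
have := wc_below wc e; have := opnormP (Gam z B) e; rewrite e1 mulr1 => h1 h2.
rewrite -div1r ler_pdivrMr// mulrC; apply: le_trans h2 _.
by apply: ler_wpM2l => //; exact: ltW.
Qed.

Lemma l2norm_weights (e1 e2 : R) u : 0 <= e1 -> 0 <= e2 ->
  l2norm (weights e1 e2 u) <= (e1 + e2) * l2norm u.
Proof.
move=> e10 e20; apply: le_trans (l2norm_col_mx_le _ _) _; rewrite !l2normZ !ger0_norm//.
rewrite mulrDl addrC; apply: lerD; apply: ler_wpM2l => //.
  exact: l2norm_dual_var.
exact: l2norm_primal.
Qed.

Lemma wc_step_norm K xB z B d (eps : R) : 0 <= K -> eps <= 1 ->
  well_conditioned K xB z B ->
  l2norm (Gam z B *m d + g z) <= eps * l2norm (g z) ->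
  l2norm d <= 2 * K * l2norm (g z).
Proof.
move=> K0 eps1 wc hr; apply: le_trans (wc_below wc d) _.
rewrite (mulrC 2) -mulrA; apply: ler_wpM2l => //.
rewrite -[Gam z B *m d](addrK (g z)); apply: le_trans (l2normB _ _) _.
have : eps * l2norm (g z) <= 1 * l2norm (g z) by exact: ler_wpM2r.
lra.
Qed.

(** In order: [e2] is small against the curvature [xB] of [B] on the tangent
    space, [e1] dominates the terms in [|c|^2], and the relative residual [eps]
    is small against [e2]. The constant [c1] collects the terms quadratic in the
    normal component of the step. *)
Definition descent_params (K xB e1 e2 eps : R) : Prop :=
  let c1 := 2 * K ^+ 2 / xB + K + xB / 2 in
  [/\ 16 * K ^+ 2 * e2 <= xB / 2,
      e2 + 32 * K ^+ 2 / e2 + 2 * c1 * K ^+ 2 <= e1,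
      eps * (2 * c1 * K ^+ 2 + 4 * K + e1 + e2) <= e2 / 4 &
      0 <= eps <= 1].

(** With [r] the residual and [d = (x, v)], the Newton equations turn the
    directional derivative into
    [- x . B x + 2 c . v - e1 |c|^2 - e2 |grad_x L|^2] plus the effects of
    [H - B] and [r]. The normal part of [x] is of the order of [|c| + |r|], and
    the tangential part is absorbed by the curvature of [B]; Young's inequality
    distributes the cross terms so that three quarters of [e2 |g|^2] survive, and
    the residual takes away at most another quarter. *)
Lemma descent_direction K xB e1 e2 eps z B d :
  Ck 2 setT f -> (forall i, Ck 2 setT (component c i)) ->
  1 <= K -> 0 < xB -> 0 < e1 -> 0 < e2 ->
  well_conditioned K xB z B -> descent_params K xB e1 e2 eps ->
  l2norm (Gam z B *m d + g z) <= eps * l2norm (g z) ->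
  dotp (grad (aug_lagr f c e1 e2) z) d <= - e2 * l2norm (g z) ^+ 2 / 2.
Proof.
move=> f2 c2 K1 xB0 e10 e20 wc [P1 P2 P3 /andP[eps0 eps1]] hr.
have K0 : 0 <= K by rewrite (le_trans ler01).
have nd := wc_step_norm K0 eps1 wc hr.
rewrite (dotp_grad_aug_lagr f2 c2); set gz := g z in hr nd *.
set r := Gam z B *m d + gz in hr.
pose x := primal d; pose v := dual_var d; pose G := jac c (primal z).
pose a := primal gz; pose b := dual_var gz; pose rx := primal r; pose rl := dual_var r.
pose Hu := ((hess_lagr f c z)^T - B) *m x.
have dE : d = col_mx x v by rewrite vsubmxK.
have gE : gz = col_mx a b by rewrite vsubmxK.
have rE : r = col_mx rx rl by rewrite vsubmxK.
have [ra rb] : B *m x + G^T *m v + a = rx /\ G *m x + b = rl.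
  have : col_mx (B *m x + G^T *m v + a) (G *m x + b) = col_mx rx rl.
    rewrite -rE /r {1}gE {1}dE /kkt_mx mul_block_col mul0mx addr0 add_col_mx.
    by [].
  by move/eq_col_mx.
have MdE : M z *m d = col_mx (rx - a + Hu) (rl - b).
  have -> : M z *m d = Gam z B *m d + col_mx Hu 0 by rewrite -kkt_jac_sub_mul addrC subrK.
  have -> : Gam z B *m d = r - gz by rewrite /r addrK.
  by rewrite rE gE opp_col_mx !add_col_mx addr0.
(* From here on only the norms [ga] of the KKT map, [q] of the constraint, and
   [s], [p] of the tangential and normal parts of [x] matter. *)
set ga := l2norm gz in hr nd *.
have ga0 : 0 <= ga by exact: l2norm_ge0.
have sq : ga ^+ 2 = l2norm a ^+ 2 + l2norm b ^+ 2 by rewrite /ga gE sqr_l2norm_col_mx.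
have na : l2norm a <= ga by exact: l2norm_primal.
have nb : l2norm b <= ga by exact: l2norm_dual_var.
have nx : l2norm x <= 2 * K * ga by apply: le_trans (l2norm_primal _) nd.
have nv : l2norm v <= 2 * K * ga by apply: le_trans (l2norm_dual_var _) nd.
have nrx : l2norm rx <= eps * ga by apply: le_trans (l2norm_primal _) hr.
have nrl : l2norm rl <= eps * ga by apply: le_trans (l2norm_dual_var _) hr.
have Ax : dotp a x = dotp rx x - dotp x (B *m x) + dotp v b - dotp v rl.
  rewrite -ra !dotpDl (dotp_mulmxl G^T) trmxK -rb dotpDr (dotpC (B *m x)); ring.
have DE : dotp gz d + dotp (weights e1 e2 gz) (M z *m d) =
    - dotp x (B *m x) + 2 * dotp b v - e1 * l2norm b ^+ 2 - e2 * l2norm a ^+ 2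
    + e2 * dotp a Hu + (dotp rx x - dotp v rl + e2 * dotp a rx + e1 * dotp b rl).
  rewrite MdE /weights -/a -/b {1}gE dE !dotp_col_mx !dotpZl.
  by rewrite !(dotpDr, dotpNr) -!l2norm_sqr Ax (dotpC v b); ring.
rewrite DE.
have E4 : dotp rx x - dotp v rl + e2 * dotp a rx + e1 * dotp b rl <=
    eps * (4 * K + e1 + e2) * ga ^+ 2.
  have t1 : dotp rx x <= (eps * ga) * (2 * K * ga).
    by apply: le_trans (dotp_le _ _) _; exact: ler_pM.
  have t2 : - dotp v rl <= (2 * K * ga) * (eps * ga).
    by rewrite -dotpNl; apply: le_trans (dotp_le _ _) _; rewrite l2normN; exact: ler_pM.
  have t3 : e2 * dotp a rx <= e2 * (ga * (eps * ga)).
    by apply: ler_wpM2l; [exact: ltW|apply: le_trans (dotp_le _ _) _; exact: ler_pM].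
  have t4 : e1 * dotp b rl <= e1 * (ga * (eps * ga)).
    by apply: ler_wpM2l; [exact: ltW|apply: le_trans (dotp_le _ _) _; exact: ler_pM].
  lra.
have [xN [xR [xE GN nR]]] := wc_split wc x.
set s := l2norm xN; set p := l2norm xR in nR.
have s0 : 0 <= s by exact: l2norm_ge0.
have p0 : 0 <= p by exact: l2norm_ge0.
set q := l2norm b in sq nb *; have q0 : 0 <= q by exact: l2norm_ge0.
have hp : p ^+ 2 <= 2 * K ^+ 2 * (q ^+ 2 + eps * ga ^+ 2).
  have hp1 : p <= K * (q + eps * ga).
    apply: le_trans nR _; apply: ler_wpM2l => //.
    rewrite -/G (_ : G *m x = rl - b); last by rewrite -rb addrK.
    by apply: le_trans (l2normB _ _) _; rewrite addrC lerD2l.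
  apply: (@le_trans _ _ ((K * (q + eps * ga)) ^+ 2)).
    by rewrite ler_pXn2r// nnegrE// mulr_ge0// addr_ge0// mulr_ge0.
  have h1 : (eps * ga) ^+ 2 <= eps * ga ^+ 2.
    by rewrite exprMn; apply: ler_wpM2r; rewrite ?sqr_ge0// expr2 ler_piMl.
  have h2 := sqr_ge0 (q - eps * ga).
  rewrite exprMn (_ : 2 * K ^+ 2 * _ = K ^+ 2 * (2 * (q ^+ 2 + eps * ga ^+ 2))); last by ring.
  apply: ler_wpM2l; first exact: sqr_ge0.
  lra.
have hB : - dotp x (B *m x) <= - (xB / 2) * s ^+ 2 + (2 * K ^+ 2 / xB + K) * p ^+ 2.
  have b1 := wc_tangent wc GN; rewrite -/s in b1.
  have b2 : - dotp xN (B *m xR) <= s * (K * p).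
    rewrite -dotpNl; apply: le_trans (dotp_le _ _) _; rewrite l2normN.
    by apply: ler_wpM2l => //; exact: (wc_B wc).
  have b3 : - dotp xR (B *m xN) <= p * (K * s).
    rewrite -dotpNl; apply: le_trans (dotp_le _ _) _; rewrite l2normN.
    by apply: ler_wpM2l => //; exact: (wc_B wc).
  have b4 : - dotp xR (B *m xR) <= p * (K * p).
    rewrite -dotpNl; apply: le_trans (dotp_le _ _) _; rewrite l2normN.
    by apply: ler_wpM2l => //; exact: (wc_B wc).
  have xB2 : 0 < xB / 2 by rewrite divr_gt0.
  have y := young s (2 * K * p) xB2.
  have yE : (2 * K * p) ^+ 2 / (4 * (xB / 2)) = 2 * K ^+ 2 / xB * p ^+ 2.
    by field; rewrite gt_eqF.
  rewrite yE in y.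
  rewrite xE mulmxDr !dotpDl !dotpDr.
  move: (dotp xN (B *m xN)) (dotp xN (B *m xR)) (dotp xR (B *m xN)) (dotp xR (B *m xR)) b1 b2 b3 b4.
  move=> d1 d2 d3 d4 b1 b2 b3 b4.
  move: y; set y1 := 2 * K ^+ 2 / xB * p ^+ 2 => y.
  rewrite mulrDl -/y1; lra.
have hH : e2 * dotp a Hu <= e2 / 8 * l2norm a ^+ 2 + xB / 2 * (s ^+ 2 + p ^+ 2).
  have h1 : dotp a Hu <= l2norm a * (2 * K * (s + p)).
    apply: le_trans (dotp_le _ _) _; apply: ler_wpM2l => //.
    apply: le_trans (wc_HB wc x) _; apply: ler_wpM2l; first by rewrite mulr_ge0.
    by rewrite xE; exact: l2normD.
  have h8 : 0 < 8^-1 :> R by rewrite invr_gt0.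
  have y := young (l2norm a) (2 * K * (s + p)) h8.
  have yE : (2 * K * (s + p)) ^+ 2 / (4 * 8^-1) = 8 * K ^+ 2 * (s + p) ^+ 2 by field.
  rewrite yE in y.
  have sp : (s + p) ^+ 2 <= 2 * (s ^+ 2 + p ^+ 2) by have := sqr_ge0 (s - p); lra.
  have h2 : dotp a Hu <= 8^-1 * l2norm a ^+ 2 + 16 * K ^+ 2 * (s ^+ 2 + p ^+ 2).
    have h3 : 8 * K ^+ 2 * (s + p) ^+ 2 <= 8 * K ^+ 2 * (2 * (s ^+ 2 + p ^+ 2)).
      by apply: ler_wpM2l => //; rewrite mulr_ge0// sqr_ge0.
    lra.
  apply: (@le_trans _ _ (e2 * (8^-1 * l2norm a ^+ 2 + 16 * K ^+ 2 * (s ^+ 2 + p ^+ 2)))).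
    by apply: ler_wpM2l => //; exact: ltW.
  rewrite mulrDr; apply: lerD; first by rewrite mulrA.
  rewrite mulrA (mulrC e2); apply: ler_wpM2r => //.
  by rewrite addr_ge0 ?sqr_ge0.
have hb : 2 * dotp b v <= e2 / 8 * ga ^+ 2 + 32 * K ^+ 2 / e2 * q ^+ 2.
  have h1 : 2 * dotp b v <= ga * (4 * K * q).
    have : dotp b v <= q * (2 * K * ga).
      by apply: le_trans (dotp_le _ _) _; exact: ler_wpM2l.
    lra.
  have e8 : 0 < e2 / 8 by rewrite divr_gt0.
  apply: le_trans h1 _; apply: le_trans (young _ _ e8) _; rewrite lerD2l.
  by rewrite le_eqVlt; apply/orP; left; apply/eqP; field; rewrite gt_eqF.
set c1 := 2 * K ^+ 2 / xB + K + xB / 2 in P2 P3.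
have c10 : 0 <= c1 by rewrite /c1 !addr_ge0// divr_ge0// ?mulr_ge0 ?sqr_ge0// ltW.
have hc : c1 * p ^+ 2 <= 2 * c1 * K ^+ 2 * (q ^+ 2 + eps * ga ^+ 2).
  rewrite (_ : 2 * c1 * _ * _ = c1 * (2 * K ^+ 2 * (q ^+ 2 + eps * ga ^+ 2))); last by ring.
  exact: ler_wpM2l.
have c1E : c1 * p ^+ 2 = (2 * K ^+ 2 / xB + K) * p ^+ 2 + xB / 2 * p ^+ 2.
  by rewrite -mulrDl.
have P2q : (e2 + 32 * K ^+ 2 / e2 + 2 * c1 * K ^+ 2) * q ^+ 2 <= e1 * q ^+ 2.
  by apply: ler_wpM2r => //; exact: sqr_ge0.
have P3g : eps * (2 * c1 * K ^+ 2 + 4 * K + e1 + e2) * ga ^+ 2 <= e2 / 4 * ga ^+ 2.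
  by apply: ler_wpM2r => //; exact: sqr_ge0.
have e2q : 0 <= e2 * q ^+ 2 by rewrite mulr_ge0 ?sqr_ge0// ltW.
have sqe : e2 * ga ^+ 2 = e2 * l2norm a ^+ 2 + e2 * q ^+ 2 by rewrite sq mulrDr.
move: E4 hB hH hb hc P2q P3g c1E sqe.
set k1 := 2 * K ^+ 2 / xB + K; set k2 := 32 * K ^+ 2 / e2.
move: (dotp x (B *m x)) (dotp b v) (dotp a Hu) => d1 d2 d3.
move: (dotp rx x - _ + _ + _) => d4.
move: k1 k2 c1 {P2 P3 c10} => k1 k2 c1; lra.
Qed.

End Conditioning.

(** * Acceptance of the unit step *)

Section FullStep.
Variables (R : realType) (n m : nat).
Variables (f : 'cV[R]_n -> R) (c : 'cV[R]_n -> 'cV[R]_m).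
Hypothesis f2 : Ck 2 setT f.
Hypothesis c2 : forall i, Ck 2 setT (component c i).
Implicit Types (z d u : 'cV[R]_(n + m)) (B : 'M[R]_n).
Notation g := (grad_lagr f c).
Notation M := (kkt_jac f c).
Notation Gam z B := (kkt_mx B (jac c (primal z))).

(** If the step nearly solves the linearized system [g + M d = 0], the KKT map is
    small at [z + d], so the penalty terms all but vanish there and the
    Lagrangian has changed by about [g . d / 2]: the augmented Lagrangian
    decreases by about half of its directional derivative. With
    [a = K^2 eps |g|^2] the errors are at most [3 a] and [4 a] in the Lagrangian,
    and [2 (e1 + e2) a] and [13 (e1 + e2) a] in the penalty terms, whence the
    constants [7] and [15]. *)
Lemma armijo_full_step K xB e1 e2 beta eps z B d :
  1 <= K -> 0 < e1 -> 0 < e2 -> beta < 2^-1 ->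
  well_conditioned f c K xB z B ->
  0 <= eps <= 1 -> eps * (K ^+ 2 * (7 + 15 * (e1 + e2))) <= (2^-1 - beta) * e2 / 2 ->
  l2norm (Gam z B *m d + g z) <= eps * l2norm (g z) ->
  l2norm (M z *m d - Gam z B *m d) <= eps * l2norm d ->
  (forall t, 0 <= t <= 1 ->
     l2norm (g (z + t *: d) - g z - t *: (M z *m d)) <= eps * l2norm d) ->
  dotp (grad (aug_lagr f c e1 e2) z) d <= - e2 * l2norm (g z) ^+ 2 / 2 ->
  aug_lagr f c e1 e2 (z + d) <=
    aug_lagr f c e1 e2 z + beta * dotp (grad (aug_lagr f c e1 e2) z) d.
Proof.
move=> K1 e10 e20 b2 wc /andP[eps0 eps1] He hr hM hT.
have K0 : 0 <= K by rewrite (le_trans ler01).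
have nd := wc_step_norm K0 eps1 wc hr.
rewrite (dotp_grad_aug_lagr f2 c2) !aug_lagrE.
have := lagr_at_expansion f2 c2 hT.
have := hT 1; rewrite ler01 lexx !scale1r => /(_ isT) hT1.
set gz := g z in hr nd hT1 *; set gp := g (z + d) in hT1 *.
set ga := l2norm gz in hr nd *.
have ga0 : 0 <= ga by exact: l2norm_ge0.
pose s := M z *m d + gz.
have K1g : ga <= K * ga by rewrite ler_peMl.
have ege : 0 <= eps * ga by exact: mulr_ge0.
have ns : l2norm s <= 3 * K * (eps * ga).
  have -> : s = (Gam z B *m d + gz) + (M z *m d - Gam z B *m d).
    by rewrite addrC addrA subrK.
  apply: le_trans (l2normD _ _) _.
  have h1 : eps * l2norm d <= eps * (2 * K * ga) by exact: ler_wpM2l.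
  have h2 : eps * ga <= eps * (K * ga) by exact: ler_wpM2l.
  move: hr hM; set x1 := l2norm _; set x2 := l2norm _; lra.
have ngp : l2norm gp <= 5 * K * (eps * ga).
  have -> : gp = (gp - gz - M z *m d) + s.
    by rewrite /s addrA subrK subrK.
  apply: le_trans (l2normD _ _) _.
  have h1 : eps * l2norm d <= eps * (2 * K * ga) by exact: ler_wpM2l.
  move: hT1 ns h1; set x1 := l2norm _; set x2 := l2norm _; lra.
have MdE : M z *m d = s - gz by rewrite addrK.
rewrite MdE !dotpBr (dotpC d gz).
have e12 : 0 <= e1 + e2 by rewrite addr_ge0// ltW.
have ds : dotp d s <= 6 * (K ^+ 2 * (eps * ga ^+ 2)).
  apply: le_trans (dotp_le _ _) _.
  apply: (@le_trans _ _ (2 * K * ga * (3 * K * (eps * ga)))); first exact: ler_pM.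
  by rewrite le_eqVlt; apply/orP; left; apply/eqP; ring.
have dd : eps * l2norm d ^+ 2 <= 4 * (K ^+ 2 * (eps * ga ^+ 2)).
  have -> : 4 * (K ^+ 2 * (eps * ga ^+ 2)) = eps * (2 * K * ga) ^+ 2 by ring.
  by apply: ler_wpM2l => //; rewrite ler_pXn2r// nnegrE// !mulr_ge0.
have ws : - dotp (weights e1 e2 gz) s <= 3 * (e1 + e2) * (K ^+ 2 * (eps * ga ^+ 2)).
  rewrite -dotpNr; apply: le_trans (dotp_le _ _) _; rewrite l2normN.
  apply: (@le_trans _ _ ((e1 + e2) * ga * (3 * K * (eps * ga)))).
    by apply: ler_pM => //; apply: l2norm_weights; exact: ltW.
  rewrite (_ : _ * _ * (3 * _ * _) = 3 * (e1 + e2) * (eps * ga * (K * ga))); last by ring.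
  rewrite (_ : K ^+ 2 * _ = eps * ga * (K * (K * ga))); last by ring.
  apply: ler_wpM2l; first by rewrite mulr_ge0.
  by apply: ler_wpM2l => //; apply: ler_wpM2l.
have wp : dotp (weights e1 e2 gp) gp <= 25 * (e1 + e2) * (K ^+ 2 * (eps * ga ^+ 2)).
  apply: le_trans (dotp_le _ _) _.
  apply: (@le_trans _ _ ((e1 + e2) * (5 * K * (eps * ga)) * (5 * K * (eps * ga)))).
    apply: ler_pM => //; apply: le_trans (l2norm_weights _ (ltW e10) (ltW e20)) _.
    exact: ler_wpM2l.
  rewrite (_ : (e1 + e2) * _ * _ = 25 * (e1 + e2) * (K ^+ 2 * (eps * (eps * ga ^+ 2)))); last by ring.
  apply: ler_wpM2l; first by rewrite mulr_ge0.
  apply: ler_wpM2l; first exact: sqr_ge0.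
  by rewrite ler_piMl// mulr_ge0// sqr_ge0.
have Hg : eps * (K ^+ 2 * (7 + 15 * (e1 + e2))) * ga ^+ 2 <= (2^-1 - beta) * e2 / 2 * ga ^+ 2.
  by apply: ler_wpM2r => //; exact: sqr_ge0.
set D := _ + (dotp (weights e1 e2 gz) s - _).
move=> hL hD.
have Hb : (2^-1 - beta) * D <= (2^-1 - beta) * (- e2 * ga ^+ 2 / 2).
  by apply: ler_wpM2l => //; rewrite subr_ge0 ltW.
have T0 : 0 <= K ^+ 2 * (eps * ga ^+ 2) by rewrite !mulr_ge0 ?sqr_ge0.
have T1 : 0 <= (e1 + e2) * (K ^+ 2 * (eps * ga ^+ 2)) by rewrite mulr_ge0.
have DE : D = dotp gz d + (dotp (weights e1 e2 gz) s - dotp (weights e1 e2 gz) gz) by [].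
move: hL ds dd ws wp Hg Hb T1 DE.
move: (lagr_at f c (z + d)) (lagr_at f c z) (dotp d s) (eps * l2norm d ^+ 2) => l1 l0 x1 x2.
move: (dotp (weights e1 e2 gz) s) (dotp (weights e1 e2 gp) gp) (dotp (weights e1 e2 gz) gz) (dotp gz d).
move=> x3 x4 x5 x6.
rewrite (_ : eps * (K ^+ 2 * (7 + 15 * (e1 + e2))) * ga ^+ 2 =
  7 * (K ^+ 2 * (eps * ga ^+ 2)) + 15 * ((e1 + e2) * (K ^+ 2 * (eps * ga ^+ 2)))); last by ring.
rewrite -!(mulrA _ (e1 + e2)).
move: T0; set Z := K ^+ 2 * (eps * ga ^+ 2); set Y := (e1 + e2) * Z.
move: D hD => D hD T0 *; lra.
Qed.

End FullStep.

Section UpdatedParams.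
Variable R : realType.

(** With [v = nu ^ T], the product [e1 e2] grows like [v], while the relative
    residual decays like [v ^ -4] and [e2 / (e1 + e2)] only like [v ^ -3]. *)
Lemma descent_params_eventually (K xB a b nu : R) :
  1 <= K -> 0 < xB -> 0 < a -> 0 < b -> 1 < nu ->
  exists T0, forall T, (T0 <= T)%N ->
    descent_params K xB (a * (nu ^+ T) ^+ 2) (b / nu ^+ T) (K / (nu ^+ T) ^+ 4).
Proof.
move=> K1 xB0 a0 b0 nu1; have K0 : 0 < K by rewrite (lt_le_trans ltr01).
pose c1 := 2 * K ^+ 2 / xB + K + xB / 2.
have c10 : 0 <= c1 by rewrite /c1 !addr_ge0// ?divr_ge0// ?mulr_ge0 ?sqr_ge0// ltW.
have K20 : 0 <= K ^+ 2 by exact: sqr_ge0.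
pose q2 := b + 32 * K ^+ 2 / b + 2 * c1 * K ^+ 2.
pose q3 := 2 * c1 * K ^+ 2 + 4 * K + a + b.
have q20 : 0 <= q2 by rewrite /q2 !addr_ge0 ?divr_ge0 ?mulr_ge0// ltW.
have q30 : 0 <= q3.
  by rewrite /q3 !addr_ge0 ?mulr_ge0 ?(ltW a0) ?(ltW b0) ?(ltW K0).
pose v0 := 32 * K ^+ 2 * b / xB + q2 / a + 4 * K * q3 / b + K.
have t1 : 0 <= 32 * K ^+ 2 * b / xB by rewrite divr_ge0 ?mulr_ge0// ltW.
have t2 : 0 <= q2 / a by rewrite divr_ge0// ltW.
have t3 : 0 <= 4 * K * q3 / b by rewrite divr_ge0 ?mulr_ge0// ltW.
have [T0 hT0] := exprn_unbounded v0 nu1; exists T0 => T /hT0.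
move: (nu ^+ T) => v hv.
have v1 : 32 * K ^+ 2 * b / xB <= v by move: hv; rewrite /v0; lra.
have v2 : q2 / a <= v by move: hv; rewrite /v0; lra.
have v3 : 4 * K * q3 / b <= v by move: hv; rewrite /v0; lra.
have v4 : K <= v by move: hv; rewrite /v0; lra.
have v5 : 1 <= v by exact: le_trans v4.
have v_gt0 : 0 < v by exact: lt_le_trans v5.
have vv : v <= v ^+ 2 by rewrite expr2 ler_peMl// ltW.
rewrite ler_pdivrMr// in v1; rewrite ler_pdivrMr// in v2; rewrite ler_pdivrMr// in v3.
rewrite /descent_params -/c1; split.
- rewrite mulrA ler_pdivrMr//; lra.
- apply: (@le_trans _ _ (q2 * v)).
    rewrite /q2 2!(mulrDl _ _ v); apply: lerD; first (apply: lerD).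
    + by rewrite ler_pdivrMr// -mulrA ler_peMr ?(ltW b0)// mulr_ege1.
    + by rewrite le_eqVlt; apply/orP; left; apply/eqP; field; rewrite !gt_eqF.
    + by apply: ler_peMr => //; apply: mulr_ge0 => //; exact: mulr_ge0.
  apply: (@le_trans _ _ (v * a * v)); first by apply: ler_wpM2r => //; exact: ltW.
  by rewrite le_eqVlt; apply/orP; left; apply/eqP; ring.
- have h : 2 * c1 * K ^+ 2 + 4 * K + a * v ^+ 2 + b / v <= q3 * v ^+ 2.
    have v21 : 1 <= v ^+ 2 by exact: le_trans vv.
    have h1 : 0 <= (2 * c1 * K ^+ 2 + 4 * K) * (v ^+ 2 - 1).
      by rewrite mulr_ge0 ?subr_ge0// addr_ge0 ?mulr_ge0// ltW.
    have h2 : b / v <= b * v ^+ 2.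
      by rewrite ler_pdivrMr// -mulrA ler_peMr ?(ltW b0)// mulr_ege1.
    rewrite /q3; lra.
  have v40 : 0 < v ^+ 4 by rewrite exprn_gt0.
  apply: (@le_trans _ _ (K / v ^+ 4 * (q3 * v ^+ 2))).
    by apply: ler_wpM2l => //; rewrite divr_ge0// ltW.
  rewrite (_ : K / v ^+ 4 * (q3 * v ^+ 2) = (4 * K * q3) / (4 * v ^+ 2)); last first.
    by field; rewrite gt_eqF.
  rewrite ler_pdivrMr ?mulr_gt0 ?exprn_gt0//.
  rewrite (_ : b / v / 4 * (4 * v ^+ 2) = v * b)//.
  by field; rewrite gt_eqF.
- have v40 : 0 < v ^+ 4 by rewrite exprn_gt0.
  rewrite divr_ge0 ?(ltW K0) ?(ltW v40)//= ler_pdivrMr// mul1r.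
  apply: le_trans v4 _; rewrite (_ : v ^+ 4 = v * v ^+ 3); last by ring.
  by rewrite ler_peMr ?(ltW v_gt0)// exprn_ege1.
Qed.

End UpdatedParams.

(** * Uniform conditioning of the iterates *)

Section Uniform.
Variables (R : realType) (n m : nat).
Variables (f : 'cV[R]_n -> R) (c : 'cV[R]_n -> 'cV[R]_m).
Hypothesis f2 : Ck 2 setT f.
Hypothesis c2 : forall i, Ck 2 setT (component c i).
Variables (X : set 'cV[R]_n) (Lam : set 'cV[R]_m) (xi xB Ups C : R).
Hypotheses (xi0 : 0 < xi) (xB0 : 0 < xB) (Ups0 : 0 < Ups) (C0 : 0 <= C).
Hypothesis MC : forall z : 'cV[R]_(n + m), X (primal z) /\ Lam (dual_var z) ->
  forall p q, `|kkt_jac f c z p q| <= C.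

Record regular (z : 'cV[R]_(n + m)) (B : 'M[R]_n) : Prop := Regular {
  reg_in : X (primal z) /\ Lam (dual_var z);
  reg_sym : B^T = B;
  reg_G : forall u : 'cV[R]_m, xi * l2norm u ^+ 2 <=
    dotp u (jac c (primal z) *m (jac c (primal z))^T *m u);
  reg_tangent : forall u : 'cV[R]_n, jac c (primal z) *m u = 0 ->
    xB * l2norm u ^+ 2 <= dotp u (B *m u);
  reg_B : opnorm B <= Ups }.

(** Each bound depends on the iterate only through the compact set and the
    constants of the assumptions. *)
Lemma regular_well_conditioned : exists2 K : R, 1 <= K &
  forall z B, regular z B -> well_conditioned f c K xB z B /\
    forall d, l2norm (kkt_jac f c z *m d) <= K * l2norm d.
Proof.
have [gb gb0 gbE] : exists2 gb : R, 0 <= gb & gb = m%:R * (n%:R * C).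
  by eexists; last reflexivity; rewrite !mulr_ge0.
have [hb hb0 hbE] : exists2 hb : R, 0 <= hb & hb = n%:R * (n%:R * C).
  by eexists; last reflexivity; rewrite !mulr_ge0.
have [mb mb0 mbE] : exists2 mb : R, 0 <= mb & mb = (n + m)%:R * ((n + m)%:R * C).
  by eexists; last reflexivity; rewrite !mulr_ge0.
have s0 : 0 <= gb / xi by rewrite divr_ge0// ltW.
have k1 := kkt_const_gt1 xi0 xB0 (ltW Ups0) gb0.
have U0 := ltW Ups0; set k := kkt_const xi xB Ups gb in k1; set s := gb / xi in s0.
pose K := k + Ups + hb + s + mb; have K1 : 1 <= K by rewrite /K; lra.
have [kK UK hK sK mK] : [/\ k <= K, Ups <= K, hb <= K, s <= K & mb <= K].
  by split; rewrite /K; lra.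
have hUK : hb + Ups <= 2 * K by lra.
exists K => //.
move=> z B [zin sB hG hT hB].
have nG u : l2norm (jac c (primal z) *m u) <= gb * l2norm u.
  by rewrite gbE; apply: l2norm_mulmx_le => i j; rewrite jacE -(kkt_jac_dl f); exact: MC.
have nH u : l2norm ((hess_lagr f c z)^T *m u) <= hb * l2norm u.
  rewrite hbE; apply: l2norm_mulmx_le => i j.
  by have := MC zin (lshift m i) (lshift m j); rewrite /kkt_jac block_mxEul.
have nB u : l2norm (B *m u) <= Ups * l2norm u.
  by apply: le_trans (opnormP _ _) _; apply: ler_wpM2r.
have wid a p (u : 'cV[R]_p) : a <= K -> a * l2norm u <= K * l2norm u.
  by move=> aK; apply: ler_wpM2r.
split; last first.
  move=> d; apply: le_trans (l2norm_mulmx_le _ (MC zin)) _; apply: wid.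
  by rewrite -mbE.
split.
- by rewrite /kkt_mx tr_block_mx sB trmxK trmx0.
- move=> u; apply: le_trans (kkt_bounded_below xi0 xB0 (ltW Ups0) gb0 nG nB hG hT u) _.
  exact: wid.
- move=> x; apply: le_trans (nB x) _; exact: wid.
- move=> x; rewrite mulmxBl; apply: le_trans (l2normB _ _) _.
  have h1 := nH x; have h2 := nB x.
  have h3 : (hb + Ups) * l2norm x <= 2 * K * l2norm x.
    exact: ler_wpM2r.
  lra.
- move=> x; have [xN [xR [h1 h2 h3]]] := kernel_range_split xi0 gb0 nG hG x.
  exists xN, xR; split=> //; apply: le_trans h3 _; exact: wid.
- exact: hT.
Qed.

(** In particular the threshold of the accuracy condition, which has [Psi] in its
    denominator, is a positive multiple of the norm of the KKT map. *)
Lemma Psi_ge1 (inp : inputs R n m) z B : (0 < m)%N -> 0 < xi_B inp -> regular z B ->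
  1 <= Psi c inp z B.
Proof.
move=> m0 xib [_ _ hG _ _]; rewrite /Psi.
have sg := least_singular_value_ge m0 xi0 hG.
set s := least_singular_value _ in sg *.
have s0 : 0 < s by apply: lt_le_trans sg; rewrite sqrtr_gt0.
have d0 : 0 < Num.min (xi_B inp) 1 by rewrite lt_min xib ltr01.
have d1 : Num.min (xi_B inp) 1 <= 1 by rewrite ge_min lexx orbT.
have e0 : 0 < Num.min (s ^+ 2) 1 by rewrite lt_min exprn_gt0// ltr01.
have e1 : Num.min (s ^+ 2) 1 <= 1 by rewrite ge_min lexx orbT.
have nu : 1 <= Num.max (opnorm B ^+ 2) 1 by rewrite le_max lexx orbT.
rewrite ler_pdivlMr ?mulr_gt0// mul1r.
apply: (@le_trans _ _ 1); last lra.
by rewrite mulr_ile1// ltW.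
Qed.

End Uniform.

(** * The inner loop *)

Section InnerLoop.
Variables (R : realType) (n m : nat).
Variables (f : 'cV[R]_n -> R) (c : 'cV[R]_n -> 'cV[R]_m) (inp : inputs R n m).
Hypothesis adm : admissible inp.
Notation g := (grad_lagr f c).
Notation Gam z B := (kkt_mx B (jac c (primal z))).

(** The parameters after [T] updates. Only a bound is kept for [delta], because
    the trial value may lower it further. *)
Definition params_at (T : nat) (e1 e2 del : R) : Prop :=
  [/\ e1 = eta1_init inp * (nu inp ^+ T) ^+ 2, e2 = eta2_init inp / nu inp ^+ T,
      0 < del & del * (nu inp ^+ T) ^+ 4 <= 1].

Lemma nu_gt1 : 1 < nu inp. Proof. by case: adm => _ _ _ _ []. Qed.
Lemma nuX_ge1 T : 1 <= nu inp ^+ T.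
Proof. by rewrite exprn_ege1// ltW// nu_gt1. Qed.
Lemma nuX_gt0 T : 0 < nu inp ^+ T.
Proof. exact: lt_le_trans (nuX_ge1 T). Qed.

Lemma params_at_bounds T e1 e2 del : params_at T e1 e2 del ->
  [/\ 0 < e1, 0 < e2, 0 < del & del <= 1].
Proof.
move=> [-> -> d0 d1]; have [_ [a0 b0 _] _ _ _] := adm; split=> //.
- by rewrite mulr_gt0// exprn_gt0// nuX_gt0.
- by rewrite divr_gt0// nuX_gt0.
- by apply: le_trans d1; rewrite ler_peMr ?(ltW d0)// exprn_ege1// nuX_ge1.
Qed.

Variables (k : nat) (z : 'cV[R]_(n + m)) (B : 'M[R]_n) (S : nat -> sketch R (n + m)).
Variables (K xB : R).
Hypotheses (K1 : 1 <= K) (wc : well_conditioned f c K xB z B).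
Hypotheses (nm0 : (0 < n + m)%N) (Psi1 : 1 <= Psi c inp z B).
Implicit Types (w : inner_state R n m).

Let K0 : 0 < K. Proof. exact: lt_le_trans K1. Qed.
Let theta_gt0 : 0 < theta inp k. Proof. by case: adm => /(_ k)/andP[]. Qed.
Let op_ge : K^-1 <= opnorm (Gam z B). Proof. exact: wc_opnorm wc. Qed.
Let op_gt0 : 0 < opnorm (Gam z B).
Proof. by apply: lt_le_trans op_ge; rewrite invr_gt0. Qed.
Let Psi0 : 0 < Psi c inp z B. Proof. exact: lt_le_trans Psi1. Qed.

Lemma delta_trial_gt0 e1 e2 : 0 < e1 -> 0 < e2 -> 0 < delta_trial f c inp z B e1 e2.
Proof.
move=> e10 e20; have [_ _ _ /andP[_ b2] _] := adm.
have U0 : 0 < Upsilon f c z by rewrite /Upsilon lt_max ltr01 orbT.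
have s0 : 0 < 1 + e1 + e2 by rewrite !addr_gt0.
apply: divr_gt0; first by rewrite mulr_gt0// subr_gt0.
by apply: mulr_gt0; [apply: mulr_gt0 => //|]; exact: exprn_gt0.
Qed.

Lemma accurate_residual w : 0 < in_delta w -> accurate f c inp k z B w ->
  l2norm (Gam z B *m dir w + g z) <= K * (theta inp k * in_delta w) * l2norm (g z).
Proof.
move=> d0 /le_trans; apply; set x := theta _ _ * _; have x0 : 0 <= x by rewrite ltW// mulr_gt0.
have opP : 0 < opnorm (Gam z B) * Psi c inp z B by exact: mulr_gt0.
set y := l2norm (g z); set o := opnorm _ in opP *; set p := Psi _ _ _ _ in opP *.
rewrite ler_pdivrMr//.
rewrite [leRHS](_ : _ = x * y * (K * o * p)); last by ring.
have h : 1 <= K * o by rewrite -ler_pdivrMl// mulr1.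
by apply: ler_peMr; [apply: mulr_ge0 => //; exact: l2norm_ge0|exact: mulr_ege1].
Qed.

(** The threshold depends on the state only through [delta], so that it is fixed
    between two parameter updates. *)
Lemma small_residual_accurate w : 0 < in_delta w -> g z != 0 -> exists2 eta : R, 0 < eta &
  forall w', in_delta w' = in_delta w ->
    l2norm (Gam z B *m dir w' + g z) <= eta -> accurate f c inp k z B w'.
Proof.
move=> d0 g0; exists (theta inp k * in_delta w * l2norm (g z) / (opnorm (Gam z B) * Psi c inp z B)).
  have ng : 0 < l2norm (g z) by rewrite l2norm_gt0.
  by apply: divr_gt0; apply: mulr_gt0 => //; exact: mulr_gt0.
by move=> w' dE h; rewrite /accurate dE.
Qed.

Variable Tmax : nat.
Hypothesis descent_late : forall T w, (Tmax <= T)%N ->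
  params_at T (in_eta1 w) (in_eta2 w) (in_delta w) ->
  accurate f c inp k z B w -> descends f c z w.

Definition inner_inv w : Prop :=
  (exists2 T, (T <= Tmax)%N & params_at T (in_eta1 w) (in_eta2 w) (in_delta w)) /\
  dir w = sketch_iter (Gam z B) (g z) S (drawn w).

Lemma params_at_update T w : params_at T (in_eta1 w) (in_eta2 w) (in_delta w) ->
  let w' := update_params f c inp z B w in
  params_at T.+1 (in_eta1 w') (in_eta2 w') (in_delta w').
Proof.
move=> pT /=; have [e10 e20 d0 d1] := params_at_bounds pT.
have nu0 : 0 < nu inp by apply: lt_trans nu_gt1.
move: pT => [E1 E2 _ d4].
have e1' : 0 < in_eta1 w * nu inp ^+ 2 by rewrite mulr_gt0// exprn_gt0.
have e2' : 0 < in_eta2 w / nu inp by rewrite divr_gt0.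
have vS : nu inp ^+ T.+1 = nu inp * nu inp ^+ T by rewrite exprS.
have v0 := nuX_gt0 T; split; rewrite ?vS.
- by rewrite E1; ring.
- by rewrite E2 invfM mulrA mulrAC.
- by rewrite lt_min delta_trial_gt0// andbT divr_gt0// exprn_gt0.
- apply: le_trans d4; rewrite exprMn mulrA.
  apply: ler_wpM2r; first by rewrite exprn_ge0// ltW.
  by rewrite -ler_pdivlMr ?exprn_gt0// ge_min lexx.
Qed.

Lemma inner_step_inv w : inner_inv w -> inner_inv (inner_step f c inp k z B S w).
Proof.
move=> [[T TT pT] dw]; rewrite /inner_step; case: ifPn => [na|].
  by split; [exists T|rewrite /= dw].
rewrite negbK => ac; case: ifPn => [nd|_]; last by split=> //; exists T.
split; last by [].
exists T.+1; last exact: params_at_update.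
by rewrite ltnNge; apply/negP => /descent_late/(_ pT ac); apply/negP.
Qed.

Lemma inner_iter_inv w t : inner_inv w -> inner_inv (iter t (inner_step f c inp k z B S) w).
Proof. by move=> iw; elim: t => // t ih; rewrite iterS; exact: inner_step_inv. Qed.

Hypothesis converges : forall (eta : R) j0, 0 < eta -> exists2 j, (j0 <= j)%N &
  l2norm (Gam z B *m sketch_iter (Gam z B) (g z) S j + g z) <= eta.

Lemma eventually_accurate w : inner_inv w -> g z != 0 ->
  exists t, let w' := iter t (inner_step f c inp k z B S) w in
    [/\ accurate f c inp k z B w', in_eta1 w' = in_eta1 w,
        in_eta2 w' = in_eta2 w & in_delta w' = in_delta w].
Proof.
move=> iw g0; have [[T _ pT] dw] := iw.
have [_ _ d0 _] := params_at_bounds pT.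
have [eta eta0 heta] := small_residual_accurate d0 g0.
have [j jd hj] := converges (drawn w) eta0.
pose st := inner_step f c inp k z B S.
(* Before the first accurate state only sketches are drawn. *)
have draws t : (forall s, (s < t)%N -> ~~ accurate f c inp k z B (iter s st w)) ->
    let w' := iter t st w in
    [/\ drawn w' = (drawn w + t)%N, in_eta1 w' = in_eta1 w,
        in_eta2 w' = in_eta2 w & in_delta w' = in_delta w].
  elim: t => [|t ih] na /=; first by rewrite addn0.
  have [|h1 h2 h3 h4] := ih _; first by move=> s st'; apply: na; exact: ltnW.
  by rewrite /st /inner_step na//= h1 h2 h3 h4 addnS.
have ex : exists t, accurate f c inp k z B (iter t st w).
  apply: contrapT => /forallNP na.
  have [|h1 _ _ h4] := draws (j - drawn w)%N; first by move=> s _; apply/negP/na.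
  apply: (na (j - drawn w)%N); apply: heta => //.
  have [_ ->] := inner_iter_inv (j - drawn w) iw.
  by rewrite h1 subnKC.
have [t ht mint] := ex_minnP ex; exists t => /=.
have [|_ -> -> ->] := draws t; last by split.
by move=> s st'; apply/negP => /mint; rewrite leqNgt st'.
Qed.

(** An accurate state is always reached again, and at most [Tmax] updates can occur
    in total. *)
Lemma inner_loop_terminates w : inner_inv w -> g z != 0 ->
  exists t, let w' := iter t (inner_step f c inp k z B S) w in
    accurate f c inp k z B w' /\ descends f c z w'.
Proof.
move=> iw g0; pose st := inner_step f c inp k z B S.
have [[T _ pT] _] := iw; have [N] := ubnP (Tmax - T)%N.
elim: N => // N ih in w T iw pT *; rewrite ltnS => TN.
have [t [ac E1 E2 E3]] := eventually_accurate iw g0.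
have pT' : params_at T (in_eta1 (iter t st w)) (in_eta2 (iter t st w)) (in_delta (iter t st w)).
  by rewrite E1 E2 E3.
have [de|nde] := boolP (descends f c z (iter t st w)); first by exists t.
have TT : (T < Tmax)%N.
  by rewrite ltnNge; apply/negP => /descent_late/(_ pT' ac); apply/negP.
have E : iter t.+1 st w = update_params f c inp z B (iter t st w).
  by rewrite iterS {1}/st /inner_step ac /= nde.
have [||t' ht'] := ih (iter t.+1 st w) T.+1 (inner_iter_inv t.+1 iw).
- by rewrite E; exact: params_at_update.
- by apply: leq_trans TN; rewrite ltn_sub2l.
- by exists (t' + t.+1)%N; rewrite iterD.
Qed.

End InnerLoop.

(** * The outer loop *)

Section OuterLoop.
Variables (R : realType) (n m : nat).
Variables (f : 'cV[R]_n -> R) (c : 'cV[R]_n -> 'cV[R]_m) (inp : inputs R n m).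
Hypotheses (f2 : Ck 2 setT f) (c2 : forall i, Ck 2 setT (component c i)).
Hypotheses (adm : admissible inp) (nm0 : (0 < n + m)%N).
Variables (K xB : R).
Hypotheses (K1 : 1 <= K) (xB0 : 0 < xB).
Notation g := (grad_lagr f c).
Notation M := (kkt_jac f c).
Notation Gam z B := (kkt_mx B (jac c (primal z))).

Let K0 : 0 < K. Proof. exact: lt_le_trans K1. Qed.

Definition good_iterate (z : 'cV[R]_(n + m)) (B : 'M[R]_n) : Prop :=
  well_conditioned f c K xB z B /\ 1 <= Psi c inp z B.

(** The first bound serves the unit step and the rate, where [theta] matters, the
    second one descent, where the number of updates does. *)
Lemma accurate_residual_eps k z B T (w : inner_state R n m) : good_iterate z B ->
  params_at inp T (in_eta1 w) (in_eta2 w) (in_delta w) -> accurate f c inp k z B w ->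
  l2norm (Gam z B *m dir w + g z) <= K * theta inp k * l2norm (g z) /\
  l2norm (Gam z B *m dir w + g z) <= K / (nu inp ^+ T) ^+ 4 * l2norm (g z).
Proof.
move=> [wc P1] pT ac; have [_ _ d0 d1] := params_at_bounds adm pT.
have [_ _ _ d4] := pT; have [/(_ k)/andP[th0 th1] _ _ _ _] := adm.
have h := accurate_residual adm K1 wc nm0 P1 d0 ac.
split; apply: le_trans h _; apply: ler_wpM2r => //; rewrite -?mulrA.
  by apply: ler_wpM2l; [exact: ltW|rewrite ler_piMr// ltW].
apply: ler_wpM2l; first exact: ltW.
have v40 : 0 < (nu inp ^+ T) ^+ 4 by rewrite exprn_gt0// (nuX_gt0 adm).
rewrite -[leRHS]div1r ler_pdivlMr// -mulrA; apply: mulr_ile1 => //; first exact: ltW.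
by apply: mulr_ge0; exact: ltW.
Qed.

(** The conditions of [descent_params] involve the iterate only through [K] and
    the number of updates, so one threshold serves all iterates. *)
Lemma descent_after_updates : exists Tmax, forall k z B, good_iterate z B ->
  forall T (w : inner_state R n m), (Tmax <= T)%N ->
  params_at inp T (in_eta1 w) (in_eta2 w) (in_delta w) ->
  accurate f c inp k z B w -> descends f c z w.
Proof.
have [_ [a0 b0 _] _ _ _] := adm.
have [Tmax hT] := descent_params_eventually K1 xB0 a0 b0 (nu_gt1 adm).
exists Tmax => k z B gz T w TT pT ac.
have [e10 e20 _ _] := params_at_bounds adm pT.
have [_ hr] := accurate_residual_eps gz pT ac; have [wc _] := gz.
have [E1 E2 _ _] := pT.
have dp := hT T TT; rewrite -E1 -E2 in dp.
exact: (descent_direction f2 c2 K1 xB0 e10 e20 wc dp hr).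
Qed.

Variables (B : nat -> 'M[R]_n) (S : nat -> nat -> sketch R (n + m)).
Let st k := (run f c inp B S k).1.
Let z k := z_of f c inp B S k.
Hypothesis good : forall k, good_iterate (z k) (B k).
Variable Tmax : nat.
Hypothesis late : forall k z B, good_iterate z B ->
  forall T (w : inner_state R n m), (Tmax <= T)%N ->
  params_at inp T (in_eta1 w) (in_eta2 w) (in_delta w) ->
  accurate f c inp k z B w -> descends f c z w.

Let step k := inner_step f c inp k (z k) (B k) (S k).
Let init k := inner_init f c inp k (B k) (st k).
Let inv k := inner_inv f c inp (z k) (B k) (S k) Tmax.

Lemma inner_init_inv k T : (T <= Tmax)%N ->
  params_at inp T (eta1 (st k)) (eta2 (st k)) (delta (st k)) -> inv k (init k).
Proof.
move=> TT pT; have [e10 e20 d0 d1] := params_at_bounds adm pT; split=> //.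
exists T => //; have [E1 E2 _ d4] := pT; split=> //=.
  rewrite lt_min d0 /=; have [_ P1] := good k.
  exact: (delta_trial_gt0 f adm P1 e10 e20).
apply: le_trans d4; apply: ler_wpM2r; first by rewrite exprn_ge0// ltW// (nuX_gt0 adm).
by rewrite ge_min lexx.
Qed.

(** An iteration that does not end leaves the state unchanged, so the parameters
    stay in the finite family in every case. *)
Lemma run_params k : exists2 T, (T <= Tmax)%N &
  params_at inp T (eta1 (st k)) (eta2 (st k)) (delta (st k)).
Proof.
elim: k => [|k [T TT pT]].
  exists 0%N => //; have [_ [a0 b0 _] /andP[d0 d1] _ _] := adm.
  rewrite /st /=; split=> //; rewrite ?expr0 ?expr1n ?mulr1 ?divr1//; exact: ltW.
rewrite /st /=; case: xgetP => [p _|_]; last by exists T.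
move=> [t [i [_ _ _ _ ->]]] /=.
have iw := inner_init_inv TT pT.
have [wc P1] := good k.
have := inner_iter_inv adm P1 (@late k _ _ (good k)) t iw.
by move=> [[T' TT' pT'] _]; exists T'.
Qed.

(** The outcome of an iteration rejects a positive backtracking index when the unit
    step is acceptable, so the index is [0]. The case [g = 0] is separate: the
    accuracy threshold is then [0], and the zero direction already passes. *)
Lemma unit_step k :
  (forall (eta : R) j0, 0 < eta -> exists2 j, (j0 <= j)%N &
     l2norm (Gam (z k) (B k) *m sketch_iter (Gam (z k) (B k)) (g (z k)) (S k) j + g (z k)) <= eta) ->
  (forall T w, (T <= Tmax)%N -> params_at inp T (in_eta1 w) (in_eta2 w) (in_delta w) ->
     accurate f c inp k (z k) (B k) w -> descends f c (z k) w -> armijo f c inp (z k) w 1) ->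
  alpha_of f c inp B S k = 1 /\ exists T w, [/\ (T <= Tmax)%N,
    params_at inp T (in_eta1 w) (in_eta2 w) (in_delta w),
    accurate f c inp k (z k) (B k) w & z k.+1 = z k + dir w].
Proof.
move=> conv full; have [T TT pT] := run_params k.
have iw := inner_init_inv TT pT; have [wc P1] := good k.
have iter_inv t := inner_iter_inv adm P1 (@late k _ _ (good k)) t iw.
have full_iter t : accurate f c inp k (z k) (B k) (iter t (step k) (init k)) ->
    descends f c (z k) (iter t (step k) (init k)) ->
    armijo f c inp (z k) (iter t (step k) (init k)) 1.
  by move=> ac de; have [[T' TT' pT'] _] := iter_inv t; exact: full pT' ac de.
have [t [ac de]] : exists t, accurate f c inp k (z k) (B k) (iter t (step k) (init k)) /\
    descends f c (z k) (iter t (step k) (init k)).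
  have [g0|g0] := eqVneq (g (z k)) 0; last first.
    exact: (inner_loop_terminates adm K1 wc nm0 P1 (@late k _ _ (good k)) conv iw g0).
  exists 0%N; rewrite /accurate /descends /= g0 mulmx0 addr0 l2norm0.
  by rewrite dotp0r expr0n /= !mulr0 !mul0r.
rewrite /alpha_of /z /z_of /=.
case: xgetP => [p _|none]; last first.
  have [] := none (State (z k + rho inp ^+ 0 *: dir (iter t (step k) (init k)))
    (in_eta1 (iter t (step k) (init k))) (in_eta2 (iter t (step k) (init k)))
    (in_delta (iter t (step k) (init k))), rho inp ^+ 0).
  by exists t, 0%N; split=> //; rewrite expr0; exact: full_iter.
move=> [t' [i [ac' de' ar mini ->]]] /=.
have i0 : i = 0%N.
  case: i ar mini => // i _ /(_ 0%N isT); rewrite expr0.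
  by have := full_iter t' ac' de'; rewrite /z /z_of /step /init /st => ->.
have [[T' TT' pT'] _] := iter_inv t'.
rewrite i0 expr0 scale1r; split=> //.
by exists T', (iter t' (step k) (init k)).
Qed.

End OuterLoop.

(** * Local convergence *)

Section LocalConvergence.
Variables (R : realType) (n m : nat).
Variables (f : 'cV[R]_n -> R) (c : 'cV[R]_n -> 'cV[R]_m) (inp : inputs R n m).
Hypotheses (f2 : Ck 2 setT f) (c2 : forall i, Ck 2 setT (component c i)).
Hypotheses (adm : admissible inp) (nm0 : (0 < n + m)%N).
Variables (K xB CQ : R).
Hypotheses (K1 : 1 <= K) (xB0 : 0 < xB) (CQ0 : 0 <= CQ).
Notation g := (grad_lagr f c).
Notation M := (kkt_jac f c).
Notation Gam z B := (kkt_mx B (jac c (primal z))).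
Implicit Types (z zs d u : 'cV[R]_(n + m)).

Let K0 : 0 < K. Proof. exact: lt_le_trans K1. Qed.

Lemma kkt_perturbation z (B : 'M[R]_n) u : B^T = B ->
  l2norm (M z *m u - Gam z B *m u) <= opnorm (hess_lagr f c z - B) * l2norm u.
Proof.
move=> sB; rewrite kkt_jac_sub_mul; apply: le_trans (l2norm_col_mx_le _ _) _.
rewrite l2norm0 addr0 -{1}sB -linearB /=.
apply: le_trans (l2norm_trmx_le (opnorm_ge0 _) (opnormP _) _) _.
by apply: ler_wpM2l; [exact: opnorm_ge0|exact: l2norm_primal].
Qed.

Lemma grad_lagr_le z zs : g zs = 0 ->
  (forall u, l2norm (M z *m u) <= K * l2norm u) ->
  l2norm (g zs - g z - M z *m (zs - z)) <= CQ * l2norm (zs - z) ^+ 2 ->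
  l2norm (g z) <= K * l2norm (z - zs) + CQ * l2norm (z - zs) ^+ 2.
Proof.
move=> g0 hM hq; rewrite -l2normN (_ : - g z = (g zs - g z - M z *m (zs - z)) + M z *m (zs - z)).
  apply: le_trans (l2normD _ _) _; rewrite addrC (l2normBC z); apply: lerD => //; exact: hM.
by rewrite subrK g0 sub0r.
Qed.

(** [Gam (z + d - zs) = (M (z - zs) - g) + (Gam - M) (z - zs) + (Gam d + g)]:
    the error of the step is made of the curvature of the KKT map, the Hessian
    modification and the residual of the linear solve. *)
Lemma newton_rate z zs B d ct th : well_conditioned f c K xB z B ->
  g zs = 0 -> (forall u, l2norm (M z *m u) <= K * l2norm u) ->
  l2norm (g zs - g z - M z *m (zs - z)) <= CQ * l2norm (zs - z) ^+ 2 ->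
  (forall u, l2norm (M z *m u - Gam z B *m u) <= ct * l2norm u) ->
  0 <= th <= 1 -> l2norm (Gam z B *m d + g z) <= K * th * l2norm (g z) ->
  l2norm (z + d - zs) <= K * (ct + K ^+ 2 * th) * l2norm (z - zs)
    + K * (1 + K) * CQ * l2norm (z - zs) ^+ 2.
Proof.
move=> wc g0 hM hq hp /andP[th0 th1] hr; have hg := grad_lagr_le g0 hM hq.
set e := z - zs in hg *; apply: le_trans (wc_below wc _) _.
have -> : Gam z B *m (z + d - zs) =
    (g zs - g z - M z *m (zs - z)) - (M z *m e - Gam z B *m e) + (Gam z B *m d + g z).
  rewrite (_ : z + d - zs = e + d); last by rewrite addrAC.
  rewrite (_ : zs - z = - e); last by rewrite opprB.
  rewrite g0 sub0r mulmxN opprK mulmxDr.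
  move: (M z *m e) (Gam z B *m e) (Gam z B *m d) (g z) => a b a' b'.
  by apply/colP => i; rewrite !mxE; ring.
have he : l2norm (zs - z) = l2norm e by rewrite l2normBC.
rewrite he in hq; set s := l2norm e in hq hg *.
have s0 : 0 <= s by exact: l2norm_ge0.
have h1 := hp e; rewrite -/s in h1.
have h2 : K * th * l2norm (g z) <= K ^+ 2 * th * s + K * (CQ * s ^+ 2).
  apply: (@le_trans _ _ (K * th * (K * s + CQ * s ^+ 2))).
    by apply: ler_wpM2l => //; rewrite mulr_ge0// ltW.
  have : th * (K * (CQ * s ^+ 2)) <= 1 * (K * (CQ * s ^+ 2)).
    by apply: ler_wpM2r => //; rewrite !mulr_ge0 ?sqr_ge0// ltW.
  lra.
apply: (@le_trans _ _ (K * (CQ * s ^+ 2 + ct * s + (K ^+ 2 * th * s + K * (CQ * s ^+ 2))))).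
  apply: ler_wpM2l; first exact: ltW.
  apply: le_trans (l2normD _ _) _; apply: lerD; last exact: le_trans hr h2.
  by apply: le_trans (l2normB _ _) _; exact: lerD.
by rewrite le_eqVlt; apply/orP; left; apply/eqP; ring.
Qed.

Variables (B : nat -> 'M[R]_n) (S : nat -> nat -> sketch R (n + m)).
Variables (zs : 'cV[R]_(n + m)) (Ctau : R) (tau : nat -> R).
Let z k := z_of f c inp B S k.
Hypothesis good : forall k, good_iterate f c inp K xB (z k) (B k).
Hypothesis symB : forall k, (B k)^T = B k.
Hypothesis boundM : forall k u, l2norm (M (z k) *m u) <= K * l2norm u.
Hypothesis g_zs : g zs = 0.
Hypothesis quad : forall k,
  l2norm (g zs - g (z k) - M (z k) *m (zs - z k)) <= CQ * l2norm (zs - z k) ^+ 2.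
Hypothesis solves : forall k (eta : R) j0, 0 < eta -> exists2 j, (j0 <= j)%N &
  l2norm (Gam (z k) (B k) *m sketch_iter (Gam (z k) (B k)) (g (z k)) (S k) j + g (z k)) <= eta.
Hypothesis theta0 : theta inp k @[k --> \oo] --> (0 : R).
Hypotheses (tau_ge0 : forall k, 0 <= tau k) (tau0 : tau k @[k --> \oo] --> (0 : R)).
Hypothesis hessB : \forall k \near \oo,
  opnorm (hess_lagr f c (z k) - B k) <= Ctau * tau k.
Hypothesis z_cvg : z k @[k --> \oo] --> zs.

Lemma iterate_near rho : 0 < rho -> \forall k \near \oo, l2norm (z k - zs) < rho.
Proof.
move=> rho0; have N0 : 0 < (n + m)%:R + 1 :> R by rewrite ltr_wpDl.
have e0 : 0 < rho / ((n + m)%:R + 1) by rewrite divr_gt0.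
move/(@cvgrPdist_lt _ 'cV[R]_(n + m))/(_ _ e0) : z_cvg; apply: filterS => k hk.
rewrite l2normBC; apply: le_lt_trans (l2norm_le_normr _) _.
apply: (@le_lt_trans _ _ (((n + m)%:R + 1) * `|zs - z k|)).
  by apply: ler_wpM2r => //; rewrite lerDl.
by rewrite mulrC -ltr_pdivlMr.
Qed.

Lemma small_eventually (u : nat -> R) a eps : u k @[k --> \oo] --> (0 : R) ->
  0 <= a -> 0 < eps -> (forall k, 0 <= u k) -> \forall k \near \oo, a * u k <= eps.
Proof.
move=> u0 a0 eps0 uge; have a1 : 0 < a + 1 by rewrite ltr_wpDl.
have e0 : 0 < eps / (a + 1) by rewrite divr_gt0.
move/cvgrPdist_lt/(_ _ e0) : u0; apply: filterS => k.
rewrite sub0r normrN ger0_norm// ltr_pdivlMr// => h.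
by apply: le_trans (ltW h); rewrite mulrC; apply: ler_wpM2l => //; rewrite lerDl.
Qed.

(** Since the parameters take finitely many values, one tolerance [eps] serves
    the unit-step criterion for all of them, and accuracy, Hessian modification
    and linearization are all eventually within it. *)
Lemma local_convergence : \forall k \near \oo,
  alpha_of f c inp B S k = 1 /\
  l2norm (z k.+1 - zs) <=
    (K * (`|Ctau| + K ^+ 2)) * (theta inp k + tau k) * l2norm (z k - zs)
    + (K * (1 + K) * CQ) * l2norm (z k - zs) ^+ 2.
Proof.
have [th01 [a0 b0 _] _ /andP[_ be2] _] := adm.
have th_ge0 k : 0 <= theta inp k by have /andP[/ltW] := th01 k.
have th_le1 k : theta inp k <= 1 by have /andP[] := th01 k.
have [Tmax late] := descent_after_updates f2 c2 adm nm0 K1 xB0.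
pose V := nu inp ^+ Tmax; have V0 : 0 < V by exact: nuX_gt0.
pose E := eta1_init inp * V ^+ 2 + eta2_init inp.
pose D := K ^+ 2 * (7 + 15 * E); pose N := (2^-1 - beta inp) * (eta2_init inp / V) / 2.
have E0 : 0 <= E by rewrite addr_ge0 ?mulr_ge0 ?sqr_ge0// ltW.
have D0 : 0 < D by rewrite mulr_gt0 ?exprn_gt0// ltr_wpDr// mulr_ge0.
have N0 : 0 < N by rewrite divr_gt0// mulr_gt0 ?subr_gt0// divr_gt0.
pose eps := Num.min 1 (N / D).
have eps0 : 0 < eps by rewrite lt_min ltr01 divr_gt0.
have eps1 : eps <= 1 by rewrite ge_min lexx.
have epsD : eps * D <= N by rewrite -ler_pdivlMr// ge_min lexx orbT.
have [rho rho0 strict] := grad_lagr_strictly_differentiable f2 c2 zs eps0.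
pose W := 1 + 2 * K * (K + CQ).
have KC0 : 0 <= 2 * K * (K + CQ) by rewrite !mulr_ge0 ?addr_ge0 ?(ltW K0).
have W0 : 0 < W by rewrite ltr_wpDr.
have r0 : 0 < Num.min 1 (rho / W) by rewrite lt_min ltr01 divr_gt0.
have Near1 := iterate_near r0.
have Near2 := small_eventually theta0 (ltW K0) eps0 th_ge0.
have Near3 := small_eventually tau0 (normr_ge0 Ctau) eps0 tau_ge0.
near=> k.
have hz : l2norm (z k - zs) < Num.min 1 (rho / W) by near: k.
have hth : K * theta inp k <= eps by near: k.
have htau : `|Ctau| * tau k <= eps by near: k.
have hHB : opnorm (hess_lagr f c (z k) - B k) <= Ctau * tau k by near: k.
set e := l2norm (z k - zs) in hz *; have e0 : 0 <= e by exact: l2norm_ge0.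
have [e1 erho] : e <= 1 /\ e * W < rho.
  by move: hz; rewrite lt_min => /andP[/ltW -> h]; split=> //; rewrite -ltr_pdivlMr.
have [wc P1] := good k.
have pert u : l2norm (M (z k) *m u - Gam (z k) (B k) *m u) <= `|Ctau| * tau k * l2norm u.
  apply: le_trans (kkt_perturbation _ _ (symB k)) _; apply: ler_wpM2r => //.
  by apply: le_trans hHB _; apply: ler_wpM2r => //; exact: ler_norm.
have gle : l2norm (g (z k)) <= (K + CQ) * e.
  apply: le_trans (grad_lagr_le g_zs (boundM k) (quad k)) _.
  rewrite mulrDl lerD2l; apply: ler_wpM2l => //.
  by rewrite expr2 ler_piMr.
have full T (w : inner_state R n m) : (T <= Tmax)%N ->
    params_at inp T (in_eta1 w) (in_eta2 w) (in_delta w) ->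
    accurate f c inp k (z k) (B k) w -> descends f c (z k) w -> armijo f c inp (z k) w 1.
  move=> TT pT ac de; have [e10 e20 _ _] := params_at_bounds adm pT.
  have [E1 E2 _ _] := pT.
  have [hr1 _] := accurate_residual_eps adm nm0 K1 (good k) pT ac.
  have hr : l2norm (Gam (z k) (B k) *m dir w + g (z k)) <= eps * l2norm (g (z k)).
    by apply: le_trans hr1 _; exact: ler_wpM2r.
  have v1 := nuX_ge1 adm T; have v0 := nuX_gt0 adm T.
  have vV : nu inp ^+ T <= V by apply: ler_weXn2l => //; exact/ltW/nu_gt1.
  have EE : in_eta1 w + in_eta2 w <= E.
    rewrite E1 E2; apply: lerD.
      apply: ler_wpM2l; first exact: ltW.
      by rewrite ler_pXn2r// nnegrE ltW.
    by rewrite ler_pdivrMr// ler_peMr// ltW.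
  have e2V : eta2_init inp / V <= in_eta2 w.
    by rewrite E2; apply: ler_wpM2l; [exact: ltW|rewrite lef_pV2 ?posrE].
  have bnd : eps * (K ^+ 2 * (7 + 15 * (in_eta1 w + in_eta2 w))) <=
      (2^-1 - beta inp) * in_eta2 w / 2.
    apply: (@le_trans _ _ (eps * D)).
      apply: ler_wpM2l; first exact: ltW.
      apply: ler_wpM2l; first exact: sqr_ge0.
      lra.
    apply: le_trans epsD _; apply: ler_wpM2r => //.
    by apply: ler_wpM2l => //; rewrite subr_ge0 ltW.
  have nd : l2norm (dir w) <= 2 * K * l2norm (g (z k)).
    exact: wc_step_norm (ltW K0) eps1 wc hr.
  have dl : l2norm (dir w) <= 2 * K * (K + CQ) * e.
    by apply: le_trans nd _; rewrite -!mulrA; do 2![apply: ler_wpM2l; rewrite ?(ltW K0)//].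
  have near1 : l2norm (z k - zs) < rho.
    by apply: le_lt_trans erho; rewrite -/e ler_peMr// /W lerDl.
  have near2 : l2norm (z k + dir w - zs) < rho.
    apply: le_lt_trans erho; rewrite addrAC; apply: le_trans (l2normD _ _) _.
    by rewrite -/e /W mulrDr mulr1 lerD2l mulrC.
  rewrite /armijo scale1r mul1r.
  have hM : l2norm (M (z k) *m dir w - Gam (z k) (B k) *m dir w) <= eps * l2norm (dir w).
    by apply: le_trans (pert _) _; exact: ler_wpM2r.
  have e01 : 0 <= eps <= 1 by rewrite (ltW eps0).
  exact: (armijo_full_step f2 c2 K1 e10 e20 be2 wc e01 bnd hr hM (strict _ _ near1 near2) de).
have [al [T [w [TT pT ac zE]]]] := unit_step adm nm0 K1 good late (solves k) full.
split=> //; rewrite /z zE.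
have [hr _] := accurate_residual_eps adm nm0 K1 (good k) pT ac.
have th01k : 0 <= theta inp k <= 1 by rewrite th_ge0 th_le1.
apply: le_trans (newton_rate wc g_zs (boundM k) (quad k) pert th01k hr) _.
rewrite lerD2r; apply: ler_wpM2r => //.
rewrite -mulrA; apply: ler_wpM2l; first exact: ltW.
have : 0 <= `|Ctau| * theta inp k by rewrite mulr_ge0.
have : 0 <= K ^+ 2 * tau k by rewrite mulr_ge0 ?sqr_ge0.
lra.
Unshelve. all: by end_near. Qed.

End LocalConvergence.

Lemma limit_in_product (R : realType) n m (X : set 'cV[R]_n) (Lam : set 'cV[R]_m)
    (z : nat -> 'cV[R]_(n + m)) zs : compact X -> compact Lam ->
  (forall k, X (primal (z k)) /\ Lam (dual_var (z k))) ->
  z k @[k --> \oo] --> zs -> X (primal zs) /\ Lam (dual_var zs).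
Proof.
move=> cX cL hz zc.
have clX := compact_closed (@norm_hausdorff R 'cV[R]_n) cX.
have clL := compact_closed (@norm_hausdorff R 'cV[R]_m) cL.
have cl1 := (continuous_closedP _).1 (@primal_continuous R n m) _ clX.
have cl2 := (continuous_closedP _).1 (@dual_var_continuous R n m) _ clL.
have n1 : \forall k \near \oo, (@primal R n m @^-1` X) (z k).
  by apply: nearW => k; have [] := hz k.
have n2 : \forall k \near \oo, (@dual_var R n m @^-1` Lam) (z k).
  by apply: nearW => k; have [] := hz k.
by split; [exact: (closed_cvg _ cl1 n1 zs zc)|exact: (closed_cvg _ cl2 n2 zs zc)].
Qed.

Lemma grad_lagr_kkt (R : realType) n m (f : 'cV[R]_n -> R) (c : 'cV[R]_n -> 'cV[R]_m) x l :
  Ck 2 setT f -> (forall i, Ck 2 setT (component c i)) ->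
  grad f x + (jac c x)^T *m l = 0 -> c x = 0 -> grad_lagr f c (col_mx x l) = 0.
Proof.
move=> f2 c2 hx hc; rewrite /grad_lagr -(col_mx0 _ n m 1).
have -> : primal (col_mx x l) = x by exact: col_mxKu.
rewrite hc; congr col_mx; apply/colP => j.
rewrite (gradx_lagrE f2 c2) /primal /dual_var col_mxKu col_mxKd -hx mxE.
congr (_ + _); first by rewrite gradE.
by rewrite mxE; apply: eq_bigr => i _; rewrite trE mulrC.
Qed.

Theorem corollary4p4 (R : realType) (n m : nat)
  (f : 'cV[R]_n -> R) (c : 'cV[R]_n -> 'cV[R]_m)
  (inp : inputs R n m)
  (d : measure_display) (Om : measurableType d) (P : probability Om R)
  (B : nat -> Om -> 'M[R]_n) (S : nat -> nat -> Om -> sketch R (n + m))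
  (Pr : probability (borel_sketch R (n + m)) R)
  (xstar : 'cV[R]_n) (lstar : 'cV[R]_m)
  (X : set 'cV[R]_n) (Lam : set 'cV[R]_m)
  (xi_G Ups_B C_tau : R) (tau : nat -> R) :
  let z (k : nat) (w : Om) : 'cV[R]_(n + m) :=
    z_of f c inp (fun i => B i w) (fun i j => S i j w) k in
  let alpha (k : nat) (w : Om) : R :=
    alpha_of f c inp (fun i => B i w) (fun i j => S i j w) k in
  let G (k : nat) (w : Om) : 'M[R]_(m, n) := jac c (primal (z k w)) in
  let H (k : nat) (w : Om) : 'M[R]_n := hess_lagr f c (z k w) in
  let zstar : 'cV[R]_(n + m) := col_mx xstar lstar in
  (0 < m)%N ->
  Ck 2 setT f -> (forall i, Ck 2 setT (component c i)) ->
  (* inputs of the algorithm *)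
  admissible inp ->
  theta inp k @[k --> \oo] --> (0 : R) ->
  (forall k w, (B k w)^T = B k w) ->
  (* local solution with its multiplier *)
  local_solution f c xstar ->
  grad f xstar + (jac c xstar)^T *m lstar = 0 -> c xstar = 0 ->
  (* (i), the part on the set and the functions *)
  convex_set (X : set (convex_lmodType 'cV[R]_n)) -> compact X ->
  convex_set (Lam : set (convex_lmodType 'cV[R]_m)) -> compact Lam ->
  lipschitz_hess X f -> (forall i, lipschitz_hess X (component c i)) ->
  (* (ii), the constants *)
  0 < xi_G -> 0 < Ups_B ->
  (* (iii) *)
  fresh_iid P z B S Pr ->
  (exists pi : R, 0 < pi <= 1 /\
    forall u : 'cV[R]_(n + m), u != 0 ->
      (pi%:E <= Pr [set s : sketch R (n + m) | ((projT2 s)^T *m u != 0)%R])%E) ->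
  (* (iv) *)
  Ck 3 X f -> (forall i, Ck 3 X (component c i)) ->
  (* (v), the sequence *)
  (forall k, 0 <= tau k) -> tau k @[k --> \oo] --> (0 : R) ->
  exists C1 C2 : R, {ae P, forall w : Om,
    (* (i) *)
    (forall k, X (primal (z k w)) /\ Lam (dual_var (z k w))) ->
    (* (ii) *)
    (forall k,
      [/\ row_free (G k w),
          forall u : 'cV[R]_m,
            xi_G * l2norm u ^+ 2 <= dotp u (G k w *m (G k w)^T *m u),
          forall u : 'cV[R]_n, G k w *m u = 0 ->
            xi_B inp * l2norm u ^+ 2 <= dotp u (B k w *m u) &
          opnorm (B k w) <= Ups_B]) ->
    (* (v) *)
    (\forall k \near \oo, opnorm (H k w - B k w) <= C_tau * tau k) ->
    (* (vi) *)
    z k w @[k --> \oo] --> zstar ->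
    \forall k \near \oo,
      alpha k w = 1 /\
      l2norm (z k.+1 w - zstar) <=
        C1 * (theta inp k + tau k) * l2norm (z k w - zstar)
        + C2 * l2norm (z k w - zstar) ^+ 2}.
Proof.
move=> z alpha G H zstar m0 f2 c2 adm theta0 symB _ kktx kktc vX cX vL cL lf lc
  xiG0 Ups0 fresh [pi [/andP[pi0 _] sees]] _ _ tau_ge0 tau0.
have nm0 : (0 < n + m)%N by rewrite addn_gt0 m0 orbT.
have [_ [_ _ xB0] _ _ _] := adm.
have [C C0 hC] := kkt_jac_bounds f2 c2 cX vX cL lf lc.
have [CQ CQ0 hQ] := grad_lagr_quadratic f2 c2 cX vX cL vL lf lc.
have MC (y : 'cV[R]_(n + m)) : X (primal y) /\ Lam (dual_var y) ->
    forall p q, `|kkt_jac f c y p q| <= C.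
  by move=> yin p q; have [] := hC y y yin yin p q.
have [K K1 hK] := regular_well_conditioned xiG0 xB0 Ups0 C0 MC.
have pos (u : 'cV[R]_(n + m)) : u != 0 ->
    (0 < Pr [set s : sketch R (n + m) | ((projT2 s)^T *m u != 0)%R])%E.
  by move=> u0; apply: lt_le_trans (sees u u0); rewrite lte_fin.
have [L [D [eps [Ms [L0 eps0 Ms0 sens hD]]]]] := sensing_pattern_exists nm0 pos.
exists (K * (`|C_tau| + K ^+ 2)), (K * (1 + K) * CQ).
apply: filterS (ae_pattern_infinitely_often fresh hD) => w often zin reg hHB zc.
have reg_k k : regular c X Lam xi_G (xi_B inp) Ups_B (z k w) (B k w).
  by have [_ h1 h2 h3] := reg k; split=> //; exact: zin.
have good k : good_iterate f c inp K (xi_B inp) (z k w) (B k w).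
  have [wc _] := hK _ _ (reg_k k); split=> //.
  exact: Psi_ge1 (reg_k k).
have gz : grad_lagr f c zstar = 0 by exact: grad_lagr_kkt.
have zsin := limit_in_product cX cL zin zc.
apply: (local_convergence f2 c2 adm nm0 K1 xB0 CQ0 good _ _ gz _ _ theta0 tau_ge0 tau0 hHB zc).
- by move=> k; exact: symB.
- by move=> k; have [_] := hK _ _ (reg_k k).
- by move=> k; exact: (hQ _ _ (zin k) zsin).
- move=> k eta j0 eta0; have [wc _] := good k.
  have [dstar hd] := wc_solvable (- grad_lagr f c (z k w)) wc.
  exact: (sketch_iter_converges (wc_sym wc) hd L0 eps0 Ms0 sens (often k)).
Qed.
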